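(* Let $X_1,X_2$ be complex Banach spaces and let $\mathcal{A}_1\subseteq\mathcal{B}(X_1)$, $\mathcal{A}_2\subseteq\mathcal{B}(X_2)$ be standard operator algebras. Let $r,s$ be nonnegative integers with $r+s\geq1$ and set $m=r+s+1$. Let $\Phi:\mathcal{A}_1\to\mathcal{A}_2$ be a map whose range contains every operator in $\mathcal{B}(X_2)$ of rank at most two. Then $$\sigma_\pi(B^rAB^s)=\sigma_\pi(\Phi(B)^r\Phi(A)\Phi(B)^s)\quad\text{for all }A,B\in\mathcal{A}_1$$ if and only if one of the following holds: (1) there exist $\lambda\in\mathbb{C}$ with $\lambda^m=1$ and an invertible $T\in\mathcal{B}(X_1,X_2)$ such that $\Phi(A)=\lambda TAT^{-1}$ for all $A\in\mathcal{A}_1$; (2) $X_1,X_2$ are reflexive and there exist $\lambda\in\mathbb{C}$ with $\lambda^m=1$ and an invertible $T\in\mathcal{B}(X_1^*,X_2)$ such that $\Phi(A)=\lambda TA^*T^{-1}$ for all $A\in\mathcal{A}_1$ (where $A^*$ is the Banach-space adjoint of $A$).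
   Context: A standard operator algebra on a complex Banach space $X$ is a subalgebra of $\mathcal{B}(X)$ containing all finite rank operators; it need not be closed or unital. The peripheral spectrum of $T\in\mathcal{B}(X)$ is $\sigma_\pi(T)=\{z\in\sigma(T):|z|=r(T)\}$, where $\sigma(T)$ is the spectrum and $r(T)$ the spectral radius. *)

(* Defs.v *)
From Stdlib Require Import Reals List.
Open Scope R_scope.

Record Cplx := mkC { Cre : R; Cim : R }.
Definition C0 : Cplx := mkC 0 0.
Definition C1 : Cplx := mkC 1 0.
Definition Cadd (a b : Cplx) : Cplx := mkC (Cre a + Cre b) (Cim a + Cim b).
Definition Copp (a : Cplx) : Cplx := mkC (- Cre a) (- Cim a).
Definition Cmul (a b : Cplx) : Cplx :=
  mkC (Cre a * Cre b - Cim a * Cim b) (Cre a * Cim b + Cim a * Cre b).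
Definition Cabs (a : Cplx) : R := sqrt (Cre a * Cre a + Cim a * Cim a).
Fixpoint Cpow (a : Cplx) (n : nat) : Cplx :=
  match n with O => C1 | S k => Cmul a (Cpow a k) end.

Record CBanach := {
  car :> Type;
  vzero : car;
  vadd : car -> car -> car;
  vopp : car -> car;
  vscal : Cplx -> car -> car;
  vnorm : car -> R;
  vadd_assoc : forall x y z, vadd x (vadd y z) = vadd (vadd x y) z;
  vadd_comm : forall x y, vadd x y = vadd y x;
  vadd_0 : forall x, vadd vzero x = x;
  vadd_opp : forall x, vadd x (vopp x) = vzero;
  vscal_assoc : forall a b x, vscal a (vscal b x) = vscal (Cmul a b) x;
  vscal_1 : forall x, vscal C1 x = x;
  vscal_addv : forall a x y, vscal a (vadd x y) = vadd (vscal a x) (vscal a y);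
  vscal_adds : forall a b x, vscal (Cadd a b) x = vadd (vscal a x) (vscal b x);
  vnorm_eq0 : forall x, vnorm x = 0 -> x = vzero;
  vnorm_scal : forall a x, vnorm (vscal a x) = Cabs a * vnorm x;
  vnorm_triangle : forall x y, vnorm (vadd x y) <= vnorm x + vnorm y;
  vcomplete : forall u : nat -> car,
    (forall eps, 0 < eps -> exists N, forall p q, (N <= p)%nat -> (N <= q)%nat ->
        vnorm (vadd (u p) (vopp (u q))) < eps) ->
    exists l, forall eps, 0 < eps -> exists N, forall n, (N <= n)%nat ->
        vnorm (vadd (u n) (vopp l)) < eps
}.

Arguments vzero {c}. Arguments vadd {c}. Arguments vopp {c}.
Arguments vscal {c}. Arguments vnorm {c}.

Definition is_linear {X Y : CBanach} (T : X -> Y) : Prop :=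
  forall a x y, T (vadd x y) = vadd (T x) (T y) /\ T (vscal a x) = vscal a (T x).
Definition is_bounded {X Y : CBanach} (T : X -> Y) : Prop :=
  exists c, forall x, vnorm (T x) <= c * vnorm x.
Definition is_op {X Y : CBanach} (T : X -> Y) : Prop := is_linear T /\ is_bounded T.

Definition inverse_ops {X Y : CBanach} (T : X -> Y) (S : Y -> X) : Prop :=
  is_op T /\ is_op S /\ (forall x, S (T x) = x) /\ (forall y, T (S y) = y).
Definition invertible_op {X Y : CBanach} (T : X -> Y) : Prop :=
  exists S, inverse_ops T S.

Definition spectrum {X : CBanach} (T : X -> X) (z : Cplx) : Prop :=
  ~ invertible_op (fun x => vadd (T x) (vopp (vscal z x))).
Definition peripheral_spectrum {X : CBanach} (T : X -> X) (z : Cplx) : Prop :=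
  spectrum T z /\ is_lub (fun t => exists w, spectrum T w /\ t = Cabs w) (Cabs z).

Fixpoint lincomb {X : CBanach} (cs : list Cplx) (ys : list X) : X :=
  match cs, ys with
  | a :: cs', y :: ys' => vadd (vscal a y) (lincomb cs' ys')
  | _, _ => vzero
  end.
Definition in_span {X : CBanach} (ys : list X) (y : X) : Prop :=
  exists cs, length cs = length ys /\ y = lincomb cs ys.
Definition finite_rank {X Y : CBanach} (F : X -> Y) : Prop :=
  exists ys : list Y, forall x, in_span ys (F x).
Definition rank_le2 {X Y : CBanach} (F : X -> Y) : Prop :=
  exists y1 y2 : Y, forall x, exists a b, F x = vadd (vscal a y1) (vscal b y2).

(** A standard operator algebra: a (not necessarily closed or unital)
    subalgebra of B(X) containing all finite rank operators. *)
Definition standard_alg {X : CBanach} (A : (X -> X) -> Prop) : Prop :=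
  (forall T, A T -> is_op T) /\
  (forall S T, A S -> A T -> A (fun x => vadd (S x) (T x))) /\
  (forall a T, A T -> A (fun x => vscal a (T x))) /\
  (forall S T, A S -> A T -> A (fun x => S (T x))) /\
  (forall F : X -> X, is_op F -> finite_rank F -> A F).

Definition opow {X : CBanach} (A : X -> X) (n : nat) : X -> X :=
  Nat.iter n (fun g x => A (g x)) (fun x => x).
Definition prod_op {X : CBanach} (B : X -> X) (r : nat) (A : X -> X) (s : nat)
  : X -> X := fun x => opow B r (A (opow B s x)).

Definition in_dual {X : CBanach} (f : X -> Cplx) : Prop :=
  (forall a x y, f (vadd x y) = Cadd (f x) (f y) /\ f (vscal a x) = Cmul a (f x)) /\
  (exists c, forall x, Cabs (f x) <= c * vnorm x).
Definition dnorm_le {X : CBanach} (f : X -> Cplx) (a : R) : Prop :=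
  forall x, Cabs (f x) <= a * vnorm x.

Definition in_bidual {X : CBanach} (phi : (X -> Cplx) -> Cplx) : Prop :=
  (forall a f g, in_dual f -> in_dual g ->
     phi (fun x => Cadd (f x) (g x)) = Cadd (phi f) (phi g) /\
     phi (fun x => Cmul a (f x)) = Cmul a (phi f)) /\
  (exists c, forall f a, in_dual f -> dnorm_le f a -> Cabs (phi f) <= c * a).
Definition reflexive (X : CBanach) : Prop :=
  forall phi : (X -> Cplx) -> Cplx, in_bidual phi ->
    exists x : X, forall f, in_dual f -> phi f = f x.

Definition dual_inverse_ops {X Y : CBanach} (T : (X -> Cplx) -> Y) (S : Y -> (X -> Cplx))
  : Prop :=
  (forall a f g, in_dual f -> in_dual g ->
     T (fun x => Cadd (f x) (g x)) = vadd (T f) (T g) /\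
     T (fun x => Cmul a (f x)) = vscal a (T f)) /\
  (exists c, forall f a, in_dual f -> dnorm_le f a -> vnorm (T f) <= c * a) /\
  (forall y, in_dual (S y)) /\
  (forall a y y', S (vadd y y') = (fun x => Cadd (S y x) (S y' x)) /\
                  S (vscal a y) = (fun x => Cmul a (S y x))) /\
  (exists c, forall y, dnorm_le (S y) (c * vnorm y)) /\
  (forall f, in_dual f -> S (T f) = f) /\
  (forall y, T (S y) = y).

(* Main.v *)
(** A rank-one operator [x (x) f] has peripheral spectrum [{f x}], so [B^r (x (x) f) B^s] always has
    one peripheral value, whereas for [A] of rank at least two some [B] of rank two gives
    [B^r A B^s] two opposite peripheral values. Hence [Phi] preserves operators of rank at most one
    in both directions. Taking [B = x (x) f], of image [y (x) g], gives
    [f(x)^(m-2) f(A x) = g(y)^(m-2) g(Phi(A) y)], which forces [Phi] to be linear and injective.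
    A bilinear family of rank-one operators is [T x (x) S f] or [T f (x) S x], and comparing traces,
    [(S f)(T x) = lam f(x)] with [lam^m = 1]; the same relation then gives [Phi(A) T = lam T A]
    (resp. [lam T A^*]). Boundedness of [T] and [T^-1] follows from uniform boundedness, and
    reflexivity from the surjectivity of [S].

    For the converse in the dual case, [B^r A B^s] has to be compared with [B^s A B^r]; they have the
    same nonzero spectrum, and nonemptiness of the spectrum settles the quasinilpotent case. *)

From Stdlib Require Import Reals List Lra Lia Psatz Field Classical ClassicalEpsilon.
From Stdlib Require Import FunctionalExtensionality PropExtensionality ProofIrrelevance.
From mathcomp Require classical_sets.
From Coquelicot Require Import Coquelicot.
Require Import Defs.
Set Bullet Behavior "Strict Subproofs".
Open Scope R_scope.

(** * Complex scalars and vectors *)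

(** The range hypothesis matches the test operators: a bounded [B] of rank at most two always lies
    in the first algebra, and on the second space it is always a value of [Phi], so one rank
    criterion serves both sides. The rest of the forward direction uses only products with a
    rank-one factor, whose peripheral spectrum is a single explicit number. Comparing traces only
    gives equal m-th powers, so the root of unity could a priori depend on [x] and [f]. Equal powers
    force equal kernels, hence proportional functionals, and bilinearity makes the ratio constant.
    Both conclusions come from one abstract pairing of [U] with [W], read as X1 with its dual or the
    reverse. [T] and the map [w => S w] are at first only algebraically linear. Continuity is
    recovered because every functional on X2 is some [S w], and [S w] composed with [T] is a
    multiple of the pairing with [w]. Nonemptiness of the spectrum is proved from the ground up,
    with circle means in place of power series. A zero space has empty spectra, so it is treated
    separately. *)

Definition Csub (a b : Cplx) : Cplx := Cadd a (Copp b).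
Definition Cinv (a : Cplx) : Cplx :=
  let d := Cre a * Cre a + Cim a * Cim a in mkC (Cre a / d) (- Cim a / d).
Definition Cdiv (a b : Cplx) : Cplx := Cmul a (Cinv b).

Lemma Cplx_ext (a b : Cplx) : Cre a = Cre b -> Cim a = Cim b -> a = b.
Proof. destruct a, b; simpl; intros; subst; reflexivity. Qed.

Lemma Cplx_dec (a b : Cplx) : {a = b} + {a <> b}.
Proof. apply excluded_middle_informative. Qed.

Lemma Cplx_neq0 (a : Cplx) : a <> C0 -> Cre a * Cre a + Cim a * Cim a <> 0.
Proof.
  intros H E; apply H; apply Cplx_ext; simpl; nra.
Qed.

Lemma Cplx_field : field_theory C0 C1 Cadd Cmul Csub Copp Cdiv Cinv eq.
Proof.
  constructor.
  - constructor; intros; apply Cplx_ext; simpl; ring.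
  - intros E; injection E; lra.
  - reflexivity.
  - intros p Hp; apply Cplx_neq0 in Hp; apply Cplx_ext; simpl; field; exact Hp.
Qed.

Add Field Cplx_field_inst : Cplx_field.

Definition RtoC (x : R) : Cplx := mkC x 0.
Definition Ci : Cplx := mkC 0 1.

Lemma RtoC_add x y : RtoC (x + y) = Cadd (RtoC x) (RtoC y).
Proof. apply Cplx_ext; simpl; ring. Qed.

Lemma RtoC_mul x y : RtoC (x * y) = Cmul (RtoC x) (RtoC y).
Proof. apply Cplx_ext; simpl; ring. Qed.

Lemma RtoC_opp x : RtoC (- x) = Copp (RtoC x).
Proof. apply Cplx_ext; simpl; ring. Qed.

Lemma Cmul_integral a b : Cmul a b = C0 -> a = C0 \/ b = C0.
Proof.
  intros H; destruct (Cplx_dec a C0) as [|Ha]; [now left | right].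
  replace b with (Cmul (Cinv a) (Cmul a b)) by (field; exact Ha).
  rewrite H; ring.
Qed.

Lemma Cmul_neq0 a b : a <> C0 -> b <> C0 -> Cmul a b <> C0.
Proof. intros Ha Hb H; destruct (Cmul_integral _ _ H); contradiction. Qed.

Lemma Csub_eq0 a b : Csub a b = C0 -> a = b.
Proof.
  intros H; replace a with (Cadd (Csub a b) b) by (unfold Csub; ring).
  rewrite H; ring.
Qed.

Lemma C1_neq0 : C1 <> C0.
Proof. intros E; injection E; lra. Qed.

Lemma Cabs_pos a : 0 <= Cabs a.
Proof. apply sqrt_pos. Qed.

Lemma Cabs_sqr a : Cabs a * Cabs a = Cre a * Cre a + Cim a * Cim a.
Proof. apply sqrt_sqrt; nra. Qed.

Lemma Cabs_mul a b : Cabs (Cmul a b) = Cabs a * Cabs b.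
Proof.
  unfold Cabs at 2 3; rewrite <- sqrt_mult by nra; unfold Cabs; f_equal; simpl; ring.
Qed.

Lemma Cabs_add a b : Cabs (Cadd a b) <= Cabs a + Cabs b.
Proof.
  pose proof (Cabs_pos a); pose proof (Cabs_pos b).
  apply Rsqr_incr_0_var; [unfold Rsqr | lra].
  rewrite Cabs_sqr; simpl.
  assert (Cre a * Cre b + Cim a * Cim b <= Cabs a * Cabs b).
  { apply Rsqr_incr_0_var; [unfold Rsqr | nra].
    replace (Cabs a * Cabs b * (Cabs a * Cabs b))
      with ((Cabs a * Cabs a) * (Cabs b * Cabs b)) by ring.
    rewrite !Cabs_sqr.
    (* Lagrange's identity: this square is the defect in the Cauchy-Schwarz inequality. *)
    pose proof (Rle_0_sqr (Cre a * Cim b - Cim a * Cre b)) as Hs; unfold Rsqr in Hs; nra. }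
  pose proof (Cabs_sqr a); pose proof (Cabs_sqr b); nra.
Qed.

Lemma Cabs_C0 : Cabs C0 = 0.
Proof. unfold Cabs; simpl; replace (0 * 0 + 0 * 0) with 0 by ring; apply sqrt_0. Qed.

Lemma Cabs_RtoC x : Cabs (RtoC x) = Rabs x.
Proof.
  unfold Cabs; simpl; replace (x * x + 0 * 0) with (Rsqr x) by (unfold Rsqr; ring).
  apply sqrt_Rsqr_abs.
Qed.

Lemma Cabs_C1 : Cabs C1 = 1.
Proof. change C1 with (RtoC 1); rewrite Cabs_RtoC; apply Rabs_R1. Qed.

Lemma Cabs_opp a : Cabs (Copp a) = Cabs a.
Proof. unfold Cabs; simpl; f_equal; ring. Qed.

Lemma Cabs_eq0 a : Cabs a = 0 -> a = C0.
Proof.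
  intros H; pose proof (Cabs_sqr a) as E; rewrite H in E.
  apply Cplx_ext; simpl; nra.
Qed.

Lemma Cabs_gt0 a : a <> C0 -> 0 < Cabs a.
Proof.
  intros H; destruct (Cabs_pos a) as [|E]; [assumption|].
  symmetry in E; apply Cabs_eq0 in E; contradiction.
Qed.

Lemma Cabs_inv a : a <> C0 -> Cabs (Cinv a) = / Cabs a.
Proof.
  intros H; pose proof (Cabs_gt0 a H).
  apply Rmult_eq_reg_l with (Cabs a); [|lra].
  rewrite <- Cabs_mul, Rinv_r by lra.
  replace (Cmul a (Cinv a)) with C1 by (field; exact H); apply Cabs_C1.
Qed.

Lemma Cre_le a : Rabs (Cre a) <= Cabs a.
Proof.
  rewrite <- (Rabs_pos_eq (Cabs a)) by apply Cabs_pos.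
  apply Rsqr_le_abs_0; unfold Rsqr; rewrite Cabs_sqr; nra.
Qed.

Lemma Cim_le a : Rabs (Cim a) <= Cabs a.
Proof.
  rewrite <- (Rabs_pos_eq (Cabs a)) by apply Cabs_pos.
  apply Rsqr_le_abs_0; unfold Rsqr; rewrite Cabs_sqr; nra.
Qed.

Lemma Cabs_le_ReIm a : Cabs a <= Rabs (Cre a) + Rabs (Cim a).
Proof.
  pose proof (Rabs_pos (Cre a)); pose proof (Rabs_pos (Cim a)).
  apply Rsqr_incr_0_var; [unfold Rsqr; rewrite Cabs_sqr | lra].
  pose proof (Rsqr_abs (Cre a)) as E1; pose proof (Rsqr_abs (Cim a)) as E2.
  unfold Rsqr in *; nra.
Qed.

Lemma Cpow_add a n k : Cpow a (n + k) = Cmul (Cpow a n) (Cpow a k).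
Proof. induction n as [|n IH]; simpl; [ring | rewrite IH; ring]. Qed.

Lemma Cpow_mul_base a b n : Cpow (Cmul a b) n = Cmul (Cpow a n) (Cpow b n).
Proof. induction n as [|n IH]; simpl; [ring | rewrite IH; ring]. Qed.

Lemma Cpow_neq0 a n : a <> C0 -> Cpow a n <> C0.
Proof.
  intros H; induction n as [|n IH]; simpl; [apply C1_neq0 | now apply Cmul_neq0].
Qed.

Lemma Cpow_eq0 a n : Cpow a n = C0 -> a = C0.
Proof.
  intros H; destruct (Cplx_dec a C0) as [|Ha]; [assumption|].
  now apply (Cpow_neq0 a n) in Ha.
Qed.

Lemma Cpow_C0 n : (1 <= n)%nat -> Cpow C0 n = C0.
Proof. destruct n; [lia|]; intros _; simpl; ring. Qed.

Lemma Cplx_polar (a : Cplx) :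
  exists t, a = mkC (Cabs a * cos t) (Cabs a * sin t).
Proof.
  destruct (Cplx_dec a C0) as [->|Ha].
  { exists 0; rewrite Cabs_C0; apply Cplx_ext; simpl; ring. }
  pose proof (Cabs_gt0 a Ha) as Hp; pose proof (Cabs_sqr a) as Hs.
  set (c := Cre a / Cabs a); set (d := Cim a / Cabs a).
  assert (Hcd : c * c + d * d = 1).
  { unfold c, d. replace (_ + _) with ((Cre a * Cre a + Cim a * Cim a) / (Cabs a * Cabs a))
      by (field; lra). rewrite Hs; field. rewrite <- Hs; nra. }
  assert (Hc : -1 <= c <= 1) by nra.
  assert (Hsd : sqrt (1 - c²) = Rabs d).
  { replace (1 - c²) with (Rsqr d) by (unfold Rsqr; lra). apply sqrt_Rsqr_abs. }
  (* [acos] fixes the angle up to sign; the sign of the imaginary part decides. *)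
  destruct (Rle_dec 0 d) as [Hd|Hd].
  - exists (acos c); rewrite cos_acos, sin_acos, Hsd, Rabs_pos_eq by assumption.
    apply Cplx_ext; unfold c, d; simpl; field; lra.
  - exists (- acos c); rewrite cos_neg, sin_neg, cos_acos, sin_acos, Hsd by assumption.
    rewrite Rabs_left by lra.
    apply Cplx_ext; unfold c, d; simpl; field; lra.
Qed.

Lemma de_Moivre t n : Cpow (mkC (cos t) (sin t)) n = mkC (cos (INR n * t)) (sin (INR n * t)).
Proof.
  induction n as [|n IH].
  - simpl; rewrite Rmult_0_l, cos_0, sin_0; reflexivity.
  - rewrite S_INR; replace ((INR n + 1) * t) with (t + INR n * t) by ring.
    simpl Cpow; rewrite IH, cos_plus, sin_plus; apply Cplx_ext; simpl; ring.
Qed.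

(** Real root of the modulus, argument divided by [n]. It supplies the scaling and the square root
    in the rank-two test operator. *)
Lemma Croot_exists (a : Cplx) (n : nat) : (1 <= n)%nat -> exists b, Cpow b n = a.
Proof.
  intros Hn; assert (HN : 0 < INR n) by (apply lt_0_INR; lia).
  destruct (Cplx_dec a C0) as [->|Ha]; [exists C0; now apply Cpow_C0|].
  destruct (Cplx_polar a) as [t Ht].
  pose proof (Cabs_gt0 a Ha) as Hp.
  exists (Cmul (RtoC (Rpower (Cabs a) (/ INR n))) (mkC (cos (t / INR n)) (sin (t / INR n)))).
  rewrite Cpow_mul_base, de_Moivre.
  replace (INR n * (t / INR n)) with t by (field; lra).
  assert (E : forall x k, Cpow (RtoC x) k = RtoC (x ^ k)).
  { intros x k; induction k as [|k IH]; simpl; [reflexivity|]. now rewrite IH, RtoC_mul. }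
  rewrite E, <- Rpower_pow by apply exp_pos.
  rewrite Rpower_mult, Rinv_l, Rpower_1 by lra.
  rewrite Ht at 2; apply Cplx_ext; simpl; ring.
Qed.

Definition vsub {X : CBanach} (x y : X) : X := vadd x (vopp y).

Lemma vadd_0r {X : CBanach} (x : X) : vadd x vzero = x.
Proof. rewrite vadd_comm; apply vadd_0. Qed.

Lemma vadd_oppl {X : CBanach} (x : X) : vadd (vopp x) x = vzero.
Proof. rewrite vadd_comm; apply vadd_opp. Qed.

Lemma vadd_cancel_l {X : CBanach} (x y z : X) : vadd x y = vadd x z -> y = z.
Proof.
  intros H; rewrite <- (vadd_0 _ y), <- (vadd_0 _ z), <- (vadd_oppl x).
  now rewrite <- !vadd_assoc, H.
Qed.

Lemma vscal_0 {X : CBanach} (x : X) : vscal C0 x = vzero.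
Proof.
  apply (vadd_cancel_l (vscal C0 x)); rewrite <- vscal_adds, vadd_0r; f_equal; ring.
Qed.

Lemma vscal_vzero {X : CBanach} (a : Cplx) : vscal a (vzero : X) = vzero.
Proof. rewrite <- (vscal_0 vzero), vscal_assoc; f_equal; ring. Qed.

Lemma vopp_scal {X : CBanach} (x : X) : vopp x = vscal (Copp C1) x.
Proof.
  apply (vadd_cancel_l x); rewrite vadd_opp.
  rewrite <- (vscal_1 _ x) at 1; rewrite <- vscal_adds.
  replace (Cadd C1 (Copp C1)) with C0 by ring; now rewrite vscal_0.
Qed.

(** * Vector identities by reflection *)

(** Syntax for goals between vectors: both sides are reified over a list of atoms and normalized to
    linear combinations of them, so an identity reduces to one scalar equation per atom. *)
Inductive vexp : Type :=
  | VVar (n : nat) | VZero | VAdd (e1 e2 : vexp) | VOpp (e : vexp) | VScal (a : Cplx) (e : vexp).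

Fixpoint veval {X : CBanach} (env : list X) (e : vexp) : X :=
  match e with
  | VVar n => nth n env vzero
  | VZero => vzero
  | VAdd e1 e2 => vadd (veval env e1) (veval env e2)
  | VOpp e => vopp (veval env e)
  | VScal a e => vscal a (veval env e)
  end.

Fixpoint vcoef (e : vexp) (k : nat) : Cplx :=
  match e with
  | VVar n => if Nat.eqb n k then C1 else C0
  | VZero => C0
  | VAdd e1 e2 => Cadd (vcoef e1 k) (vcoef e2 k)
  | VOpp e => Copp (vcoef e k)
  | VScal a e => Cmul a (vcoef e k)
  end.

(** [k] is the index of the head of [env], so the recursion never has to shift the coefficient
    function. *)
Fixpoint vlin {X : CBanach} (env : list X) (c : nat -> Cplx) (k : nat) : X :=
  match env with
  | nil => vzero
  | x :: env' => vadd (vscal (c k) x) (vlin env' c (S k))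
  end.

Lemma vlin_add {X : CBanach} (env : list X) c d k :
  vlin env (fun i => Cadd (c i) (d i)) k = vadd (vlin env c k) (vlin env d k).
Proof.
  revert k; induction env as [|x env IH]; intros k; simpl; [now rewrite vadd_0|].
  rewrite IH, vscal_adds, <- !vadd_assoc; f_equal.
  rewrite !vadd_assoc; f_equal; apply vadd_comm.
Qed.

Lemma vlin_scal {X : CBanach} (env : list X) a c k :
  vlin env (fun i => Cmul a (c i)) k = vscal a (vlin env c k).
Proof.
  revert k; induction env as [|x env IH]; intros k; simpl; [now rewrite vscal_vzero|].
  now rewrite IH, vscal_addv, vscal_assoc.
Qed.

Lemma vlin_ext {X : CBanach} (env : list X) c d k :
  (forall i, (i < k + length env)%nat -> c i = d i) -> vlin env c k = vlin env d k.
Proof.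
  revert k; induction env as [|x env IH]; intros k H; simpl; [reflexivity|].
  rewrite H, (IH (S k)) by (simpl in *; try (intros; apply H); simpl; lia); reflexivity.
Qed.

Lemma vlin_zero {X : CBanach} (env : list X) k : vlin env (fun _ => C0) k = vzero.
Proof.
  revert k; induction env as [|x env IH]; intros k; simpl; [reflexivity|].
  now rewrite IH, vscal_0, vadd_0.
Qed.

Lemma vlin_var {X : CBanach} (env : list X) n k :
  vlin env (fun i => if Nat.eqb (k + n) i then C1 else C0) k = nth n env vzero.
Proof.
  revert n k; induction env as [|x env IH]; intros [|n] k; simpl; try reflexivity.
  - rewrite Nat.add_0_r, Nat.eqb_refl, vscal_1.
    transitivity (vadd x (vlin env (fun _ => C0) (S k))); [|now rewrite vlin_zero, vadd_0r].
    (* Beyond position [k] the indicator of [k] vanishes. *)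
    f_equal. clear IH. enough (H : forall j, (k < j)%nat ->
      vlin env (fun i => if Nat.eqb k i then C1 else C0) j = vlin env (fun _ => C0) j)
      by (apply H; lia).
    induction env as [|y env IH]; intros j Hj; simpl; [reflexivity|].
    rewrite IH by lia. now replace (Nat.eqb k j) with false by (symmetry; apply Nat.eqb_neq; lia).
  - replace (Nat.eqb (k + S n) k) with false by (symmetry; apply Nat.eqb_neq; lia).
    rewrite vscal_0, vadd_0, <- (IH n (S k)); f_equal.
    apply functional_extensionality; intros i; now rewrite Nat.add_succ_r.
Qed.

Lemma veval_vlin {X : CBanach} (env : list X) (e : vexp) :
  veval env e = vlin env (vcoef e) 0.
Proof.
  induction e; simpl.
  - symmetry; apply (vlin_var env n 0).
  - symmetry; apply vlin_zero.
  - now rewrite vlin_add, IHe1, IHe2.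
  - rewrite vopp_scal, IHe, <- vlin_scal; apply vlin_ext; intros; ring.
  - now rewrite vlin_scal, IHe.
Qed.

Lemma veval_eq {X : CBanach} (env : list X) (e1 e2 : vexp) :
  (forall k, (k < length env)%nat -> vcoef e1 k = vcoef e2 k) -> veval env e1 = veval env e2.
Proof. intros H; rewrite !veval_vlin; apply vlin_ext; exact H. Qed.

Ltac vmem x env :=
  lazymatch env with
  | nil => false
  | x :: _ => true
  | _ :: ?env' => vmem x env'
  end.

Ltac vatoms env t :=
  lazymatch t with
  | vadd ?a ?b => let env' := vatoms env a in vatoms env' b
  | vopp ?a => vatoms env a
  | vscal _ ?a => vatoms env a
  | vzero => env
  | ?x => let m := vmem x env in
          lazymatch m with true => env | false => constr:(x :: env) end
  end.

Ltac vindex env x :=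
  lazymatch env with
  | x :: _ => constr:(O)
  | _ :: ?env' => let n := vindex env' x in constr:(S n)
  end.

Ltac vquote env t :=
  lazymatch t with
  | vadd ?a ?b => let a' := vquote env a in let b' := vquote env b in constr:(VAdd a' b')
  | vopp ?a => let a' := vquote env a in constr:(VOpp a')
  | vscal ?c ?a => let a' := vquote env a in constr:(VScal c a')
  | vzero => constr:(VZero)
  | ?x => let n := vindex env x in constr:(VVar n)
  end.

(* Equalities between vectors that hold by comparing coefficients; [tac] closes the scalar goals. *)
Ltac vector_with tac :=
  unfold vsub;
  lazymatch goal with
  | |- @eq ?T ?u ?v =>
      let env0 := constr:(@nil T) in
      let env1 := vatoms env0 u in
      let env := vatoms env1 v in
      let u' := vquote env u in
      let v' := vquote env v in
      change (veval env u' = veval env v');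
      apply veval_eq;
      let k := fresh "k" in let Hk := fresh "Hk" in
      intros k Hk; cbn [length] in Hk;
      repeat (destruct k as [|k]; [cbn [vcoef Nat.eqb]; tac | try (exfalso; lia)])
  end.

Ltac vector := vector_with ltac:(ring).

Lemma vnorm_0 (X : CBanach) : vnorm (vzero : X) = 0.
Proof. rewrite <- (vscal_0 vzero), vnorm_scal, Cabs_C0; ring. Qed.

Lemma vnorm_opp {X : CBanach} (x : X) : vnorm (vopp x) = vnorm x.
Proof. rewrite vopp_scal, vnorm_scal, Cabs_opp, Cabs_C1; ring. Qed.

Lemma vnorm_pos {X : CBanach} (x : X) : 0 <= vnorm x.
Proof.
  pose proof (vnorm_triangle _ x (vopp x)) as H.
  rewrite vadd_opp, vnorm_0, vnorm_opp in H; lra.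
Qed.

Lemma vsub_eq0 {X : CBanach} (x y : X) : vsub x y = vzero -> x = y.
Proof.
  intros H; rewrite <- (vadd_0 _ y), <- H; unfold vsub.
  now rewrite <- vadd_assoc, vadd_oppl, vadd_0r.
Qed.

Lemma vscal_eq0 {X : CBanach} (a : Cplx) (x : X) : vscal a x = vzero -> a = C0 \/ x = vzero.
Proof.
  intros H; destruct (Cplx_dec a C0) as [|Ha]; [now left | right].
  rewrite <- (vscal_1 _ x); replace C1 with (Cmul (Cinv a) a) by (field; exact Ha).
  now rewrite <- vscal_assoc, H, vscal_vzero.
Qed.

Lemma dual_add {X : CBanach} (f : X -> Cplx) : in_dual f ->
  forall x y, f (vadd x y) = Cadd (f x) (f y).
Proof. intros [H _] x y; apply (H C0). Qed.

Lemma dual_scal {X : CBanach} (f : X -> Cplx) : in_dual f ->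
  forall a x, f (vscal a x) = Cmul a (f x).
Proof. intros [H _] a x; apply (H a x x). Qed.

Lemma dual_opp {X : CBanach} (f : X -> Cplx) : in_dual f ->
  forall x, f (vopp x) = Copp (f x).
Proof. intros H x; rewrite vopp_scal, dual_scal by assumption; ring. Qed.

Lemma dual_zero {X : CBanach} (f : X -> Cplx) : in_dual f -> f vzero = C0.
Proof. intros H; rewrite <- (vscal_0 vzero), dual_scal by assumption; ring. Qed.

Lemma dual_bound {X : CBanach} (f : X -> Cplx) : in_dual f ->
  exists c, 0 <= c /\ dnorm_le f c.
Proof.
  intros [_ [c Hc]]; exists (Rabs c); split; [apply Rabs_pos|].
  intros x; specialize (Hc x); pose proof (Rle_abs c); pose proof (vnorm_pos x); nra.
Qed.

Lemma op_add {X Y : CBanach} (T : X -> Y) : is_op T ->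
  forall x y, T (vadd x y) = vadd (T x) (T y).
Proof. intros [H _] x y; apply (H C0). Qed.

Lemma op_scal {X Y : CBanach} (T : X -> Y) : is_op T ->
  forall a x, T (vscal a x) = vscal a (T x).
Proof. intros [H _] a x; apply (H a x x). Qed.

Lemma op_opp {X Y : CBanach} (T : X -> Y) : is_op T -> forall x, T (vopp x) = vopp (T x).
Proof. intros H x; rewrite !vopp_scal; now apply op_scal. Qed.

Lemma op_zero {X Y : CBanach} (T : X -> Y) : is_op T -> T vzero = vzero.
Proof. intros H; now rewrite <- (vscal_0 vzero), op_scal, vscal_0. Qed.

Lemma op_bound {X Y : CBanach} (T : X -> Y) : is_op T ->
  exists c, 0 <= c /\ forall x, vnorm (T x) <= c * vnorm x.
Proof.
  intros [_ [c Hc]]; exists (Rabs c); split; [apply Rabs_pos|].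
  intros x; specialize (Hc x); pose proof (Rle_abs c); pose proof (vnorm_pos x); nra.
Qed.

Lemma is_op_intro {X Y : CBanach} (T : X -> Y) (c : R) :
  (forall x y, T (vadd x y) = vadd (T x) (T y)) ->
  (forall a x, T (vscal a x) = vscal a (T x)) ->
  (forall x, vnorm (T x) <= c * vnorm x) -> is_op T.
Proof. intros Ha Hs Hc; split; [split; auto | exists c; exact Hc]. Qed.

Lemma in_dual_intro {X : CBanach} (f : X -> Cplx) (c : R) :
  (forall x y, f (vadd x y) = Cadd (f x) (f y)) ->
  (forall a x, f (vscal a x) = Cmul a (f x)) ->
  dnorm_le f c -> in_dual f.
Proof. intros Ha Hs Hc; split; [split; auto | exists c; exact Hc]. Qed.

(** * Hahn-Banach *)

(** The library version takes a boolean relation; classical decidability turns a [Prop]-valued order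
    into one. *)
Lemma zorn (T : Type) (R : T -> T -> Prop) :
  (forall t, R t t) -> (forall a b c, R a b -> R b c -> R a c) ->
  (forall a b, R a b -> R b a -> a = b) ->
  (forall A : T -> Prop, (forall a b, A a -> A b -> R a b \/ R b a) ->
     exists t, forall a, A a -> R a t) ->
  exists t, forall a, R t a -> a = t.
Proof.
  intros Hr Ht Ha Hc.
  set (rb := fun a b => if excluded_middle_informative (R a b) then true else false).
  assert (E : forall a b, is_true (rb a b) <-> R a b).
  { intros a b; unfold rb, is_true.
    destruct (excluded_middle_informative (R a b)); split; auto; discriminate. }
  destruct (@classical_sets.Zorn T rb) as [t Hmax].
  - intros t; now apply E.
  - intros a b c H1 H2; apply E; apply (Ht a b c); now apply E.
  - intros a b H1 H2; apply Ha; now apply E.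
  - intros A HA; destruct (Hc A) as [t H].
    + intros a b Aa Ab; destruct (HA a b Aa Ab); [left | right]; now apply E.
    + exists t; intros a Aa; apply E; auto.
  - exists t; intros a H; apply Hmax; now apply E.
Qed.

(* The graph of a real-linear functional dominated by the norm, on a real subspace. *)
Definition dominated_graph {X : CBanach} (G : X -> R -> Prop) : Prop :=
  G vzero 0 /\
  (forall x y a b, G x a -> G y b -> G (vadd x y) (a + b)) /\
  (forall t x a, G x a -> G (vscal (RtoC t) x) (t * a)) /\
  (forall x a, G x a -> a <= vnorm x).

Lemma vnorm_rscal {X : CBanach} (t : R) (x : X) : 0 <= t -> vnorm (vscal (RtoC t) x) = t * vnorm x.
Proof. intros H; rewrite vnorm_scal, Cabs_RtoC, Rabs_pos_eq by assumption; reflexivity. Qed.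

(** A value [a] at [x0] is admissible when [r - |x - x0| <= a <= |y + x0| - s] for all [(x, r)] and
    [(y, s)] in the graph. The triangle inequality for [x + y] separates the two sides, and [a] is
    the supremum of the left one. *)
Lemma dominated_graph_extend {X : CBanach} (G : X -> R -> Prop) (x0 : X) :
  dominated_graph G ->
  exists G', dominated_graph G' /\ (forall x a, G x a -> G' x a) /\ exists a, G' x0 a.
Proof.
  intros (G0 & Gadd & Gscal & Gdom).
  destruct (completeness (fun b => exists x r, G x r /\ b = r - vnorm (vsub x x0))) as [a [Hub Hlub]].
  - exists (vnorm x0); intros b (x & r & HG & ->).
    pose proof (Gdom x r HG). pose proof (vnorm_triangle _ (vsub x x0) x0) as Ht.
    replace (vadd (vsub x x0) x0) with x in Ht by vector. lra.
  - exists (0 - vnorm (vsub vzero x0)), vzero, 0; split; [exact G0 | reflexivity].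
  - assert (Hle : forall x r, G x r -> r + a <= vnorm (vadd x x0)).
    { intros y s HG. enough (a <= vnorm (vadd y x0) - s) by lra. apply Hlub.
      intros b (x & r & HG' & ->). pose proof (Gdom _ _ (Gadd _ _ _ _ HG HG')) as H1.
      pose proof (vnorm_triangle _ (vadd y x0) (vsub x x0)) as H2.
      replace (vadd (vadd y x0) (vsub x x0)) with (vadd y x) in H2 by vector. lra. }
    assert (Hge : forall x r, G x r -> r - a <= vnorm (vsub x x0)).
    { intros x r HG. enough (r - vnorm (vsub x x0) <= a) by lra. apply Hub; eauto. }
    exists (fun y b => exists t x r, G x r /\ y = vadd x (vscal (RtoC t) x0) /\ b = r + t * a).
    split; [split; [|split; [|split]]|split].
    + exists 0, vzero, 0; repeat split; [exact G0| |ring].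
      change (RtoC 0) with C0; now rewrite vscal_0, vadd_0.
    + intros x y b c (t & x' & r & HG & -> & ->) (s & y' & q & HG' & -> & ->).
      exists (t + s), (vadd x' y'), (r + q); repeat split; [auto| |ring].
      rewrite RtoC_add; vector.
    + intros u y b (t & x & r & HG & -> & ->).
      exists (u * t), (vscal (RtoC u) x), (u * r); repeat split; [auto| |ring].
      rewrite RtoC_mul; vector.
    + intros y b (t & x & r & HG & -> & ->).
      assert (Hinv : forall u : R, u <> 0 -> Cmul (RtoC u) (RtoC (/ u)) = C1).
      { intros u Hu; rewrite <- RtoC_mul, Rinv_r by assumption; reflexivity. }
      (* Dividing by the absolute value of [t] reduces to coefficient 1 or -1 of [x0], that is, to
         [Hle] or [Hge]. *)
      destruct (Rtotal_order t 0) as [Ht|[->|Ht]].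
      * pose proof (Hge _ _ (Gscal (/ - t) _ _ HG)) as H1.
        apply (Rmult_le_compat_l (- t)) in H1; [|lra].
        rewrite <- vnorm_rscal in H1 by lra.
        replace (vscal (RtoC (- t)) (vsub (vscal (RtoC (/ - t)) x) x0))
          with (vadd x (vscal (RtoC t) x0)) in H1.
        -- replace (- t * (/ - t * r - a)) with (r + t * a) in H1 by (field; lra). exact H1.
        -- rewrite <- (vscal_1 _ x) at 1. rewrite <- (Hinv (- t)) by lra.
           rewrite RtoC_opp. vector.
      * change (RtoC 0) with C0; rewrite vscal_0, vadd_0r, Rmult_0_l, Rplus_0_r; auto.
      * pose proof (Hle _ _ (Gscal (/ t) _ _ HG)) as H1.
        apply (Rmult_le_compat_l t) in H1; [|lra].
        rewrite <- vnorm_rscal in H1 by lra.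
        replace (vscal (RtoC t) (vadd (vscal (RtoC (/ t)) x) x0))
          with (vadd x (vscal (RtoC t) x0)) in H1.
        -- replace (t * (/ t * r + a)) with (r + t * a) in H1 by (field; lra). exact H1.
        -- rewrite <- (vscal_1 _ x) at 1. rewrite <- (Hinv t) by lra. vector.
    + intros x b HG; exists 0, x, b; repeat split; [exact HG| |ring].
      change (RtoC 0) with C0; now rewrite vscal_0, vadd_0r.
    + exists a, 1, vzero, 0; repeat split; [exact G0| |ring].
      change (RtoC 1) with C1; now rewrite vscal_1, vadd_0.
Qed.

(** Zorn's lemma on the dominated extensions of [G0] ordered by inclusion; a maximal one is total,
    since any vector can be adjoined. *)
Lemma dominated_graph_total {X : CBanach} (G0 : X -> R -> Prop) :
  dominated_graph G0 ->
  exists G, dominated_graph G /\ (forall x a, G0 x a -> G x a) /\ forall x, exists a, G x a.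
Proof.
  intros HG0.
  destruct (zorn {G : X -> R -> Prop | dominated_graph G /\ (forall x a, G0 x a -> G x a)}
     (fun G H => forall x a, proj1_sig G x a -> proj1_sig H x a)) as [[G [HG Hinc]] Hmax].
  - auto.
  - auto.
  - intros [G HG] [H HH] H1 H2; simpl in *.
    apply subset_eq_compat; apply functional_extensionality; intros x.
    apply functional_extensionality; intros a; apply propositional_extensionality; split; auto.
  (* The union of the empty chain would not contain [G0], so that chain is bounded by [G0]
     itself. *)
  - intros A HA. destruct (classic (exists G, A G)) as [[[G1 [HG1 Hinc1]] AG1]|Hne].
    2: { exists (exist _ G0 (conj HG0 (fun x a h => h))); intros G AG; exfalso; eauto. }
    set (U := fun x a => exists G, A G /\ proj1_sig G x a).
    assert (HU : dominated_graph U /\ (forall x a, G0 x a -> U x a)).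
    { split; [split; [|split; [|split]]|].
      - eexists; split; [exact AG1|]; simpl; apply HG1.
      - intros x y a b [G [AG Gx]] [H [AH Hy]].
        destruct (HA G H AG AH) as [L|L].
        + exists H; split; [exact AH|]. destruct H as [H HH]; simpl in *.
          apply (proj1 (proj2 (proj1 HH))); [now apply L | assumption].
        + exists G; split; [exact AG|]. destruct G as [G HG]; simpl in *.
          apply (proj1 (proj2 (proj1 HG))); [assumption | now apply L].
      - intros t x a [G [AG Gx]]; exists G; split; [exact AG|].
        destruct G as [G HG]; simpl in *; now apply (proj1 (proj2 (proj2 (proj1 HG)))).
      - intros x a [[G HG] [AG Gx]]; simpl in *; now apply (proj2 (proj2 (proj2 (proj1 HG)))).
      - intros x a Hx; eexists; split; [exact AG1|]; simpl; auto. }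
    exists (exist _ U HU); intros G AG x a Gx; simpl; exists G; auto.
  - exists G; split; [exact HG|]; split; [exact Hinc|]. intros x.
    destruct (dominated_graph_extend G x HG) as (G' & HG' & Hsub & a & Ha).
    exists a. specialize (Hmax (exist _ G' (conj HG' (fun y b h => Hsub y b (Hinc y b h)))) Hsub).
    apply (f_equal (@proj1_sig _ _)) in Hmax; simpl in Hmax; now rewrite <- Hmax.
Qed.

Lemma real_norming_functional {X : CBanach} (x0 : X) :
  exists g : X -> R, (forall x y, g (vadd x y) = g x + g y) /\
    (forall t x, g (vscal (RtoC t) x) = t * g x) /\
    (forall x, g x <= vnorm x) /\ g x0 = vnorm x0.
Proof.
  destruct (dominated_graph_total
    (fun y b => exists t, y = vscal (RtoC t) x0 /\ b = t * vnorm x0))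
    as (G & (H0 & Hadd & Hscal & Hdom) & Hinc & Htot).
  { split; [|split; [|split]].
    - exists 0; change (RtoC 0) with C0; rewrite vscal_0; split; [reflexivity|ring].
    - intros x y a b (t & -> & ->) (s & -> & ->); exists (t + s).
      rewrite RtoC_add, vscal_adds; split; [reflexivity|ring].
    - intros u x a (t & -> & ->); exists (u * t).
      rewrite RtoC_mul, vscal_assoc; split; [reflexivity|ring].
    - intros x a (t & -> & ->); rewrite vnorm_scal, Cabs_RtoC.
      pose proof (Rle_abs t); pose proof (vnorm_pos x0); nra. }
  (* Domination makes the graph single-valued: the difference of two values at [x] is a value at 0,
     hence at most 0. *)
  assert (Huniq : forall x a b, G x a -> G x b -> a <= b).
  { intros x a b Ha Hb. pose proof (Hdom _ _ (Hadd _ _ _ _ Ha (Hscal (-1) _ _ Hb))) as H.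
    replace (vadd x (vscal (RtoC (-1)) x)) with (vzero : X) in H.
    - rewrite vnorm_0 in H; lra.
    - vector_with ltac:(apply Cplx_ext; simpl; ring). }
  assert (Heq : forall x a b, G x a -> G x b -> a = b)
    by (intros x a b Ha Hb; apply Rle_antisym; eauto).
  set (g := fun x => proj1_sig (constructive_indefinite_description _ (Htot x))).
  assert (Hg : forall x, G x (g x))
    by (intros x; exact (proj2_sig (constructive_indefinite_description _ (Htot x)))).
  exists g; repeat split.
  - intros x y; apply (Heq (vadd x y)); auto.
  - intros t x; apply (Heq (vscal (RtoC t) x)); auto.
  - intros x; apply Hdom; auto.
  - apply (Heq x0); [auto|]; apply Hinc; exists 1.
    change (RtoC 1) with C1; rewrite vscal_1; split; [reflexivity|ring].
Qed.

(** Complexification [f x = g x - i g (i x)] of a real norming functional. Rotating [x] so that [f]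
    is real and nonnegative there transfers the bound from [g] to [f]. *)
Lemma norming_functional {X : CBanach} (x0 : X) :
  exists f : X -> Cplx, in_dual f /\ dnorm_le f 1 /\ f x0 = RtoC (vnorm x0).
Proof.
  destruct (real_norming_functional x0) as (g & gadd & gscal & gdom & gx0).
  set (f := fun x => mkC (g x) (- g (vscal Ci x))).
  assert (fadd : forall x y, f (vadd x y) = Cadd (f x) (f y)).
  { intros x y; apply Cplx_ext; simpl; rewrite ?vscal_addv, ?gadd; ring. }
  assert (fscal : forall a x, f (vscal a x) = Cmul a (f x)).
  { intros a x.
    assert (E1 : vscal a x = vadd (vscal (RtoC (Cre a)) x) (vscal (RtoC (Cim a)) (vscal Ci x))).
    { vector_with ltac:(apply Cplx_ext; simpl; ring). }
    assert (E2 : vscal Ci (vscal a x)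
      = vadd (vscal (RtoC (Cre a)) (vscal Ci x)) (vscal (RtoC (- Cim a)) x)).
    { vector_with ltac:(apply Cplx_ext; simpl; ring). }
    apply Cplx_ext; unfold f; cbn [Cre Cim Cmul]; [rewrite E1 | rewrite E2];
      rewrite gadd, !gscal; ring. }
  assert (fdom : dnorm_le f 1).
  { intros x; rewrite Rmult_1_l. destruct (Cplx_dec (f x) C0) as [E|Hne].
    - rewrite E, Cabs_C0; apply vnorm_pos.
    - pose proof (Cabs_gt0 _ Hne) as Hp.
      set (u := Cmul (RtoC (Cabs (f x))) (Cinv (f x))).
      assert (Hu : f (vscal u x) = RtoC (Cabs (f x)))
        by (rewrite fscal; unfold u; field; exact Hne).
      pose proof (gdom (vscal u x)) as H.
      replace (g (vscal u x)) with (Cabs (f x)) in H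
        by (apply (f_equal Cre) in Hu; symmetry; exact Hu).
      rewrite vnorm_scal in H. unfold u in H.
      rewrite Cabs_mul, Cabs_inv, Cabs_RtoC, Rabs_pos_eq, Rinv_r in H by (lra || assumption).
      lra. }
  exists f; split; [eapply in_dual_intro; eauto | split; [exact fdom|]].
  (* The real part of [f x0] already attains the bound on the modulus, so the imaginary part is
     0. *)
  specialize (fdom x0). pose proof (Cabs_sqr (f x0)) as E; pose proof (Cabs_pos (f x0)) as Hp.
  change (Cre (f x0)) with (g x0) in E; rewrite gx0 in E.
  pose proof (vnorm_pos x0) as Hp'.
  apply Cplx_ext; [exact gx0|]; simpl RtoC; cbn [Cim].
  apply Rsqr_0_uniq; unfold Rsqr; nra.
Qed.

Lemma dual_separates {X : CBanach} (x : X) : (forall f, in_dual f -> f x = C0) -> x = vzero.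
Proof.
  intros H; destruct (norming_functional x) as (f & Hf & _ & E); rewrite H in E by assumption.
  apply vnorm_eq0; apply (f_equal Cre) in E; simpl in E; now symmetry.
Qed.

Lemma dual_eq {X : CBanach} (x y : X) : (forall f, in_dual f -> f x = f y) -> x = y.
Proof.
  intros H; apply vsub_eq0, dual_separates; intros f Hf; unfold vsub.
  rewrite dual_add, dual_opp, H by assumption; ring.
Qed.

Lemma dual_lincomb {X : CBanach} (a b : Cplx) (f g : X -> Cplx) :
  in_dual f -> in_dual g -> in_dual (fun x => Cadd (Cmul a (f x)) (Cmul b (g x))).
Proof.
  intros Hf Hg; destruct (dual_bound f Hf) as (c & _ & Hc), (dual_bound g Hg) as (d & _ & Hd).
  apply in_dual_intro with (Cabs a * c + Cabs b * d).
  - intros x y; rewrite !dual_add by assumption; ring.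
  - intros u x; rewrite !dual_scal by assumption; ring.
  - intros x; eapply Rle_trans; [apply Cabs_add|]; rewrite !Cabs_mul.
    specialize (Hc x); specialize (Hd x).
    pose proof (Cabs_pos a); pose proof (Cabs_pos b); nra.
Qed.

Lemma dual_fadd {X : CBanach} (f g : X -> Cplx) :
  in_dual f -> in_dual g -> in_dual (fun x => Cadd (f x) (g x)).
Proof.
  intros Hf Hg; replace (fun x => Cadd (f x) (g x))
    with (fun x => Cadd (Cmul C1 (f x)) (Cmul C1 (g x))).
  - now apply dual_lincomb.
  - apply functional_extensionality; intros x; ring.
Qed.

Lemma dual_fscal {X : CBanach} a (f : X -> Cplx) : in_dual f -> in_dual (fun x => Cmul a (f x)).
Proof.
  intros Hf; replace (fun x => Cmul a (f x)) with (fun x => Cadd (Cmul a (f x)) (Cmul C0 (f x))).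
  - now apply dual_lincomb.
  - apply functional_extensionality; intros x; ring.
Qed.

Lemma dual_comp {X Y : CBanach} (f : Y -> Cplx) (T : X -> Y) :
  in_dual f -> is_op T -> in_dual (fun x => f (T x)).
Proof.
  intros Hf HT; destruct (dual_bound f Hf) as (c & Hc0 & Hc), (op_bound T HT) as (d & _ & Hd).
  apply in_dual_intro with (c * d).
  - intros x y; now rewrite (op_add T HT), (dual_add f Hf).
  - intros a x; now rewrite (op_scal T HT), (dual_scal f Hf).
  - intros x; specialize (Hd x); specialize (Hc (T x)); nra.
Qed.

(* If [f v <> 0] and [g w <> 0], one of [f], [g], [f + g] is nonzero at both points. *)
Lemma dual_nonzero2 {X : CBanach} (v w : X) : v <> vzero -> w <> vzero ->
  exists f, in_dual f /\ f v <> C0 /\ f w <> C0.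
Proof.
  assert (Hex : forall u : X, u <> vzero -> exists f, in_dual f /\ f u <> C0).
  { intros u Hu; destruct (norming_functional u) as (f & Hf & _ & E); exists f; split; [exact Hf|].
    rewrite E; intros E0; apply Hu, vnorm_eq0; now injection E0. }
  intros Hv Hw; destruct (Hex v Hv) as (f & Hf & Hfv), (Hex w Hw) as (g & Hg & Hgw).
  destruct (Cplx_dec (f w) C0) as [Efw|Hfw]; [|eauto].
  destruct (Cplx_dec (g v) C0) as [Egv|Hgv]; [|eauto].
  exists (fun x => Cadd (f x) (g x)); split; [now apply dual_fadd|]; rewrite Efw, Egv; split.
  - now replace (Cadd (f v) C0) with (f v) by ring.
  - now replace (Cadd C0 (g w)) with (g w) by ring.
Qed.

Lemma dual_normalized {X : CBanach} (v w : X) : v <> vzero -> w <> vzero ->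
  exists f, in_dual f /\ f v = C1 /\ f w <> C0.
Proof.
  intros Hv Hw; destruct (dual_nonzero2 v w Hv Hw) as (f & Hf & Hfv & Hfw).
  exists (fun x => Cmul (Cinv (f v)) (f x)); split; [now apply dual_fscal|split].
  - field; exact Hfv.
  - apply Cmul_neq0; [|exact Hfw]. intros E; apply C1_neq0.
    replace C1 with (Cmul (Cinv (f v)) (f v)) by (field; exact Hfv). rewrite E; ring.
Qed.

Lemma dual_one {X : CBanach} (v : X) : v <> vzero -> exists f, in_dual f /\ f v = C1.
Proof. intros Hv; destruct (dual_normalized v v Hv Hv) as (f & ? & ? & _); eauto. Qed.

(** * The dual space and uniform boundedness *)

Definition Ccv (u : nat -> Cplx) (l : Cplx) : Prop :=
  forall eps, 0 < eps -> exists N, forall n, (N <= n)%nat -> Cabs (Csub (u n) l) < eps.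

Lemma Cabs_sub_sym a b : Cabs (Csub a b) = Cabs (Csub b a).
Proof. rewrite <- Cabs_opp; f_equal; ring. Qed.

Lemma Cabs_triangle a b c : Cabs (Csub a c) <= Cabs (Csub a b) + Cabs (Csub b c).
Proof. replace (Csub a c) with (Cadd (Csub a b) (Csub b c)) by ring; apply Cabs_add. Qed.

Lemma Ccv_le u l a b N0 :
  Ccv u l -> (forall n, (N0 <= n)%nat -> Cabs (Csub (u n) a) <= b) -> Cabs (Csub l a) <= b.
Proof.
  intros Hu Hb; apply le_epsilon; intros eps Heps.
  destruct (Hu eps Heps) as [N HN].
  specialize (HN (max N N0) ltac:(lia)); specialize (Hb (max N N0) ltac:(lia)).
  pose proof (Cabs_triangle l (u (max N N0)) a) as Ht.
  rewrite (Cabs_sub_sym l (u _)) in Ht; lra.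
Qed.

Lemma Ccv_unique u l l' : Ccv u l -> Ccv u l' -> l = l'.
Proof.
  intros H H'; apply Csub_eq0, Cabs_eq0, Rle_antisym; [|apply Cabs_pos].
  apply le_epsilon; intros eps Heps; rewrite Rplus_0_l.
  destruct (H' eps Heps) as [N HN]; apply (Ccv_le u l l' eps N H).
  intros n Hn; apply Rlt_le, HN, Hn.
Qed.

Lemma Ccv_add u v a b : Ccv u a -> Ccv v b -> Ccv (fun n => Cadd (u n) (v n)) (Cadd a b).
Proof.
  intros Hu Hv eps Heps.
  destruct (Hu (eps / 2) ltac:(lra)) as [N HN], (Hv (eps / 2) ltac:(lra)) as [N' HN'].
  exists (max N N'); intros n Hn.
  specialize (HN n ltac:(lia)); specialize (HN' n ltac:(lia)).
  replace (Csub (Cadd (u n) (v n)) (Cadd a b)) with (Cadd (Csub (u n) a) (Csub (v n) b)) by ring.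
  pose proof (Cabs_add (Csub (u n) a) (Csub (v n) b)); lra.
Qed.

Lemma Ccv_scal c u a : Ccv u a -> Ccv (fun n => Cmul c (u n)) (Cmul c a).
Proof.
  intros Hu eps Heps. pose proof (Cabs_pos c) as Hc.
  destruct (Hu (eps / (Cabs c + 1))) as [N HN]; [apply Rdiv_lt_0_compat; lra|].
  exists N; intros n Hn; specialize (HN n Hn).
  replace (Csub (Cmul c (u n)) (Cmul c a)) with (Cmul c (Csub (u n) a)) by ring.
  rewrite Cabs_mul. apply Rmult_lt_compat_r with (r := Cabs c + 1) in HN; [|lra].
  replace (eps / (Cabs c + 1) * (Cabs c + 1)) with eps in HN by (field; lra).
  pose proof (Cabs_pos (Csub (u n) a)); nra.
Qed.

Lemma Ccauchy_cv (u : nat -> Cplx) :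
  (forall eps, 0 < eps -> exists N, forall p q, (N <= p)%nat -> (N <= q)%nat ->
     Cabs (Csub (u p) (u q)) < eps) -> exists l, Ccv u l.
Proof.
  intros H.
  destruct (Rcomplete.R_complete (fun n => Cre (u n))) as [a Ha].
  { intros eps Heps; destruct (H eps Heps) as [N HN]; exists N; intros p q Hp Hq.
    specialize (HN p q Hp Hq); eapply Rle_lt_trans; [|exact HN].
    apply (Cre_le (Csub (u p) (u q))). }
  destruct (Rcomplete.R_complete (fun n => Cim (u n))) as [b Hb].
  { intros eps Heps; destruct (H eps Heps) as [N HN]; exists N; intros p q Hp Hq.
    specialize (HN p q Hp Hq); eapply Rle_lt_trans; [|exact HN].
    apply (Cim_le (Csub (u p) (u q))). }
  exists (mkC a b); intros eps Heps.
  destruct (Ha (eps / 2) ltac:(lra)) as [N HN], (Hb (eps / 2) ltac:(lra)) as [N' HN'].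
  exists (max N N'); intros n Hn.
  specialize (HN n ltac:(lia)); specialize (HN' n ltac:(lia)); unfold Rdist in *.
  eapply Rle_lt_trans; [apply Cabs_le_ReIm|]; simpl; unfold Rminus in *; lra.
Qed.

(** The norm is the infimum of the admissible constants, obtained as the supremum of their lower
    bounds. It is itself admissible because every quotient [Cabs (f x) / vnorm x] is such a lower
    bound. *)
Lemma opnorm_exists {X : CBanach} (f : X -> Cplx) : in_dual f ->
  exists N, 0 <= N /\ dnorm_le f N /\ forall c, 0 <= c -> dnorm_le f c -> N <= c.
Proof.
  intros Hf; destruct (dual_bound f Hf) as (c0 & Hc0 & Hb).
  destruct (completeness (fun t => forall c, 0 <= c -> dnorm_le f c -> t <= c)) as [N [Hub Hlub]].
  - exists c0; intros t Ht; auto.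
  - exists 0; auto.
  - exists N; split; [|split].
    + apply Hub; auto.
    + intros x; destruct (Rle_lt_or_eq_dec 0 (vnorm x) (vnorm_pos x)) as [Hx|Hx].
      * enough (H : Cabs (f x) / vnorm x <= N).
        { apply Rmult_le_compat_r with (r := vnorm x) in H; [|lra].
          replace (Cabs (f x) / vnorm x * vnorm x) with (Cabs (f x)) in H by (field; lra).
          exact H. }
        apply Hub; intros c _ Hc; specialize (Hc x).
        apply Rmult_le_reg_r with (vnorm x); [exact Hx|].
        replace (Cabs (f x) / vnorm x * vnorm x) with (Cabs (f x)) by (field; lra); exact Hc.
      * symmetry in Hx; pose proof (vnorm_eq0 _ _ Hx) as ->.
        rewrite dual_zero, Cabs_C0, vnorm_0 by assumption; lra.
    + intros c Hc Hd; apply Hlub; intros t Ht; auto.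
Qed.

(** Functionals bundled with continuity, so that the dual is itself a [CBanach]; the statement of
    the theorem speaks of bare functions satisfying [in_dual] instead. *)
Definition dcar (X : CBanach) : Type := {f : X -> Cplx | in_dual f}.

Definition dfun {X : CBanach} (f : dcar X) : X -> Cplx := proj1_sig f.

Lemma dfun_dual {X : CBanach} (f : dcar X) : in_dual (dfun f).
Proof. exact (proj2_sig f). Qed.

Lemma dcar_ext {X : CBanach} (f g : dcar X) : (forall x, dfun f x = dfun g x) -> f = g.
Proof.
  destruct f as [f Hf], g as [g Hg]; simpl; intros H.
  apply subset_eq_compat; now apply functional_extensionality.
Qed.

Definition dadd {X : CBanach} (f g : dcar X) : dcar X :=
  exist _ _ (dual_fadd _ _ (dfun_dual f) (dfun_dual g)).
Definition dscal {X : CBanach} (a : Cplx) (f : dcar X) : dcar X :=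
  exist _ _ (dual_fscal a _ (dfun_dual f)).

Lemma dual_const0 (X : CBanach) : in_dual (fun _ : X => C0).
Proof.
  apply in_dual_intro with 0; [intros; ring | intros; ring|].
  intros x; rewrite Cabs_C0; lra.
Qed.

Definition dzero (X : CBanach) : dcar X := exist _ _ (dual_const0 X).

Definition dnorm {X : CBanach} (f : dcar X) : R :=
  proj1_sig (constructive_indefinite_description _ (opnorm_exists _ (dfun_dual f))).

Lemma dnorm_pos {X : CBanach} (f : dcar X) : 0 <= dnorm f.
Proof.
  unfold dnorm; destruct (constructive_indefinite_description _ _) as [N HN]; apply HN.
Qed.

Lemma dnorm_spec {X : CBanach} (f : dcar X) : dnorm_le (dfun f) (dnorm f).
Proof.
  unfold dnorm; destruct (constructive_indefinite_description _ _) as [N HN]; apply HN.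
Qed.

Lemma dnorm_min {X : CBanach} (f : dcar X) c : 0 <= c -> dnorm_le (dfun f) c -> dnorm f <= c.
Proof.
  unfold dnorm; destruct (constructive_indefinite_description _ _) as [N HN]; apply HN.
Qed.

Lemma dnorm_triangle {X : CBanach} (f g : dcar X) : dnorm (dadd f g) <= dnorm f + dnorm g.
Proof.
  apply dnorm_min; [pose proof (dnorm_pos f); pose proof (dnorm_pos g); lra|].
  intros x; simpl; eapply Rle_trans; [apply Cabs_add|].
  pose proof (dnorm_spec f x); pose proof (dnorm_spec g x); unfold dfun in *; lra.
Qed.

Lemma dnorm_scal_le {X : CBanach} a (f : dcar X) : dnorm (dscal a f) <= Cabs a * dnorm f.
Proof.
  pose proof (Cabs_pos a); pose proof (dnorm_pos f).
  apply dnorm_min; [nra|]. intros x; simpl; rewrite Cabs_mul.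
  pose proof (dnorm_spec f x); unfold dfun in *; nra.
Qed.

Lemma dnorm_scal {X : CBanach} a (f : dcar X) : dnorm (dscal a f) = Cabs a * dnorm f.
Proof.
  apply Rle_antisym; [apply dnorm_scal_le|].
  destruct (Cplx_dec a C0) as [->|Ha].
  - rewrite Cabs_C0, Rmult_0_l; apply dnorm_pos.
  - pose proof (dnorm_scal_le (Cinv a) (dscal a f)) as H.
    replace (dscal (Cinv a) (dscal a f)) with f in H
      by (apply dcar_ext; intros x; simpl; field; exact Ha).
    pose proof (Cabs_gt0 a Ha). rewrite Cabs_inv in H by assumption.
    apply Rmult_le_compat_l with (r := Cabs a) in H; [|lra].
    rewrite <- Rmult_assoc, Rinv_r, Rmult_1_l in H by lra; exact H.
Qed.

Lemma dnorm_eq0 {X : CBanach} (f : dcar X) : dnorm f = 0 -> f = dzero X.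
Proof.
  intros H; apply dcar_ext; intros x; simpl; apply Cabs_eq0, Rle_antisym; [|apply Cabs_pos].
  pose proof (dnorm_spec f x) as Hs; rewrite H in Hs; unfold dfun in *; lra.
Qed.

(** The Cauchy estimate is uniform relative to [vnorm x], so it survives the pointwise limit; this
    gives both continuity of the limit and convergence in norm. *)
Lemma dual_complete {X : CBanach} (u : nat -> dcar X) :
  (forall eps, 0 < eps -> exists N, forall p q, (N <= p)%nat -> (N <= q)%nat ->
     dnorm (dadd (u p) (dscal (Copp C1) (u q))) < eps) ->
  exists l, forall eps, 0 < eps -> exists N, forall n, (N <= n)%nat ->
     dnorm (dadd (u n) (dscal (Copp C1) l)) < eps.
Proof.
  intros Hu.
  assert (Hpt : forall p q x, Cabs (Csub (dfun (u p) x) (dfun (u q) x))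
                <= dnorm (dadd (u p) (dscal (Copp C1) (u q))) * vnorm x).
  { intros p q x. eapply Rle_trans; [|apply (dnorm_spec _ x)]. simpl.
    right; f_equal; unfold dfun; ring. }
  assert (Hlim : forall x, exists l, Ccv (fun n => dfun (u n) x) l).
  { intros x; apply Ccauchy_cv; intros eps Heps; pose proof (vnorm_pos x).
    destruct (Hu (eps / (vnorm x + 1))) as [N HN]; [apply Rdiv_lt_0_compat; lra|].
    exists N; intros p q Hp Hq; eapply Rle_lt_trans; [apply Hpt|].
    specialize (HN p q Hp Hq).
    apply Rmult_lt_compat_r with (r := vnorm x + 1) in HN; [|lra].
    replace (eps / (vnorm x + 1) * (vnorm x + 1)) with eps in HN by (field; lra).
    pose proof (dnorm_pos (dadd (u p) (dscal (Copp C1) (u q)))); nra. }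
  set (l := fun x => proj1_sig (constructive_indefinite_description _ (Hlim x))).
  assert (Hl : forall x, Ccv (fun n => dfun (u n) x) (l x))
    by (intros x; exact (proj2_sig (constructive_indefinite_description _ (Hlim x)))).
  assert (Hunif : forall eps, 0 < eps -> exists N, forall n, (N <= n)%nat ->
            forall x, Cabs (Csub (l x) (dfun (u n) x)) <= eps * vnorm x).
  { intros eps Heps; destruct (Hu eps Heps) as [N HN]; exists N; intros n Hn x.
    apply (Ccv_le _ _ _ _ N (Hl x)); intros p Hp; eapply Rle_trans; [apply Hpt|].
    apply Rmult_le_compat_r; [apply vnorm_pos | apply Rlt_le; auto]. }
  assert (Hdual : in_dual l).
  { destruct (Hunif 1 ltac:(lra)) as [N HN].
    apply in_dual_intro with (1 + dnorm (u N)).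
    - intros x y; apply (Ccv_unique (fun n => dfun (u n) (vadd x y))); [apply Hl|].
      intros eps Heps; destruct (Ccv_add _ _ _ _ (Hl x) (Hl y) eps Heps) as [M HM].
      exists M; intros n Hn; rewrite (dual_add _ (dfun_dual (u n))); auto.
    - intros a x; apply (Ccv_unique (fun n => dfun (u n) (vscal a x))); [apply Hl|].
      intros eps Heps; destruct (Ccv_scal a _ _ (Hl x) eps Heps) as [M HM].
      exists M; intros n Hn; rewrite (dual_scal _ (dfun_dual (u n))); auto.
    - intros x; specialize (HN N (le_n N) x).
      replace (l x) with (Cadd (Csub (l x) (dfun (u N) x)) (dfun (u N) x)) by ring.
      eapply Rle_trans; [apply Cabs_add|]; pose proof (dnorm_spec (u N) x); lra. }
  exists (exist _ l Hdual); intros eps Heps.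
  destruct (Hunif (eps / 2) ltac:(lra)) as [N HN]; exists N; intros n Hn.
  apply Rle_lt_trans with (eps / 2); [|lra]. apply dnorm_min; [lra|].
  intros x; simpl; specialize (HN n Hn x); rewrite Cabs_sub_sym in HN.
  eapply Rle_trans; [|exact HN]; right; f_equal; unfold dfun; ring.
Qed.

Definition dual (X : CBanach) : CBanach.
Proof.
  refine {| car := dcar X; vzero := dzero X; vadd := dadd; vopp := dscal (Copp C1);
            vscal := dscal; vnorm := dnorm |};
  try (intros; apply dcar_ext; intros; simpl; ring).
  - exact dnorm_eq0.
  - exact dnorm_scal.
  - exact dnorm_triangle.
  - exact dual_complete.
Defined.

(** The canonical embedding into the bidual. *)
Lemma dual_point {X : CBanach} (x : X) : in_dual (X := dual X) (fun f : dual X => dfun f x).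
Proof.
  apply in_dual_intro with (vnorm x); [reflexivity | reflexivity |].
  intros f; rewrite Rmult_comm; apply (dnorm_spec f x).
Qed.

Lemma pow_Rinv3 n : (/ 3) ^ S n = / 3 * (/ 3) ^ n.
Proof. reflexivity. Qed.

(* Gliding hump: from [f n] with norm above [4 ^ n] and [v n] in the unit ball nearly norming it,
   form [x (n+1) = x n +- v n / 3 ^ n] with the sign making [f n (x (n+1))] large. *)
Lemma banach_steinhaus {X : CBanach} (E : dual X -> Prop) :
  (forall x : X, exists c, forall f, E f -> Cabs (dfun f x) <= c) ->
  exists c, forall f, E f -> dnorm f <= c.
Proof.
  intros Hpt; apply NNPP; intros Hno.
  assert (Hex : forall n : nat, exists fv : dual X * X, E (fst fv) /\ 4 ^ n < dnorm (fst fv) /\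
            vnorm (snd fv) <= 1 /\
            2 / 3 * dnorm (fst fv) <= Cabs (dfun (fst fv) (snd fv))).
  { intros n. assert (H : exists f, E f /\ 4 ^ n < dnorm f).
    { apply NNPP; intros H; apply Hno; exists (4 ^ n); intros f Hf.
      apply Rnot_lt_le; intros Hlt; apply H; eauto. }
    destruct H as (f & Hf & Hn).
    assert (Hp : 0 < 4 ^ n) by (apply pow_lt; lra).
    assert (H : exists x, 2 / 3 * dnorm f * vnorm x < Cabs (dfun f x)).
    { apply NNPP; intros H. assert (dnorm f <= 2 / 3 * dnorm f); [|lra].
      apply dnorm_min; [lra|]. intros x; apply Rnot_lt_le; intros Hlt; apply H; eauto. }
    destruct H as [x Hx].
    assert (Hx0 : 0 < vnorm x).
    { destruct (vnorm_pos x) as [|E0]; [assumption|]. symmetry in E0.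
      pose proof (vnorm_eq0 _ _ E0) as ->.
      rewrite (dual_zero _ (dfun_dual f)), Cabs_C0, vnorm_0 in Hx; lra. }
    exists (f, vscal (RtoC (/ vnorm x)) x); simpl; split; [exact Hf|]; split; [exact Hn|].
    assert (Hi : 0 < / vnorm x) by now apply Rinv_0_lt_compat.
    rewrite vnorm_rscal, Rinv_l by lra; split; [lra|].
    rewrite (dual_scal _ (dfun_dual f)), Cabs_mul, Cabs_RtoC, Rabs_pos_eq by lra.
    apply Rmult_lt_compat_l with (r := / vnorm x) in Hx; [|exact Hi].
    replace (/ vnorm x * (2 / 3 * dnorm f * vnorm x)) with (2 / 3 * dnorm f) in Hx by (field; lra).
    lra. }
  set (fv := fun n => proj1_sig (constructive_indefinite_description _ (Hex n))).
  assert (Hfv : forall n, E (fst (fv n)) /\ 4 ^ n < dnorm (fst (fv n)) /\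
            vnorm (snd (fv n)) <= 1 /\
            2 / 3 * dnorm (fst (fv n)) <= Cabs (dfun (fst (fv n)) (snd (fv n))))
    by (intros n; exact (proj2_sig (constructive_indefinite_description _ (Hex n)))).
  set (f := fun n => fst (fv n)) in *; set (v := fun n => snd (fv n)) in *.
  set (step := fun (n : nat) (s : Cplx) (x : X) => vadd x (vscal (Cmul s (RtoC ((/ 3) ^ n))) (v n))).
  set (next := fun n x =>
    if Rle_dec ((/ 3) ^ n * Cabs (dfun (f n) (v n))) (Cabs (dfun (f n) (step n C1 x)))
    then step n C1 x else step n (Copp C1) x).
  set (x := fix x n := match n with O => vzero | S k => next k (x k) end).
  assert (H3 : forall n, 0 < (/ 3) ^ n) by (intros n; apply pow_lt; lra).
  assert (Hstep : forall n, vnorm (vsub (x (S n)) (x n)) <= (/ 3) ^ n).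
  { intros n; simpl. destruct (Hfv n) as (_ & _ & Hv & _). fold (v n) in Hv.
    assert (G : forall s, Cabs s = 1 -> vnorm (vsub (step n s (x n)) (x n)) <= (/ 3) ^ n).
    { intros s Hs; unfold step.
      replace (vsub _ _) with (vscal (Cmul s (RtoC ((/ 3) ^ n))) (v n)) by vector.
      rewrite vnorm_scal, Cabs_mul, Hs, Cabs_RtoC, Rabs_pos_eq by (apply Rlt_le, H3).
      pose proof (H3 n); nra. }
    unfold next; destruct (Rle_dec _ _); apply G; [|rewrite Cabs_opp]; apply Cabs_C1. }
  assert (Hlarge : forall n, (/ 3) ^ n * Cabs (dfun (f n) (v n)) <= Cabs (dfun (f n) (x (S n)))).
  { intros n; simpl; unfold next; destruct (Rle_dec _ _) as [|Hn]; [assumption|].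
    apply Rnot_le_lt in Hn.
    set (a := dfun (f n) (x n)). set (b := Cmul (RtoC ((/ 3) ^ n)) (dfun (f n) (v n))).
    assert (Es : forall s, dfun (f n) (step n s (x n)) = Cadd a (Cmul s b)).
    { intros s; unfold step.
      rewrite (dual_add _ (dfun_dual (f n))), (dual_scal _ (dfun_dual (f n))).
      unfold a, b; ring. }
    rewrite Es in *.
    assert (Eb : Cabs b = (/ 3) ^ n * Cabs (dfun (f n) (v n))).
    { unfold b; rewrite Cabs_mul, Cabs_RtoC, Rabs_pos_eq by (apply Rlt_le, H3); reflexivity. }
    rewrite <- Eb in *.
    (* The two candidate values differ by [2 b], so if one has modulus below [Cabs b], the other
       exceeds it. *)
    pose proof (Cabs_add (Cadd a (Cmul C1 b)) (Copp (Cadd a (Cmul (Copp C1) b)))) as Ht.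
    rewrite Cabs_opp in Ht.
    replace (Cadd (Cadd a (Cmul C1 b)) (Copp (Cadd a (Cmul (Copp C1) b))))
      with (Cmul (RtoC 2) b) in Ht by (apply Cplx_ext; simpl; ring).
    rewrite Cabs_mul, Cabs_RtoC, Rabs_pos_eq in Ht by lra. lra. }
  (* Partial sums of the geometric series of ratio 1/3; the factor 3/2 is [1 / (1 - 1/3)]. *)
  assert (Htail : forall n k, vnorm (vsub (x (n + k)%nat) (x n)) <= 3 / 2 * (/ 3) ^ n - 3 / 2 * (/ 3) ^ (n + k)).
  { intros n k; induction k as [|k IH].
    - rewrite Nat.add_0_r; unfold vsub; rewrite vadd_opp, vnorm_0; lra.
    - rewrite Nat.add_succ_r, pow_Rinv3.
      replace (vsub (x (S (n + k))) (x n))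
        with (vadd (vsub (x (S (n + k))) (x (n + k)%nat)) (vsub (x (n + k)%nat) (x n))) by vector.
      eapply Rle_trans; [apply vnorm_triangle|].
      pose proof (Hstep (n + k)%nat); lra. }
  assert (Hpow : forall eps, 0 < eps -> exists N, forall n, (N <= n)%nat -> (/ 3) ^ n < eps).
  { intros eps Heps. destruct (pow_lt_1_zero (/ 3) ltac:(rewrite Rabs_pos_eq; lra) eps Heps) as [N HN].
    exists N; intros n Hn; specialize (HN n Hn); now rewrite Rabs_pos_eq in HN by (apply Rlt_le, H3). }
  destruct (vcomplete _ x) as [l Hl].
  { intros eps Heps; destruct (Hpow (eps / 3) ltac:(lra)) as [N HN]; exists N; intros p q Hp Hq.
    pose proof (Htail N (p - N)%nat) as Hp'; pose proof (Htail N (q - N)%nat) as Hq'.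
    replace (N + (p - N))%nat with p in Hp' by lia.
    replace (N + (q - N))%nat with q in Hq' by lia.
    change (vnorm (vsub (x p) (x q)) < eps).
    replace (vsub (x p) (x q)) with (vadd (vsub (x p) (x N)) (vopp (vsub (x q) (x N)))) by vector.
    eapply Rle_lt_trans; [apply vnorm_triangle|]; rewrite vnorm_opp.
    pose proof (HN N (le_n N)); pose proof (H3 p); pose proof (H3 q); lra. }
  assert (Hlim : forall n, vnorm (vsub l (x n)) <= 3 / 2 * (/ 3) ^ n).
  { intros n; apply le_epsilon; intros eps Heps; destruct (Hl eps Heps) as [N HN].
    specialize (HN (n + N)%nat ltac:(lia)); fold (vsub (x (n + N)%nat) l) in HN.
    replace (vsub l (x n)) with (vadd (vopp (vsub (x (n + N)%nat) l)) (vsub (x (n + N)%nat) (x n)))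
      by vector.
    eapply Rle_trans; [apply vnorm_triangle|]; rewrite vnorm_opp.
    pose proof (Htail n N); pose proof (H3 (n + N)%nat); lra. }
  destruct (Hpt l) as [c Hc].
  (* The limit differs from [x (S n)] by at most [1/2 * 3^-n], while [f n] at [x (S n)] is at least
     [2/3 * 3^-n] times its norm. The difference 1/6 remains, multiplied by a norm above [4^n]. *)
  assert (Hbig : forall n, 1 / 6 * (4 / 3) ^ n <= c).
  { intros n; destruct (Hfv n) as (HE & Hn & _ & Hv); fold (f n) (v n) in *.
    specialize (Hc _ HE).
    pose proof (dnorm_spec (f n) (vsub l (x (S n)))) as Hd.
    pose proof (Hlim (S n)) as Hll; rewrite pow_Rinv3 in Hll.
    unfold vsub in Hd; rewrite (dual_add _ (dfun_dual (f n))), (dual_opp _ (dfun_dual (f n))) in Hd.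
    fold (vsub l (x (S n))) in Hd. fold (Csub (dfun (f n) l) (dfun (f n) (x (S n)))) in Hd.
    pose proof (Cabs_triangle (dfun (f n) (x (S n))) (dfun (f n) l) C0) as Ht.
    rewrite Cabs_sub_sym in Hd.
    replace (Csub (dfun (f n) (x (S n))) C0) with (dfun (f n) (x (S n))) in Ht by ring.
    replace (Csub (dfun (f n) l) C0) with (dfun (f n) l) in Ht by ring.
    pose proof (Hlarge n) as HL.
    replace (4 / 3) with (/ 3 * 4) by field. rewrite Rpow_mult_distr.
    pose proof (H3 n) as Hq. pose proof (dnorm_pos (f n)) as Hnp.
    assert (A1 : dnorm (f n) * vnorm (vsub l (x (S n))) <= dnorm (f n) * (1 / 2 * (/ 3) ^ n))
      by (apply Rmult_le_compat_l; lra).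
    assert (A2 : (/ 3) ^ n * (2 / 3 * dnorm (f n)) <= (/ 3) ^ n * Cabs (dfun (f n) (v n)))
      by (apply Rmult_le_compat_l; lra).
    assert (A3 : (/ 3) ^ n * 4 ^ n <= (/ 3) ^ n * dnorm (f n)) by (apply Rmult_le_compat_l; lra).
    lra. }
  destruct (Pow_x_infinity (4 / 3) ltac:(rewrite Rabs_pos_eq; lra) (6 * c + 1)) as [N HN].
  specialize (HN N (le_n N)); specialize (Hbig N).
  rewrite Rabs_pos_eq in HN by (apply pow_le; lra); lra.
Qed.

(** Uniform boundedness on the dual, applied to the evaluations at points of [S]; a norming
    functional recovers [vnorm x] from the norm of the evaluation. *)
Lemma weakly_bounded {X : CBanach} (S : X -> Prop) :
  (forall f, in_dual f -> exists c, forall x, S x -> Cabs (f x) <= c) ->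
  exists c, forall x, S x -> vnorm x <= c.
Proof.
  intros H.
  destruct (banach_steinhaus (X := dual X)
    (fun phi => exists x, S x /\ forall f, dfun phi f = dfun f x)) as [c Hc].
  - intros f; destruct (H _ (dfun_dual f)) as [c Hc]; exists c.
    intros phi (x & Sx & E); rewrite E; auto.
  - exists c; intros x Sx.
    set (phi := exist _ _ (dual_point x) : dual (dual X)).
    assert (Hphi : dnorm phi <= c) by (apply Hc; exists x; split; [exact Sx | reflexivity]).
    destruct (norming_functional x) as (f & Hf & Hf1 & Ef).
    pose proof (dnorm_spec phi (exist _ f Hf : dual X)) as Hs; simpl in Hs; rewrite Ef in Hs.
    pose proof (dnorm_min (exist _ f Hf : dual X) 1 ltac:(lra) Hf1) as Hm; simpl in Hm.
    rewrite Cabs_RtoC, Rabs_pos_eq in Hs by apply vnorm_pos.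
    pose proof (dnorm_pos phi); pose proof (dnorm_pos (exist _ f Hf : dual X)); simpl in *.
    change (@vnorm (dual X)) with (@dnorm X) in Hs. nra.
Qed.

(** * Circle means of differentiable functions *)

(** The remainder is quadratic, which is what the resolvent identity delivers. *)
Definition has_derivative_at (phi : Cplx -> Cplx) (z d : Cplx) : Prop :=
  exists C delta, 0 < delta /\ forall w, Cabs (Csub w z) < delta ->
    Cabs (Csub (Csub (phi w) (phi z)) (Cmul (Csub w z) d))
      <= C * (Cabs (Csub w z) * Cabs (Csub w z)).

Definition lipschitz_at (phi : Cplx -> Cplx) (z : Cplx) : Prop :=
  exists C delta, 0 < delta /\ forall w, Cabs (Csub w z) < delta ->
    Cabs (Csub (phi w) (phi z)) <= C * Cabs (Csub w z).

Lemma Cabs_mkC_le u v x y M : Rabs (u - x) <= M -> Rabs (v - y) <= M ->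
  Cabs (Csub (mkC u v) (mkC x y)) <= 2 * M.
Proof.
  intros H1 H2; eapply Rle_trans; [apply Cabs_le_ReIm|]; simpl; unfold Rminus in *; lra.
Qed.

Lemma differentiable_Re (phi : Cplx -> Cplx) x y d :
  has_derivative_at phi (mkC x y) d ->
  differentiable_pt_lim (fun u v => Cre (phi (mkC u v))) x y (Cre d) (- Cim d).
Proof.
  intros (C & delta & Hdelta & H) eps.
  assert (HC : 0 < 4 * (Rabs C + 1)) by (pose proof (Rabs_pos C); lra).
  (* With [M] the distance in the maximum norm, the modulus is at most [2 M] and the remainder at
     most [4 (|C| + 1) M^2]; this radius brings it below [eps * M]. *)
  assert (Hm : 0 < Rmin (delta / 2) (eps / (4 * (Rabs C + 1)))).
  { apply Rmin_glb_lt; [lra|]. apply Rdiv_lt_0_compat; [apply cond_pos | exact HC]. }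
  exists (mkposreal _ Hm); simpl; intros u v Hu Hv.
  set (M := Rmax (Rabs (u - x)) (Rabs (v - y))).
  assert (HM : M < Rmin (delta / 2) (eps / (4 * (Rabs C + 1)))) by now apply Rmax_lub_lt.
  assert (HM0 : 0 <= M) by (eapply Rle_trans; [apply Rabs_pos | apply Rmax_l]).
  assert (Hd : Cabs (Csub (mkC u v) (mkC x y)) <= 2 * M)
    by (apply Cabs_mkC_le; [apply Rmax_l | apply Rmax_r]).
  pose proof (Rmin_l (delta / 2) (eps / (4 * (Rabs C + 1)))) as Hl.
  pose proof (Rmin_r (delta / 2) (eps / (4 * (Rabs C + 1)))) as Hr.
  specialize (H (mkC u v) ltac:(lra)).
  apply Rle_trans with (4 * (Rabs C + 1) * (M * M)).
  - eapply Rle_trans; [|eapply Rle_trans; [exact H|]].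
    + eapply Rle_trans; [|apply Cre_le]. right; f_equal; simpl; ring.
    + pose proof (Cabs_pos (Csub (mkC u v) (mkC x y))) as Hp.
      pose proof (Rle_abs C).
      assert (Cabs (Csub (mkC u v) (mkC x y)) * Cabs (Csub (mkC u v) (mkC x y)) <= 4 * (M * M))
        by nra.
      pose proof (Rabs_pos C). nra.
  - assert (E : M < eps / (4 * (Rabs C + 1))) by lra.
    apply Rmult_lt_compat_r with (r := 4 * (Rabs C + 1)) in E; [|lra].
    replace (eps / (4 * (Rabs C + 1)) * (4 * (Rabs C + 1))) with (pos eps) in E by (field; lra).
    nra.
Qed.

(** The chain rule in the form of the real part of [d] times the velocity; imaginary parts are
    reached by applying it to [-i phi]. *)
Lemma derivative_along_curve (phi : Cplx -> Cplx) (c1 c2 : R -> R) t d1 d2 d :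
  has_derivative_at phi (mkC (c1 t) (c2 t)) d ->
  is_derive c1 t d1 -> is_derive c2 t d2 ->
  is_derive (fun u => Cre (phi (mkC (c1 u) (c2 u)))) t (Cre d * d1 - Cim d * d2).
Proof.
  intros H H1 H2; apply is_derive_Reals.
  replace (Cre d * d1 - Cim d * d2) with (Cre d * d1 + - Cim d * d2) by ring.
  apply (derivable_pt_lim_comp_2d (fun u v => Cre (phi (mkC u v)))).
  - now apply differentiable_Re.
  - now apply is_derive_Reals.
  - now apply is_derive_Reals.
Qed.

(** [F] stands for the real or the imaginary part, both of which are 1-Lipschitz. *)
Lemma lipschitz_continuity_2d (psi : Cplx -> Cplx) x y (F : Cplx -> R) :
  (forall a b, Rabs (F a - F b) <= Cabs (Csub a b)) ->
  lipschitz_at psi (mkC x y) -> continuity_2d_pt (fun u v => F (psi (mkC u v))) x y.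
Proof.
  intros HF (C & delta & Hdelta & H) eps.
  assert (HC : 0 < 2 * (Rabs C + 1)) by (pose proof (Rabs_pos C); lra).
  assert (Hm : 0 < Rmin (delta / 2) (eps / (2 * (Rabs C + 1)))).
  { apply Rmin_glb_lt; [lra|]. apply Rdiv_lt_0_compat; [apply cond_pos | exact HC]. }
  exists (mkposreal _ Hm); simpl; intros u v Hu Hv.
  set (M := Rmax (Rabs (u - x)) (Rabs (v - y))).
  assert (HM : M < Rmin (delta / 2) (eps / (2 * (Rabs C + 1)))) by now apply Rmax_lub_lt.
  assert (HM0 : 0 <= M) by (eapply Rle_trans; [apply Rabs_pos | apply Rmax_l]).
  assert (Hd : Cabs (Csub (mkC u v) (mkC x y)) <= 2 * M)
    by (apply Cabs_mkC_le; [apply Rmax_l | apply Rmax_r]).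
  pose proof (Rmin_l (delta / 2) (eps / (2 * (Rabs C + 1)))) as Hl.
  pose proof (Rmin_r (delta / 2) (eps / (2 * (Rabs C + 1)))) as Hr.
  specialize (H (mkC u v) ltac:(lra)).
  eapply Rle_lt_trans; [apply HF|]. eapply Rle_lt_trans; [exact H|].
  assert (E : M < eps / (2 * (Rabs C + 1))) by lra.
  apply Rmult_lt_compat_r with (r := 2 * (Rabs C + 1)) in E; [|lra].
  replace (eps / (2 * (Rabs C + 1)) * (2 * (Rabs C + 1))) with (pos eps) in E by (field; lra).
  pose proof (Cabs_pos (Csub (mkC u v) (mkC x y))) as Hp.
  pose proof (Rle_abs C). pose proof (Rabs_pos C). nra.
Qed.

Lemma Cre_lipschitz a b : Rabs (Cre a - Cre b) <= Cabs (Csub a b).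
Proof. apply (Cre_le (Csub a b)). Qed.

Lemma Cim_lipschitz a b : Rabs (Cim a - Cim b) <= Cabs (Csub a b).
Proof. apply (Cim_le (Csub a b)). Qed.

Lemma polar_continuous (F : R -> R -> R) rho t :
  continuity_2d_pt F (rho * cos t) (rho * sin t) ->
  continuous (fun z : R * R => F (fst z * cos (snd z)) (fst z * sin (snd z))) (rho, t).
Proof.
  intros H; apply continuity_2d_pt_filterlim in H.
  apply (continuous_comp_2 (fun z : R * R => fst z * cos (snd z)) (fun z : R * R => fst z * sin (snd z)) F).
  - apply (continuous_mult (K := R_AbsRing) (fun z : R * R => fst z) (fun z : R * R => cos (snd z))).
    + apply continuous_fst.
    + apply (continuous_comp (fun z : R * R => snd z) cos); [apply continuous_snd | apply continuous_cos].
  - apply (continuous_mult (K := R_AbsRing) (fun z : R * R => fst z) (fun z : R * R => sin (snd z))).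
    + apply continuous_fst.
    + apply (continuous_comp (fun z : R * R => snd z) sin); [apply continuous_snd | apply continuous_sin].
  - exact H.
Qed.

(* The circle means of [Re phi] do not depend on the radius: by Cauchy-Riemann the radial derivative
   of [Re phi] is [1 / rho] times the angular derivative of [Im phi], which integrates to 0. *)
Lemma circle_mean_constant (phi dphi : Cplx -> Cplx) :
  (forall z, has_derivative_at phi z (dphi z)) -> (forall z, lipschitz_at dphi z) ->
  forall rho, 0 < rho ->
    RInt (fun t => Cre (phi (mkC (rho * cos t) (rho * sin t)))) 0 (2 * PI)
    = 2 * PI * Cre (phi C0).
Proof.
  intros Hd Hl rho Hrho.
  set (h := fun r t => Cre (phi (mkC (r * cos t) (r * sin t)))).
  set (k := fun r t => Cre (dphi (mkC (r * cos t) (r * sin t))) * cos t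
                       - Cim (dphi (mkC (r * cos t) (r * sin t))) * sin t).
  assert (Hcos : forall r t, is_derive (fun u => u * cos t) r (cos t))
    by (intros; auto_derive; [trivial | ring]).
  assert (Hsin : forall r t, is_derive (fun u => u * sin t) r (sin t))
    by (intros; auto_derive; [trivial | ring]).
  assert (Hh : forall r t, is_derive (fun u => h u t) r (k r t)).
  { intros r t; apply (derivative_along_curve phi (fun u => u * cos t) (fun u => u * sin t)); auto. }
  (* The real part of [-i phi] is the imaginary part of [phi]; its angular derivative is [r] times
     the radial derivative [k]. *)
  assert (Hq : forall r t, is_derive
      (fun u => Cre (Cmul (Copp Ci) (phi (mkC (r * cos u) (r * sin u))))) t (r * k r t)).
  { intros r t.
    replace (r * k r t) with
      (Cre (Cmul (Copp Ci) (dphi (mkC (r * cos t) (r * sin t)))) * (- (r * sin t))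
       - Cim (Cmul (Copp Ci) (dphi (mkC (r * cos t) (r * sin t)))) * (r * cos t))
      by (unfold k; simpl; ring).
    apply (derivative_along_curve (fun z => Cmul (Copp Ci) (phi z))
             (fun u => r * cos u) (fun u => r * sin u)).
    - destruct (Hd (mkC (r * cos t) (r * sin t))) as (C & delta & Hdel & H).
      exists C, delta; split; [exact Hdel|]; intros w Hw.
      specialize (H w Hw); eapply Rle_trans; [|exact H]; right.
      match goal with |- Cabs ?a = Cabs ?b => replace a with (Cmul (Copp Ci) b) by ring end.
      rewrite Cabs_mul, Cabs_opp.
      replace (Cabs Ci) with 1; [ring|].
      unfold Cabs, Ci; simpl; replace (0 * 0 + 1 * 1) with 1 by ring; now rewrite sqrt_1.
    - auto_derive; [trivial | ring].
    - auto_derive; [trivial | ring]. }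
  assert (Hk : forall r t, continuous (fun z : R * R => k (fst z) (snd z)) (r, t)).
  { intros r t; unfold k.
    apply (continuous_minus (V := R_NormedModule)
      (fun z : R * R => Cre (dphi (mkC (fst z * cos (snd z)) (fst z * sin (snd z)))) * cos (snd z))
      (fun z : R * R => Cim (dphi (mkC (fst z * cos (snd z)) (fst z * sin (snd z)))) * sin (snd z))).
    - apply (continuous_mult (K := R_AbsRing)
        (fun z : R * R => Cre (dphi (mkC (fst z * cos (snd z)) (fst z * sin (snd z)))))
        (fun z : R * R => cos (snd z))).
      + apply (polar_continuous (fun u v => Cre (dphi (mkC u v)))).
        apply lipschitz_continuity_2d; [apply Cre_lipschitz | apply Hl].
      + apply (continuous_comp (fun z : R * R => snd z) cos); [apply continuous_snd | apply continuous_cos].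
    - apply (continuous_mult (K := R_AbsRing)
        (fun z : R * R => Cim (dphi (mkC (fst z * cos (snd z)) (fst z * sin (snd z)))))
        (fun z : R * R => sin (snd z))).
      + apply (polar_continuous (fun u v => Cim (dphi (mkC u v)))).
        apply lipschitz_continuity_2d; [apply Cim_lipschitz | apply Hl].
      + apply (continuous_comp (fun z : R * R => snd z) sin); [apply continuous_snd | apply continuous_sin]. }
  assert (Hkt : forall r t, continuous (fun u => k r u) t).
  { intros r t; apply (continuous_comp_2 (fun _ : R => r) (fun u : R => u) k).
    - apply continuous_const.
    - apply continuous_id.
    - apply Hk. }
  assert (Hht : forall r, ex_RInt (fun t => h r t) 0 (2 * PI)).
  { intros r; apply (ex_RInt_continuous (V := R_CompleteNormedModule)); intros t _.
    apply (ex_derive_continuous (V := R_NormedModule)).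
    exists (Cre (dphi (mkC (r * cos t) (r * sin t))) * (- (r * sin t))
       - Cim (dphi (mkC (r * cos t) (r * sin t))) * (r * cos t)).
    apply (derivative_along_curve phi (fun u => r * cos u) (fun u => r * sin u)).
    - apply Hd.
    - auto_derive; [trivial | ring].
    - auto_derive; [trivial | ring]. }
  assert (HD : forall r t, Derive (fun u => h u t) r = k r t)
    by (intros; apply is_derive_unique, Hh).
  assert (Hg : forall r, is_derive (fun r => RInt (fun t => h r t) 0 (2 * PI)) r
                 (RInt (fun t => k r t) 0 (2 * PI))).
  { intros r. rewrite <- (RInt_ext (fun t => Derive (fun u => h u t) r)) by (intros; apply HD).
    apply is_derive_RInt_param.
    - apply filter_forall; intros; eexists; apply Hh.
    - intros t _. apply continuity_2d_pt_filterlim.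
      apply (filterlim_ext (fun z : R * R => k (fst z) (snd z))).
      { intros z; symmetry; apply HD. }
      rewrite HD; apply (Hk r t).
    - apply filter_forall; intros; apply Hht. }
  assert (Hzero : forall r, 0 <= r -> RInt (fun t => k r t) 0 (2 * PI) = 0).
  { intros r Hr; apply is_RInt_unique.
    destruct Hr as [Hr|<-].
    - pose proof (is_RInt_derive (V := R_CompleteNormedModule) _ (fun t => r * k r t) 0 (2 * PI)
        (fun t _ => Hq r t)) as HI.
      assert (HI' : is_RInt (fun t => r * k r t) 0 (2 * PI) 0).
      { cbv beta in HI; rewrite sin_2PI, cos_2PI, sin_0, cos_0, minus_eq_zero in HI; apply HI.
        intros t _; apply (continuous_mult (K := R_AbsRing) (fun _ : R => r) (fun u => k r u));
          [apply continuous_const | apply Hkt]. }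
      apply (is_RInt_scal (V := R_NormedModule) _ _ _ (/ r)) in HI'.
      change (is_RInt (fun t => / r * (r * k r t)) 0 (2 * PI) (/ r * 0)) in HI'.
      rewrite Rmult_0_r in HI'.
      eapply is_RInt_ext; [|exact HI']. intros t _; simpl; field; lra.
    (* At radius 0 there is no division by [r]; here [k 0] is a fixed combination of [cos] and
       [sin], integrated directly. *)
    - set (a := Cre (dphi C0)); set (b := Cim (dphi C0)).
      assert (Ek : forall t, k 0 t = a * cos t - b * sin t).
      { intros t; unfold k; now rewrite !Rmult_0_l. }
      pose proof (is_RInt_derive (V := R_CompleteNormedModule) (fun t => a * sin t + b * cos t) (fun t => k 0 t) 0 (2 * PI)) as HI.
      cbv beta in HI. rewrite sin_2PI, cos_2PI, sin_0, cos_0, minus_eq_zero in HI; apply HI.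
      + intros t _; rewrite Ek; auto_derive; [trivial | ring].
      + intros t _; apply Hkt. }
  replace (2 * PI * Cre (phi C0)) with (RInt (fun t => h 0 t) 0 (2 * PI)).
  - symmetry.
    apply (eq_is_derive (V := R_NormedModule) (fun r => RInt (fun t => h r t) 0 (2 * PI)) 0 rho); [|exact Hrho].
    intros r Hr; change (zero : R_NormedModule) with 0.
    pose proof (Hg r) as E; rewrite (Hzero r) in E by apply Hr; exact E.
  - rewrite (RInt_ext _ (fun _ => Cre (phi C0))).
    + rewrite RInt_const; unfold scal; simpl; unfold mult; simpl; ring.
    + intros t _; unfold h; now rewrite !Rmult_0_l.
Qed.

(** The mean over a circle does not depend on the radius and tends to 0 for large radii. The real
    part at 0 is enough for the application, where the value at 0 is a norm. *)
Lemma entire_decay_zero (phi dphi : Cplx -> Cplx) :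
  (forall z, has_derivative_at phi z (dphi z)) -> (forall z, lipschitz_at dphi z) ->
  (forall eps, 0 < eps -> exists M, forall z, M <= Cabs z -> Cabs (phi z) <= eps) ->
  Cre (phi C0) = 0.
Proof.
  intros Hd Hl Hdecay.
  apply cond_eq; intros eps Heps; rewrite Rminus_0_r.
  destruct (Hdecay (eps / 2) ltac:(lra)) as [M HM].
  set (rho := Rabs M + 1). assert (Hrho : 0 < rho) by (unfold rho; pose proof (Rabs_pos M); lra).
  pose proof PI_RGT_0 as Hpi.
  assert (HI : Rabs (RInt (fun t => Cre (phi (mkC (rho * cos t) (rho * sin t)))) 0 (2 * PI))
               <= (2 * PI - 0) * (eps / 2)).
  { apply abs_RInt_le_const; [lra| |].
    - apply (ex_RInt_continuous (V := R_CompleteNormedModule)); intros t _.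
      apply (ex_derive_continuous (V := R_NormedModule)).
      eexists.
      apply (derivative_along_curve phi (fun u => rho * cos u) (fun u => rho * sin u)).
      + apply Hd.
      + auto_derive; [trivial | reflexivity].
      + auto_derive; [trivial | reflexivity].
    - intros t _; eapply Rle_trans; [apply Cre_le|]. apply HM.
      assert (E : Cabs (mkC (rho * cos t) (rho * sin t)) = rho).
      { unfold Cabs; simpl. replace (_ + _) with (Rsqr rho * (Rsqr (sin t) + Rsqr (cos t)))
          by (unfold Rsqr; ring).
        rewrite sin2_cos2, Rmult_1_r; apply sqrt_Rsqr; lra. }
      rewrite E; unfold rho; pose proof (Rle_abs M); lra. }
  rewrite (circle_mean_constant phi dphi Hd Hl rho Hrho) in HI.
  rewrite Rabs_mult, (Rabs_pos_eq (2 * PI)) in HI by lra.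
  assert (Rabs (Cre (phi C0)) <= eps / 2); [|lra].
  apply Rmult_le_reg_l with (2 * PI); lra.
Qed.

(** * Spectra *)

Definition shift {X : CBanach} (T : X -> X) (z : Cplx) : X -> X :=
  fun x => vadd (T x) (vopp (vscal z x)).

Lemma is_op_comp {X Y Z : CBanach} (S : Y -> Z) (T : X -> Y) :
  is_op S -> is_op T -> is_op (fun x => S (T x)).
Proof.
  intros HS HT; destruct (op_bound S HS) as (c & Hc0 & Hc), (op_bound T HT) as (d & _ & Hd).
  apply is_op_intro with (c * d).
  - intros x y; now rewrite (op_add T HT), (op_add S HS).
  - intros a x; now rewrite (op_scal T HT), (op_scal S HS).
  - intros x; specialize (Hd x); specialize (Hc (T x)); nra.
Qed.

Lemma is_op_lincomb {X Y : CBanach} (a b : Cplx) (S T : X -> Y) :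
  is_op S -> is_op T -> is_op (fun x => vadd (vscal a (S x)) (vscal b (T x))).
Proof.
  intros HS HT; destruct (op_bound S HS) as (c & _ & Hc), (op_bound T HT) as (d & _ & Hd).
  apply is_op_intro with (Cabs a * c + Cabs b * d).
  - intros x y; rewrite (op_add S HS), (op_add T HT); vector.
  - intros u x; rewrite (op_scal S HS), (op_scal T HT); vector.
  - intros x; eapply Rle_trans; [apply vnorm_triangle|]; rewrite !vnorm_scal.
    specialize (Hc x); specialize (Hd x); pose proof (Cabs_pos a); pose proof (Cabs_pos b); nra.
Qed.

Lemma is_op_id (X : CBanach) : is_op (fun x : X => x).
Proof. apply is_op_intro with 1; try reflexivity; intros x; lra. Qed.

Lemma is_op_shift {X : CBanach} (T : X -> X) z : is_op T -> is_op (shift T z).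
Proof.
  intros HT; replace (shift T z) with (fun x => vadd (vscal C1 (T x)) (vscal (Copp z) x)).
  - apply (is_op_lincomb C1 (Copp z) T (fun x => x)); [exact HT | apply is_op_id].
  - apply functional_extensionality; intros x; unfold shift; vector.
Qed.

Lemma is_op_pow {X : CBanach} (T : X -> X) n : is_op T -> is_op (opow T n).
Proof.
  intros HT; induction n as [|n IH]; [apply is_op_id|]; exact (is_op_comp T (opow T n) HT IH).
Qed.

Lemma is_op_prod {X : CBanach} (B A : X -> X) r s : is_op A -> is_op B -> is_op (prod_op B r A s).
Proof.
  intros HA HB; apply (is_op_comp (opow B r) (fun x => A (opow B s x))); [now apply is_op_pow|].
  apply (is_op_comp A); [exact HA | now apply is_op_pow].
Qed.

Lemma opow_S {X : CBanach} (T : X -> X) n x : opow T (S n) x = T (opow T n x).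
Proof. reflexivity. Qed.

Lemma opow_add {X : CBanach} (T : X -> X) n k x : opow T (n + k) x = opow T n (opow T k x).
Proof. induction n as [|n IH]; [reflexivity|]; simpl Nat.add; now rewrite !opow_S, IH. Qed.

Lemma spectrum_alt {X : CBanach} (T : X -> X) z : spectrum T z <-> ~ invertible_op (shift T z).
Proof. reflexivity. Qed.

(** * The resolvent of an operator whose spectrum is empty *)

Section Resolvent.
Context {X : CBanach} (T : X -> X) (HT : is_op T) (R : Cplx -> X -> X)
  (HR : forall z, inverse_ops (shift T z) (R z)).

Lemma resolvent_op z : is_op (R z).
Proof. apply HR. Qed.

Lemma resolvent_eq z x : T (R z x) = vadd x (vscal z (R z x)).
Proof.
  destruct (HR z) as (_ & _ & _ & H); specialize (H x); unfold shift in H.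
  rewrite <- H at 2; vector.
Qed.

Lemma resolvent_identity w z x : R w x = vadd (R z x) (vscal (Csub w z) (R z (R w x))).
Proof.
  destruct (HR z) as (_ & _ & H & _). rewrite <- (H (R w x)) at 1.
  unfold shift; rewrite resolvent_eq.
  rewrite <- (op_scal _ (resolvent_op z)), <- (op_add _ (resolvent_op z)); f_equal; vector.
Qed.

Lemma resolvent_identity' w z x : R w x = vadd (R z x) (vscal (Csub w z) (R w (R z x))).
Proof. rewrite (resolvent_identity z w x) at 1; vector. Qed.

(** For [w] this close to [z], the resolvent identity bounds the norm of [R w x] by [c * vnorm x]
    plus half of itself, whence the constant [2 c]. *)
Lemma resolvent_locally_bounded z : exists c delta, 0 < delta /\ 0 <= c /\
  forall w x, Cabs (Csub w z) < delta -> vnorm (R w x) <= c * vnorm x.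
Proof.
  destruct (op_bound _ (resolvent_op z)) as (c & Hc0 & Hc).
  exists (2 * c), (/ (2 * (c + 1))); split; [apply Rinv_0_lt_compat; lra|split; [lra|]].
  intros w x Hw.
  apply Rmult_lt_compat_r with (r := 2 * (c + 1)) in Hw; [|lra].
  rewrite Rinv_l in Hw by lra.
  pose proof (Hc x) as H1; pose proof (Hc (R w x)) as H2.
  pose proof (vnorm_triangle _ (R z x) (vscal (Csub w z) (R z (R w x)))) as Ht.
  rewrite <- resolvent_identity, vnorm_scal in Ht.
  pose proof (Cabs_pos (Csub w z)) as Hp; pose proof (vnorm_pos (R w x)) as Hn.
  assert (Cabs (Csub w z) * vnorm (R z (R w x)) <= Cabs (Csub w z) * (c * vnorm (R w x)))
    by (apply Rmult_le_compat_l; lra).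
  assert (Cabs (Csub w z) * c * vnorm (R w x) <= 1 / 2 * vnorm (R w x))
    by (apply Rmult_le_compat_r; lra).
  lra.
Qed.

(** Applying the resolvent identity twice leaves exactly [(w - z)^2 R_w R_z R_z] as remainder. *)
Lemma resolvent_functional_derivative (f : X -> Cplx) (x : X) z : in_dual f ->
  has_derivative_at (fun z => f (R z x)) z (f (R z (R z x))).
Proof.
  intros Hf; destruct (resolvent_locally_bounded z) as (c & delta & Hd & Hc0 & Hc).
  destruct (dual_bound f Hf) as (k & Hk0 & Hk).
  exists (k * (c * vnorm (R z (R z x)))), delta; split; [exact Hd|]; intros w Hw.
  replace (Csub (Csub (f (R w x)) (f (R z x))) (Cmul (Csub w z) (f (R z (R z x)))))
    with (Cmul (Cmul (Csub w z) (Csub w z)) (f (R w (R z (R z x))))).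
  - rewrite !Cabs_mul.
    pose proof (Hk (R w (R z (R z x)))) as H1; pose proof (Hc w (R z (R z x)) Hw) as H2.
    pose proof (Cabs_pos (Csub w z)) as Hp.
    assert (Cabs (f (R w (R z (R z x)))) <= k * (c * vnorm (R z (R z x)))) by nra.
    assert (0 <= Cabs (Csub w z) * Cabs (Csub w z)) by nra. nra.
  - rewrite (resolvent_identity' w z x), (resolvent_identity' w z (R z x)).
    rewrite !(dual_add f Hf), !(dual_scal f Hf), !(dual_add f Hf), !(dual_scal f Hf); ring.
Qed.

Lemma resolvent_square_lipschitz (f : X -> Cplx) (x : X) z : in_dual f ->
  lipschitz_at (fun z => f (R z (R z x))) z.
Proof.
  intros Hf; destruct (resolvent_locally_bounded z) as (c & delta & Hd & Hc0 & Hc).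
  destruct (dual_bound f Hf) as (k & Hk0 & Hk).
  exists (k * (c * (c * vnorm (R z x))) + k * (c * vnorm (R z (R z x)))), delta.
  split; [exact Hd|]; intros w Hw.
  replace (Csub (f (R w (R w x))) (f (R z (R z x))))
    with (Cmul (Cadd (f (R w (R w (R z x)))) (f (R w (R z (R z x))))) (Csub w z)).
  - rewrite Cabs_mul. apply Rmult_le_compat_r; [apply Cabs_pos|].
    eapply Rle_trans; [apply Cabs_add|].
    pose proof (Hk (R w (R z (R z x)))); pose proof (Hc w (R z (R z x)) Hw).
    pose proof (Hk (R w (R w (R z x)))); pose proof (Hc w (R w (R z x)) Hw).
    pose proof (Hc w (R z x) Hw).
    assert (c * vnorm (R w (R z x)) <= c * (c * vnorm (R z x))) by (apply Rmult_le_compat_l; lra).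
    assert (k * vnorm (R w (R w (R z x))) <= k * (c * (c * vnorm (R z x))))
      by (apply Rmult_le_compat_l; lra).
    assert (k * vnorm (R w (R z (R z x))) <= k * (c * vnorm (R z (R z x))))
      by (apply Rmult_le_compat_l; lra).
    lra.
  - assert (E1 : R w (R w x) = vadd (R w (R z x)) (vscal (Csub w z) (R w (R w (R z x))))).
    { rewrite (resolvent_identity' w z x).
      now rewrite (op_add _ (resolvent_op w)), (op_scal _ (resolvent_op w)). }
    rewrite E1, (dual_add f Hf), (dual_scal f Hf).
    rewrite (resolvent_identity' w z (R z x)) at 2.
    rewrite (dual_add f Hf), (dual_scal f Hf); ring.
Qed.

Lemma resolvent_decay (f : X -> Cplx) (x : X) : in_dual f ->
  forall eps, 0 < eps -> exists M, forall z, M <= Cabs z -> Cabs (f (R z x)) <= eps.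
Proof.
  intros Hf eps Heps; destruct (op_bound T HT) as (c & Hc0 & Hc).
  destruct (dual_bound f Hf) as (k & Hk0 & Hk). pose proof (vnorm_pos x) as Hx.
  (* For [|z| >= c + K] the identity [z R_z x = T R_z x - x] gives [K |R_z x| <= |x|]; this [K] is
     positive and makes [k |x| / K] at most [eps]. *)
  set (K := k * vnorm x / eps + 1).
  assert (HK : 0 <= k * vnorm x / eps).
  { apply Rmult_le_pos; [nra | apply Rlt_le, Rinv_0_lt_compat, Heps]. }
  exists (c + K); intros z Hz.
  assert (Ez : vscal z (R z x) = vadd (T (R z x)) (vopp x)) by (rewrite resolvent_eq; vector).
  pose proof (vnorm_triangle _ (T (R z x)) (vopp x)) as Ht.
  rewrite <- Ez, vnorm_scal, vnorm_opp in Ht.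
  pose proof (Hc (R z x)) as Hcr; pose proof (vnorm_pos (R z x)) as Hr.
  assert (HKr : K * vnorm (R z x) <= vnorm x) by nra.
  eapply Rle_trans; [apply Hk|].
  assert (E : k * vnorm x = eps * (K - 1)) by (unfold K; field; lra).
  assert (k * (K * vnorm (R z x)) <= k * vnorm x) by (apply Rmult_le_compat_l; lra).
  apply Rmult_le_reg_l with K; unfold K in *; nra.
Qed.

End Resolvent.

(** With empty spectrum, [f (R z x)] is entire and tends to 0 at infinity, so its real part vanishes
    at 0. For [f] norming [R 0 x] this says [R 0 x = 0], hence [x = 0]. *)
Lemma spectrum_nonempty {X : CBanach} (T : X -> X) :
  is_op T -> (exists x : X, x <> vzero) -> exists z, spectrum T z.
Proof.
  intros HT [x Hx]; apply NNPP; intros Hno.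
  assert (Hinv : forall z, exists R, inverse_ops (shift T z) R).
  { intros z; apply NNPP; intros H; apply Hno; exists z; exact H. }
  set (R := fun z => proj1_sig (constructive_indefinite_description _ (Hinv z))).
  assert (HR : forall z, inverse_ops (shift T z) (R z))
    by (intros z; exact (proj2_sig (constructive_indefinite_description _ (Hinv z)))).
  apply Hx. destruct (HR C0) as (Hsh & _ & _ & H). rewrite <- (H x).
  replace (R C0 x) with (vzero : X); [now apply op_zero|].
  symmetry; apply vnorm_eq0.
  destruct (norming_functional (R C0 x)) as (f & Hf & _ & E).
  apply (f_equal Cre) in E; simpl in E; rewrite <- E.
  apply (entire_decay_zero (fun z => f (R z x)) (fun z => f (R z (R z x)))).
  - intros z; now apply (resolvent_functional_derivative T).
  - intros z; now apply (resolvent_square_lipschitz T).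
  - now apply (resolvent_decay T HT).
Qed.

(** Jacobson's identity: if [R] inverts [T S - z], then [z^-1 (S R T - 1)] inverts [S T - z]. *)
Lemma spectrum_comp_comm {X : CBanach} (S T : X -> X) z : is_op S -> is_op T -> z <> C0 ->
  spectrum (fun x => S (T x)) z -> spectrum (fun x => T (S x)) z.
Proof.
  intros HS HT Hz Hsp [R (Hop & HR & HRl & HRr)]; apply Hsp.
  exists (fun x => vadd (vscal (Cinv z) (S (R (T x)))) (vscal (Copp (Cinv z)) x)).
  split; [|split; [|split]].
  - apply is_op_shift, (is_op_comp S T); assumption.
  - apply (is_op_lincomb (Cinv z) (Copp (Cinv z)) (fun x => S (R (T x))) (fun x => x)); [|apply is_op_id].
    apply (is_op_comp S); [exact HS|]; now apply (is_op_comp R).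
  - intros x. specialize (HRl (T x)); unfold shift in HRl.
    rewrite (op_add T HT), (op_opp T HT), (op_scal T HT), HRl.
    vector_with ltac:(field; exact Hz).
  - intros x; specialize (HRr (T x)); unfold shift in HRr; cbv beta in HRr.
    rewrite (op_add T HT), !(op_scal T HT).
    replace (T (S (R (T x)))) with (vadd (T x) (vscal z (R (T x)))) by (rewrite <- HRr at 1; vector).
    rewrite !(op_add S HS), !(op_scal S HS), (op_add S HS), !(op_scal S HS).
    vector_with ltac:(field; exact Hz).
Qed.

Lemma spectrum_trivial {X : CBanach} (T : X -> X) z :
  is_op T -> (forall x : X, x = vzero) -> ~ spectrum T z.
Proof.
  intros HT H Hsp; apply Hsp; exists (fun x => x); split; [|split; [|split]].
  - now apply is_op_shift.
  - apply is_op_id.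
  - intros x; rewrite (H x); apply H.
  - intros x; rewrite (H x); apply H.
Qed.

Lemma nontrivial_of_spectrum {X : CBanach} (T : X -> X) z :
  is_op T -> spectrum T z -> exists x : X, x <> vzero.
Proof.
  intros HT Hsp; apply NNPP; intros H; revert Hsp; apply spectrum_trivial; [exact HT|].
  intros x; apply NNPP; intros Hx; eauto.
Qed.

Lemma peripheral_spectrum_intro {X : CBanach} (T : X -> X) z : spectrum T z ->
  (forall w, spectrum T w -> Cabs w <= Cabs z) -> peripheral_spectrum T z.
Proof.
  intros Hz H; split; [exact Hz|]; split.
  - intros t (w & Hw & ->); auto.
  - intros b Hb; apply Hb; eauto.
Qed.

Lemma peripheral_spectrum_max {X : CBanach} (T : X -> X) z w :
  peripheral_spectrum T z -> spectrum T w -> Cabs w <= Cabs z.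
Proof. intros [_ [H _]] Hw; apply H; eauto. Qed.

(** The delicate value is 0: if it is peripheral for [S], then [T] has no nonzero spectrum either,
    and nonemptiness puts 0 in the spectrum of [T]. *)
Lemma peripheral_of_nonzero_spectrum {X : CBanach} (S T : X -> X) z : is_op S -> is_op T ->
  (forall w, w <> C0 -> spectrum S w <-> spectrum T w) ->
  peripheral_spectrum S z -> peripheral_spectrum T z.
Proof.
  intros HS HT H Hz.
  assert (Hub : forall w, spectrum T w -> Cabs w <= Cabs z).
  { intros w Hw; destruct (Cplx_dec w C0) as [->|Hw0].
    - rewrite Cabs_C0; apply Cabs_pos.
    - apply (peripheral_spectrum_max S); [exact Hz | now apply H]. }
  apply peripheral_spectrum_intro; [|exact Hub].
  destruct (Cplx_dec z C0) as [->|Hz0]; [|apply H; [exact Hz0 | apply Hz]].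
  destruct (spectrum_nonempty T HT) as [w Hw].
  { apply (nontrivial_of_spectrum S C0 HS), Hz. }
  replace C0 with w; [exact Hw|]. specialize (Hub w Hw); rewrite Cabs_C0 in Hub.
  apply Cabs_eq0, Rle_antisym; [exact Hub | apply Cabs_pos].
Qed.

Lemma peripheral_comp_comm {X : CBanach} (S T : X -> X) z : is_op S -> is_op T ->
  peripheral_spectrum (fun x => S (T x)) z -> peripheral_spectrum (fun x => T (S x)) z.
Proof.
  intros HS HT; apply peripheral_of_nonzero_spectrum; try now apply is_op_comp.
  intros w Hw; split; now apply spectrum_comp_comm.
Qed.

(** Moving [B^s] to the front gives [B^s B^r A = B^r B^s A]; moving [B^r] to the back then gives
    [B^s A B^r]. *)
Lemma peripheral_prod_swap {X : CBanach} (A B : X -> X) r s z : is_op A -> is_op B ->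
  peripheral_spectrum (prod_op B r A s) z -> peripheral_spectrum (prod_op B s A r) z.
Proof.
  intros HA HB H.
  pose proof (is_op_pow B r HB) as Hr; pose proof (is_op_pow B s HB) as Hs.
  apply (peripheral_comp_comm (opow B r) (fun x => opow B s (A x)));
    [exact Hr | now apply (is_op_comp (opow B s) A)|].
  apply (peripheral_comp_comm (fun x => opow B r (A x)) (opow B s)) in H;
    [|now apply (is_op_comp (opow B r) A) | exact Hs].
  replace (fun x => opow B r (opow B s (A x))) with (fun x => opow B s (opow B r (A x))); [exact H|].
  apply functional_extensionality; intros x; rewrite <- !opow_add; f_equal; lia.
Qed.

Lemma peripheral_similar {X Y : CBanach} (A : X -> X) (D : Y -> Y) z :
  (forall w, spectrum A w <-> spectrum D w) ->
  peripheral_spectrum A z <-> peripheral_spectrum D z.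
Proof.
  intros H; split; intros Hz; apply peripheral_spectrum_intro; try (apply H, Hz).
  - intros w Hw; apply (peripheral_spectrum_max A); [exact Hz | now apply H].
  - intros w Hw; apply (peripheral_spectrum_max D); [exact Hz | now apply H].
Qed.

Lemma spectrum_eigenvalue {X : CBanach} (T : X -> X) z v :
  T v = vscal z v -> v <> vzero -> spectrum T z.
Proof.
  intros E Hv [S (_ & HS & Hl & _)]; apply Hv.
  rewrite <- (Hl v), E, vadd_opp; now apply op_zero.
Qed.

(** For any other [z], the relation [D^2 = c D] makes [(z (c - z))^-1 D - z^-1] the inverse of
    [D - z]. *)
Lemma spectrum_quadratic {X : CBanach} (D : X -> X) c z : is_op D ->
  (forall x, D (D x) = vscal c (D x)) -> spectrum D z -> z = C0 \/ z = c.
Proof.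
  intros HD HE Hsp; apply NNPP; intros Hno; apply Hsp.
  assert (Hz : z <> C0) by tauto.
  assert (Hzc : Csub c z <> C0) by (intros E; apply Csub_eq0 in E; subst; tauto).
  exists (fun x => vadd (vscal (Cinv (Cmul z (Csub c z))) (D x)) (vscal (Copp (Cinv z)) x)).
  split; [now apply is_op_shift|]; split; [|split].
  - apply (is_op_lincomb _ _ D (fun x => x) HD), is_op_id.
  - intros x; rewrite (op_add D HD), (op_opp D HD), (op_scal D HD), HE.
    vector_with ltac:(field; split; assumption).
  - intros x; rewrite (op_add D HD), !(op_scal D HD), HE.
    vector_with ltac:(field; split; assumption).
Qed.

(** An inverse [Q] of [T^2 - z^2 = (T - z) (T + z)] commutes with [T], so [(T + z) Q] inverts
    [T - z]. *)
Lemma spectrum_square {X : CBanach} (T : X -> X) z : is_op T ->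
  spectrum T z -> spectrum (fun x => T (T x)) (Cmul z z).
Proof.
  intros HT Hsp [Q (_ & HQ & Hl & Hr)]; apply Hsp.
  assert (Hcomm : forall x, Q (T x) = T (Q x)).
  { intros x. rewrite <- (Hl (T (Q x))). f_equal.
    pose proof (f_equal T (Hr x)) as E; cbv beta in E.
    rewrite (op_add T HT), (op_opp T HT), (op_scal T HT) in E; now rewrite <- E. }
  exists (fun x => vadd (T (Q x)) (vscal z (Q x))); split; [now apply is_op_shift|]; split; [|split].
  - replace (fun x => vadd (T (Q x)) (vscal z (Q x)))
      with (fun x => vadd (vscal C1 (T (Q x))) (vscal z (Q x)))
      by (apply functional_extensionality; intros x; vector).
    apply (is_op_lincomb C1 z (fun x => T (Q x)) Q); [now apply is_op_comp | exact HQ].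
  - intros x. rewrite (op_add Q HQ), (op_opp Q HQ), (op_scal Q HQ), Hcomm.
    rewrite (op_add T HT), (op_opp T HT), (op_scal T HT). rewrite <- (Hr x) at 5; vector.
  - intros x. rewrite (op_add T HT), (op_scal T HT). rewrite <- (Hr x) at 5; vector.
Qed.

(** * Rank-one operators and the products containing them *)

Definition rank1 {X Y : CBanach} (y : Y) (g : X -> Cplx) : X -> Y := fun v => vscal (g v) y.

Lemma rank1_op {X Y : CBanach} (y : Y) (g : X -> Cplx) : in_dual g -> is_op (rank1 y g).
Proof.
  intros Hg; destruct (dual_bound g Hg) as (c & _ & Hc).
  apply is_op_intro with (c * vnorm y); unfold rank1.
  - intros u v; rewrite (dual_add g Hg); vector.
  - intros a v; rewrite (dual_scal g Hg); vector.
  - intros x; rewrite vnorm_scal; specialize (Hc x); pose proof (vnorm_pos y); nra.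
Qed.

(** The square of the operator is [g u] times the operator, so the spectrum lies in [{0, g u}]. If
    [g u = 0] the operator is nilpotent on a nonzero space, hence not injective, and 0 does belong
    to the spectrum. *)
Lemma peripheral_rank1 {X : CBanach} (u : X) (g : X -> Cplx) z :
  (exists x : X, x <> vzero) -> in_dual g ->
  peripheral_spectrum (rank1 u g) z <-> z = g u.
Proof.
  intros [x Hx] Hg. pose proof (rank1_op u g Hg) as Hop.
  assert (Hsp : forall w, spectrum (rank1 u g) w -> w = C0 \/ w = g u).
  { intros w; apply spectrum_quadratic; [exact Hop|].
    intros v; unfold rank1; rewrite (dual_scal g Hg); vector. }
  assert (Hin : spectrum (rank1 u g) (g u)).
  { destruct (Cplx_dec (g u) C0) as [E|Hgu].
    - rewrite E; intros [S (_ & HS & Hl & _)].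
      assert (Hinj : forall v, rank1 u g v = vzero -> v = vzero).
      { intros v Hv; rewrite <- (Hl v), Hv, vscal_0, vadd_opp; now apply op_zero. }
      apply Hx, Hinj, Hinj; unfold rank1; rewrite (dual_scal g Hg), E.
      replace (Cmul (g x) C0) with C0 by ring; apply vscal_0.
    - apply (spectrum_eigenvalue _ _ u); [reflexivity|].
      intros ->; apply Hgu; now apply dual_zero. }
  assert (Hmax : peripheral_spectrum (rank1 u g) (g u)).
  { apply peripheral_spectrum_intro; [exact Hin|]; intros w Hw.
    destruct (Hsp w Hw) as [->| ->]; [rewrite Cabs_C0; apply Cabs_pos | lra]. }
  split; [|intros ->; exact Hmax].
  intros Hz; destruct (Hsp z (proj1 Hz)) as [->|]; [|assumption].
  pose proof (peripheral_spectrum_max _ _ _ Hz Hin) as H; rewrite Cabs_C0 in H.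
  symmetry; apply Cabs_eq0, Rle_antisym; [exact H | apply Cabs_pos].
Qed.

Lemma opow_rank1 {X : CBanach} (x : X) (f : X -> Cplx) n v : in_dual f ->
  opow (rank1 x f) (S n) v = vscal (Cmul (Cpow (f x) n) (f v)) x.
Proof.
  intros Hf; induction n as [|n IH].
  - simpl; unfold rank1; f_equal; ring.
  - rewrite opow_S, IH; unfold rank1; rewrite (dual_scal f Hf); f_equal; simpl; ring.
Qed.

(** The product is again of rank one, with vector [B^r x] and functional [f] composed with [B^s]. *)
Lemma prod_rank1_middle {X : CBanach} (B : X -> X) (x : X) (f : X -> Cplx) r s z :
  (exists x : X, x <> vzero) -> is_op B -> in_dual f ->
  peripheral_spectrum (prod_op B r (rank1 x f) s) z <-> z = f (opow B (r + s) x).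
Proof.
  intros Hne HB Hf.
  replace (prod_op B r (rank1 x f) s) with (rank1 (opow B r x) (fun v => f (opow B s v))).
  - rewrite peripheral_rank1.
    + rewrite <- opow_add, (Nat.add_comm s r); reflexivity.
    + exact Hne.
    + apply (dual_comp f); [exact Hf | now apply is_op_pow].
  - apply functional_extensionality; intros v; unfold prod_op, rank1.
    now rewrite (op_scal _ (is_op_pow B r HB)).
Qed.

(** Powers of the outer factor are scalar multiples of it, so the product has rank at most one. For
    [r = 0] its range is spanned by [A x] instead of [x], hence the case distinction; the exponent
    is [m - 2]. *)
Lemma prod_rank1_outer {X : CBanach} (A : X -> X) (x : X) (f : X -> Cplx) r s z :
  (exists x : X, x <> vzero) -> is_op A -> in_dual f -> (1 <= r + s)%nat ->
  peripheral_spectrum (prod_op (rank1 x f) r A s) z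
  <-> z = Cmul (Cpow (f x) (r + s - 1)) (f (A x)).
Proof.
  intros Hne HA Hf Hrs. pose proof (rank1_op x f Hf) as HB.
  destruct r as [|r].
  - destruct s as [|s]; [lia|].
    replace (prod_op (rank1 x f) 0 A (S s)) with (rank1 (A x) (fun v => Cmul (Cpow (f x) s) (f v))).
    + rewrite peripheral_rank1; [|exact Hne | now apply dual_fscal].
      replace (0 + S s - 1)%nat with s by lia; reflexivity.
    + apply functional_extensionality; intros v; unfold prod_op; rewrite opow_rank1 by exact Hf.
      rewrite (op_scal A HA); reflexivity.
  - replace (prod_op (rank1 x f) (S r) A s)
      with (rank1 x (fun v => Cmul (Cpow (f x) r) (f (A (opow (rank1 x f) s v))))).
    + rewrite peripheral_rank1; [|exact Hne |].
      * replace (S r + s - 1)%nat with (r + s)%nat by lia.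
        replace (f (A (opow (rank1 x f) s x))) with (Cmul (Cpow (f x) s) (f (A x))).
        { rewrite Cpow_add. replace (Cmul (Cmul (Cpow (f x) r) (Cpow (f x) s)) (f (A x)))
            with (Cmul (Cpow (f x) r) (Cmul (Cpow (f x) s) (f (A x)))) by ring; reflexivity. }
        destruct s as [|s]; [simpl; ring|].
        rewrite opow_rank1, (op_scal A HA), (dual_scal f Hf) by exact Hf; simpl; ring.
      * apply (dual_fscal (Cpow (f x) r) (fun v => f (A (opow (rank1 x f) s v)))).
        apply (dual_comp f (fun v => A (opow (rank1 x f) s v))); [exact Hf|].
        apply (is_op_comp A); [exact HA | now apply is_op_pow].
    + apply functional_extensionality; intros v; unfold prod_op; now rewrite opow_rank1.
Qed.

(** * Operators of rank at least two *)

Definition rank_le1 {X Y : CBanach} (T : X -> Y) : Prop :=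
  exists y g, in_dual g /\ T = rank1 y g.

Lemma rank_le1_op {X Y : CBanach} (T : X -> Y) : rank_le1 T -> is_op T.
Proof. intros (y & g & Hg & ->); now apply rank1_op. Qed.

Lemma rank1_zero {X Y : CBanach} (g : X -> Cplx) : rank1 (vzero : Y) g = fun _ => vzero.
Proof. apply functional_extensionality; intros v; apply vscal_vzero. Qed.

Lemma rank_le1_zero {X Y : CBanach} (T : X -> Y) : (forall x, T x = vzero) -> rank_le1 T.
Proof.
  intros H; exists vzero, (fun _ => C0); split; [apply dual_const0|].
  rewrite rank1_zero; now apply functional_extensionality.
Qed.

Lemma rank1_of_range {X Y : CBanach} (T : X -> Y) (y : Y) : is_op T -> y <> vzero ->
  (forall x, exists a, T x = vscal a y) -> exists g, in_dual g /\ T = rank1 y g.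
Proof.
  intros HT Hy H; destruct (dual_one y Hy) as (h & Hh & E).
  exists (fun x => h (T x)); split; [now apply (dual_comp h)|].
  apply functional_extensionality; intros x; destruct (H x) as [a Ha]; unfold rank1.
  rewrite Ha, (dual_scal h Hh), E; f_equal; ring.
Qed.

Lemma rank_le1_or_independent {X Y : CBanach} (T : X -> Y) : is_op T ->
  rank_le1 T \/ exists u1 u2, T u1 <> vzero /\ forall a, T u2 <> vscal a (T u1).
Proof.
  intros HT; destruct (classic (exists u1, T u1 <> vzero)) as [[u1 H1]|H0].
  - destruct (classic (exists u2, forall a, T u2 <> vscal a (T u1))) as [[u2 H2]|H2]; [right; eauto|].
    left; destruct (rank1_of_range T (T u1) HT H1) as (g & Hg & E).
    + intros x; apply NNPP; intros H; apply H2; exists x; intros a Ha; apply H; eauto.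
    + exists (T u1), g; auto.
  - left; apply rank_le1_zero; intros x; apply NNPP; eauto.
Qed.

Lemma rank_le2_finite {X Y : CBanach} (F : X -> Y) : rank_le2 F -> finite_rank F.
Proof.
  intros (y1 & y2 & H); exists (y1 :: y2 :: nil); intros x; destruct (H x) as (a & b & E).
  exists (a :: b :: nil); split; [reflexivity|]; rewrite E; simpl; vector.
Qed.

Lemma rank_le1_rank_le2 {X Y : CBanach} (F : X -> Y) : rank_le1 F -> rank_le2 F.
Proof.
  intros (y & g & _ & ->); exists y, vzero; intros x; exists (g x), C0; unfold rank1; vector.
Qed.

Definition biorthogonal {X : CBanach} (x1 x2 : X) (f1 f2 : X -> Cplx) : Prop :=
  in_dual f1 /\ in_dual f2 /\ f1 x1 = C1 /\ f1 x2 = C0 /\ f2 x1 = C0 /\ f2 x2 = C1.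

(** Gaussian elimination on the matrix with entries [fi (A xj)]: [x2] is [u2] moved into the kernel
    of [f1], and [w] is [A u2] with its [f1]-part along [A u1] removed. Row and column operations
    keep the determinant, which is [f1 (A u1)] times the value at [w] of the functional chosen
    nonzero there. *)
Lemma biorthogonal_compression {X : CBanach} (A : X -> X) (u1 u2 : X) : is_op A ->
  A u1 <> vzero -> (forall a, A u2 <> vscal a (A u1)) ->
  exists x1 x2 f1 f2, biorthogonal x1 x2 f1 f2 /\ f1 (A x1) <> C0 /\
    Csub (Cmul (f1 (A x1)) (f2 (A x2))) (Cmul (f1 (A x2)) (f2 (A x1))) <> C0.
Proof.
  intros HA H1 H2.
  assert (Hu1 : u1 <> vzero) by (intros ->; apply H1; now apply op_zero).
  destruct (dual_normalized u1 (A u1) Hu1 H1) as (f1 & Hf1 & E1 & Hm).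
  set (x2 := vadd u2 (vscal (Copp (f1 u2)) u1)).
  set (w := vadd (A u2) (vscal (Copp (Cdiv (f1 (A u2)) (f1 (A u1)))) (A u1))).
  assert (Hx2 : x2 <> vzero).
  { intros E; apply (H2 (f1 u2)). rewrite <- (op_scal A HA); f_equal.
    transitivity (vadd x2 (vscal (f1 u2) u1)); [unfold x2; vector | rewrite E; vector]. }
  assert (Hw : w <> vzero).
  { intros E; apply (H2 (Cdiv (f1 (A u2)) (f1 (A u1)))).
    transitivity (vadd w (vscal (Cdiv (f1 (A u2)) (f1 (A u1))) (A u1)));
      [unfold w; vector | rewrite E; vector]. }
  destruct (dual_normalized x2 w Hx2 Hw) as (f2 & Hf2 & E2 & Hfw).
  exists u1, x2, f1, (fun x => Cadd (Cmul C1 (f2 x)) (Cmul (Copp (f2 u1)) (f1 x))).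
  assert (E12 : f1 x2 = C0).
  { unfold x2; rewrite (dual_add f1 Hf1), (dual_scal f1 Hf1), E1; ring. }
  split; [|split; [exact Hm|]].
  - split; [exact Hf1|split; [now apply dual_lincomb|split; [exact E1|split; [exact E12|split]]]].
    + rewrite E1; ring.
    + rewrite E12, E2; ring.
  - intros E; apply (Cmul_neq0 _ _ Hm Hfw); rewrite <- E.
    unfold x2, w. rewrite (op_add A HA), (op_scal A HA).
    rewrite !(dual_add f1 Hf1), !(dual_add f2 Hf2), !(dual_scal f1 Hf1), !(dual_scal f2 Hf2).
    field; exact Hm.
Qed.

(* If the second diagonal entry of the compression vanishes, conjugating by a transvection makes both nonzero. *)
Lemma biorthogonal_compression_diag {X : CBanach} (A : X -> X) (u1 u2 : X) : is_op A ->
  A u1 <> vzero -> (forall a, A u2 <> vscal a (A u1)) ->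
  exists x1 x2 f1 f2, biorthogonal x1 x2 f1 f2 /\ f1 (A x1) <> C0 /\ f2 (A x2) <> C0 /\
    Csub (Cmul (f1 (A x1)) (f2 (A x2))) (Cmul (f1 (A x2)) (f2 (A x1))) <> C0.
Proof.
  intros HA H1 H2.
  destruct (biorthogonal_compression A u1 u2 HA H1 H2)
    as (x1 & x2 & f1 & f2 & (Hf1 & Hf2 & E11 & E12 & E21 & E22) & Hm & Hdet).
  destruct (Cplx_dec (f2 (A x2)) C0) as [E0|Hn];
    [|exists x1, x2, f1, f2; unfold biorthogonal; auto 10].
  rewrite E0 in Hdet.
  assert (H12 : f1 (A x2) <> C0) by (intros E; apply Hdet; rewrite E; ring).
  (* With [m = f1 (A x1)], this [t] turns the diagonal [(m, 0)] into [(2 m, -m)]. *)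
  set (t := Cdiv (f1 (A x1)) (f1 (A x2))).
  assert (E1' : f1 (A (vadd x1 (vscal t x2))) = Cadd (f1 (A x1)) (f1 (A x1))).
  { rewrite (op_add A HA), (op_scal A HA), (dual_add f1 Hf1), (dual_scal f1 Hf1).
    unfold t; field; exact H12. }
  assert (E2' : f2 (A (vadd x1 (vscal t x2))) = f2 (A x1)).
  { rewrite (op_add A HA), (op_scal A HA), (dual_add f2 Hf2), (dual_scal f2 Hf2), E0; ring. }
  exists (vadd x1 (vscal t x2)), x2, f1, (fun x => Cadd (Cmul C1 (f2 x)) (Cmul (Copp t) (f1 x))).
  rewrite E1', E2', E0; split; [|split; [|split]].
  - split; [exact Hf1|split; [now apply dual_lincomb|split; [|split; [exact E12|split]]]].
    + rewrite (dual_add f1 Hf1), (dual_scal f1 Hf1), E11, E12; ring.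
    + rewrite (dual_add f1 Hf1), (dual_scal f1 Hf1), (dual_add f2 Hf2), (dual_scal f2 Hf2),
        E11, E12, E21, E22; ring.
    + rewrite E22, E12; ring.
  - intros E; apply Hm. replace (f1 (A x1)) with (Cmul (RtoC (/ 2)) (Cadd (f1 (A x1)) (f1 (A x1)))).
    + rewrite E; ring.
    + apply Cplx_ext; simpl; field.
  - intros E; apply Hm. replace (f1 (A x1)) with
      (Copp (Cadd (Cmul C1 C0) (Cmul (Copp t) (f1 (A x2))))) by (unfold t; field; exact H12).
    rewrite E; ring.
  - intros E; apply Hdet; etransitivity; [|exact E]; unfold t; field; exact H12.
Qed.

(** [B] acts as [p] on [x1] and as 1 on [x2]. The scaling [p] makes the compression of
    [N = B^(r+s) A] to their span traceless, so by Cayley-Hamilton [N^2] is there the nonzero scalar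
    [de], minus its determinant, and the peripheral values are the two square roots of [de]. *)
Lemma two_peripheral_values {X : CBanach} (A : X -> X) (u1 u2 : X) r s : is_op A ->
  (1 <= r + s)%nat -> A u1 <> vzero -> (forall a, A u2 <> vscal a (A u1)) ->
  exists B z w, is_op B /\ rank_le2 B /\ z <> w /\
    peripheral_spectrum (prod_op B r A s) z /\ peripheral_spectrum (prod_op B r A s) w.
Proof.
  intros HA Hrs H1 H2.
  destruct (biorthogonal_compression_diag A u1 u2 HA H1 H2)
    as (x1 & x2 & f1 & f2 & (Hf1 & Hf2 & E11 & E12 & E21 & E22) & Hm1 & Hm2 & Hdet).
  set (m11 := f1 (A x1)) in *; set (m12 := f1 (A x2)) in *.
  set (m21 := f2 (A x1)) in *; set (m22 := f2 (A x2)) in *.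
  (* Chosen so that the trace [p^(r+s) m11 + m22] vanishes. *)
  destruct (Croot_exists (Copp (Cdiv m22 m11)) (r + s) Hrs) as [p Hp].
  set (al := Cpow p (r + s)) in *.
  assert (Htr : Cmul al m11 = Copp m22) by (rewrite Hp; field; exact Hm1).
  assert (Hal : al <> C0).
  { intros E; apply Hm2. replace m22 with (Copp (Copp m22)) by ring.
    rewrite <- Htr, E; ring. }
  set (B := fun v => vadd (vscal p (rank1 x1 f1 v)) (vscal C1 (rank1 x2 f2 v))).
  assert (HB : is_op B) by (apply is_op_lincomb; now apply rank1_op).
  assert (HBn : forall n v, opow B (S n) v = vadd (vscal (Cmul (Cpow p (S n)) (f1 v)) x1) (vscal (f2 v) x2)).
  { intros n v; induction n as [|n IH].
    - simpl; unfold B, rank1; vector.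
    - rewrite opow_S, IH; unfold B, rank1.
      rewrite !(dual_add f1 Hf1), !(dual_add f2 Hf2), !(dual_scal f1 Hf1), !(dual_scal f2 Hf2),
        E11, E12, E21, E22; simpl Cpow; vector. }
  set (N := fun v => opow B (r + s) (A v)).
  assert (HN : is_op N) by (apply (is_op_comp (opow B (r + s)) A); [now apply is_op_pow | exact HA]).
  assert (HNv : forall v, N v = vadd (vscal (Cmul al (f1 (A v))) x1) (vscal (f2 (A v)) x2)).
  { intros v; unfold N, al; destruct (r + s)%nat as [|n]; [lia|]; apply HBn. }
  assert (HN12 : forall a b, N (vadd (vscal a x1) (vscal b x2))
     = vadd (vscal (Cmul al (Cadd (Cmul a m11) (Cmul b m12))) x1)
            (vscal (Cadd (Cmul a m21) (Cmul b m22)) x2)).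
  { intros a b; rewrite HNv, (op_add A HA), !(op_scal A HA).
    rewrite (dual_add f1 Hf1), (dual_add f2 Hf2), !(dual_scal f1 Hf1), !(dual_scal f2 Hf2); reflexivity. }
  set (de := Copp (Cmul al (Csub (Cmul m11 m22) (Cmul m12 m21)))).
  assert (Hde : de <> C0).
  { intros E; apply (Cmul_neq0 _ _ Hal Hdet). replace (Cmul al _) with (Copp de) by (unfold de; ring).
    rewrite E; ring. }
  assert (HNN : forall a b, N (N (vadd (vscal a x1) (vscal b x2)))
                = vscal de (vadd (vscal a x1) (vscal b x2))).
  { intros a b; rewrite !HN12.
    assert (Em : m22 = Copp (Cmul al m11)) by (rewrite Htr; ring).
    unfold de; rewrite Em. vector. }
  destruct (Croot_exists de 2 ltac:(lia)) as [c Hc].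
  assert (Hcc : Cmul c c = de) by (rewrite <- Hc; simpl; ring).
  assert (Hc0 : c <> C0) by (intros E; apply Hde; rewrite <- Hcc, E; ring).
  assert (H2c : Cadd c c <> C0).
  { intros E; apply Hc0; replace c with (Cmul (RtoC (/ 2)) (Cadd c c)).
    - rewrite E; ring.
    - apply Cplx_ext; simpl; field. }
  (* The product is [T S], whereas [S T = N] is the operator computed above; [T] carries
     eigenvectors of [N] to eigenvectors of the product. *)
  set (T := fun v => opow B r (A v)). set (S := opow B s).
  assert (HT : is_op T) by (apply (is_op_comp (opow B r) A); [now apply is_op_pow | exact HA]).
  assert (HS : is_op S) by now apply is_op_pow.
  assert (HST : forall v, S (T v) = N v).
  { intros v; unfold S, T, N; rewrite <- opow_add; f_equal; lia. }
  assert (Heig : forall e, Cmul e e = de -> Cadd e e <> C0 -> spectrum (prod_op B r A s) e).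
  { intros e He H2e.
    assert (He0 : e <> C0) by (intros E; apply H2e; rewrite E; ring).
    (* Since [N^2 = e^2] on the span, [N + e] maps it into the [e]-eigenspace. It does not vanish
       there, because [N = -e] would have trace [-2 e], which is nonzero. *)
    assert (Hv : exists a b, vadd (N (vadd (vscal a x1) (vscal b x2)))
                                  (vscal e (vadd (vscal a x1) (vscal b x2))) <> vzero).
    { apply NNPP; intros Hno.
      assert (Hz : forall a b, vadd (N (vadd (vscal a x1) (vscal b x2)))
                                  (vscal e (vadd (vscal a x1) (vscal b x2))) = vzero)
        by (intros a b; apply NNPP; eauto).
      pose proof (f_equal f1 (Hz C1 C0)) as G1; pose proof (f_equal f2 (Hz C0 C1)) as G2.
      rewrite HN12 in G1, G2.
      rewrite !(dual_add f1 Hf1), !(dual_scal f1 Hf1), !(dual_add f1 Hf1), !(dual_scal f1 Hf1),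
        E11, E12, (dual_zero f1 Hf1) in G1.
      rewrite !(dual_add f2 Hf2), !(dual_scal f2 Hf2), !(dual_add f2 Hf2), !(dual_scal f2 Hf2),
        E21, E22, (dual_zero f2 Hf2) in G2.
      apply H2e. assert (Em : m22 = Copp (Cmul al m11)) by (rewrite Htr; ring).
      assert (F1 : Cadd (Cmul al m11) e = C0) by (etransitivity; [|exact G1]; ring).
      assert (F2 : Cadd (Copp (Cmul al m11)) e = C0)
        by (etransitivity; [|exact G2]; rewrite Em; ring).
      replace (Cadd e e) with (Cadd (Cadd (Cmul al m11) e) (Cadd (Copp (Cmul al m11)) e)) by ring.
      rewrite F1, F2; ring. }
    destruct Hv as (a & b & Hv).
    set (x := vadd (vscal a x1) (vscal b x2)) in *.
    set (v := vadd (N x) (vscal e x)) in *.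
    assert (Ev : N v = vscal e v).
    { unfold v; rewrite (op_add N HN), (op_scal N HN); unfold x at 1; rewrite HNN; fold x.
      rewrite <- He; vector. }
    apply (spectrum_eigenvalue _ _ (T v)).
    - change (T (S (T v)) = vscal e (T v)). rewrite HST, Ev; now apply op_scal.
    - intros E; apply Hv. pose proof (f_equal S E) as G; rewrite HST, Ev, (op_zero S HS) in G.
      destruct (vscal_eq0 _ _ G); [contradiction | assumption]. }
  assert (Hbound : forall z, spectrum (prod_op B r A s) z -> Cabs z <= Cabs c).
  { intros z Hz. pose proof (is_op_prod B A r s HA HB) as HC.
    (* The square [D] of the product satisfies [D^2 = de D], so every spectral value squares to 0 or
       [de]. *)
    apply (spectrum_square _ _ HC), (spectrum_quadratic _ de) in Hz.
    - apply Rsqr_incr_0_var; [|apply Cabs_pos]; unfold Rsqr; rewrite <- !Cabs_mul, Hcc.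
      destruct Hz as [-> | ->]; [rewrite Cabs_C0; apply Cabs_pos | lra].
    - now apply is_op_comp.
    - intros x.
      change (T (S (T (S (T (S (T (S x))))))) = vscal de (T (S (T (S x))))).
      rewrite !HST, <- (op_scal T HT); f_equal. rewrite (HNv (S x)); apply HNN. }
  exists B, c, (Copp c); split; [exact HB|]; split; [|split; [|split]].
  - exists x1, x2; intros x; exists (Cmul p (f1 x)), (f2 x); unfold B, rank1; vector.
  - intros E; apply H2c; rewrite E at 1; ring.
  - apply peripheral_spectrum_intro; [now apply Heig | exact Hbound].
  - apply peripheral_spectrum_intro; [|intros z Hz; rewrite Cabs_opp; auto].
    apply Heig; [rewrite <- Hcc; ring|].
    intros E; apply H2c; replace (Cadd c c) with (Copp (Cadd (Copp c) (Copp c))) by ring.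
    rewrite E; ring.
Qed.

(** Only operators [B] of rank at most two are tested, which is what allows the criterion to be
    carried through [Phi] in either direction. *)
Lemma rank_le1_of_peripheral {X : CBanach} (A : X -> X) r s : is_op A -> (1 <= r + s)%nat ->
  (forall B, is_op B -> rank_le2 B -> forall z w,
     peripheral_spectrum (prod_op B r A s) z -> peripheral_spectrum (prod_op B r A s) w -> z = w) ->
  rank_le1 A.
Proof.
  intros HA Hrs H; destruct (rank_le1_or_independent A HA) as [|(u1 & u2 & H1 & H2)]; [assumption|].
  destruct (two_peripheral_values A u1 u2 r s HA Hrs H1 H2) as (B & z & w & HB & HB2 & Hne & Hz & Hw).
  exfalso; apply Hne; eapply H; eauto.
Qed.

(** * Bilinear families of rank-one operators *)

Definition dep {X : CBanach} (x y : X) : Prop := x = vzero \/ exists a, y = vscal a x.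

Lemma Cinv_cancel {X : CBanach} a (x : X) : a <> C0 -> vscal (Cinv a) (vscal a x) = x.
Proof. intros Ha; vector_with ltac:(field; exact Ha). Qed.

Lemma dep_sym {X : CBanach} (x y : X) : dep x y -> dep y x.
Proof.
  intros [->|[a ->]].
  - right; exists C0; now rewrite vscal_0.
  - destruct (Cplx_dec a C0) as [->|Ha]; [left; apply vscal_0 | right].
    exists (Cinv a); now rewrite Cinv_cancel.
Qed.

(** Stated for algebraically linear functionals: it is applied to [u => S w (T u)] before [T] is
    known to be bounded. *)
Lemma linear_proportional {X : CBanach} (f g : X -> Cplx) :
  (forall u v, f (vadd u v) = Cadd (f u) (f v)) -> (forall a v, f (vscal a v) = Cmul a (f v)) ->
  (forall u v, g (vadd u v) = Cadd (g u) (g v)) -> (forall a v, g (vscal a v) = Cmul a (g v)) ->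
  (forall v, f v = C0 -> g v = C0) -> exists a, forall v, g v = Cmul a (f v).
Proof.
  intros fadd fscal gadd gscal H; destruct (classic (exists v, f v <> C0)) as [[v Hv]|H0].
  - exists (Cdiv (g v) (f v)); intros x.
    assert (E : g (vadd x (vscal (Copp (Cdiv (f x) (f v))) v)) = C0).
    { apply H; rewrite fadd, fscal; field; exact Hv. }
    rewrite gadd, gscal in E.
    replace (g x) with (Cadd (Cadd (g x) (Cmul (Copp (Cdiv (f x) (f v))) (g v)))
      (Cmul (Cdiv (f x) (f v)) (g v))) by ring.
    rewrite E; field; exact Hv.
  - exists C0; intros v. replace (Cmul C0 (f v)) with C0 by ring.
    apply H, NNPP; eauto.
Qed.

Lemma functional_at_one {X : CBanach} (g : X -> Cplx) v : in_dual g -> g v <> C0 ->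
  exists v', g v' = C1.
Proof.
  intros Hg Hv; exists (vscal (Cinv (g v)) v); rewrite (dual_scal g Hg); field; exact Hv.
Qed.

Lemma rank1_nonzero {X Y : CBanach} (y : Y) (g : X -> Cplx) v : in_dual g -> rank1 y g v <> vzero ->
  y <> vzero /\ g v <> C0 /\ exists v', g v' = C1.
Proof.
  unfold rank1; intros Hg Hv.
  assert (Hgv : g v <> C0) by (intros E; apply Hv; rewrite E; apply vscal_0).
  split; [|split; [exact Hgv | now apply (functional_at_one g v)]].
  intros ->; apply Hv, vscal_vzero.
Qed.

(** On a vector of the kernel of [g0] outside that of [g], the sum is a nonzero multiple of [y]; at
    [v0] it is [y0] plus a multiple of [y]. If both lie on one line, [y] is a multiple of [y0].
    Without such a vector the kernels are nested and [g] is a multiple of [g0]. *)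
Lemma rank1_sum {X Y : CBanach} (y y0 : Y) (g g0 : X -> Cplx) v0 : in_dual g -> in_dual g0 ->
  y0 <> vzero -> g0 v0 = C1 -> rank_le1 (fun v => vadd (rank1 y g v) (rank1 y0 g0 v)) ->
  (exists a, y = vscal a y0) \/ (exists a, forall v, g v = Cmul a (g0 v)).
Proof.
  intros Hg Hg0 Hy0 Ev0 (y' & g' & Hg' & E).
  assert (Hv : forall v, vadd (vscal (g v) y) (vscal (g0 v) y0) = vscal (g' v) y')
    by (intros v; exact (f_equal (fun F => F v) E)).
  destruct (classic (exists v, g0 v = C0 /\ g v <> C0)) as [(v2 & E2 & H2)|Hno].
  - left. pose proof (Hv v2) as G; rewrite E2, vscal_0, vadd_0r in G.
    assert (Ey : y = vscal (Cdiv (g' v2) (g v2)) y').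
    { rewrite <- (Cinv_cancel (g v2) y H2), G; vector_with ltac:(field; exact H2). }
    set (b := Cdiv (g' v2) (g v2)) in *.
    pose proof (Hv v0) as G0; rewrite Ev0 in G0.
    destruct (Cplx_dec b C0) as [Eb|Hb].
    { exists C0; now rewrite Ey, Eb, !vscal_0. }
    set (e := Csub (Cmul (g' v0) (Cinv b)) (g v0)).
    assert (Ey0 : y0 = vscal e y).
    { transitivity (vadd (vscal (g' v0) y') (vscal (Copp (g v0)) y)); [rewrite <- G0; vector|].
      rewrite Ey; unfold e; vector_with ltac:(field; exact Hb). }
    assert (He : e <> C0) by (intros Ee; apply Hy0; rewrite Ey0, Ee; apply vscal_0).
    exists (Cinv e). now rewrite Ey0, Cinv_cancel.
  - right; apply linear_proportional; try (now apply dual_add); try (now apply dual_scal).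
    intros v Ev; apply NNPP; eauto.
Qed.

Lemma rank1_same_vector {X Y : CBanach} (y y' : Y) (g g' : X -> Cplx) v :
  in_dual g -> rank1 y g = rank1 y' g' -> rank1 y g v <> vzero -> exists a, y = vscal a y'.
Proof.
  intros Hg E Hv; destruct (rank1_nonzero y g v Hg Hv) as (_ & Hgv & _).
  apply (f_equal (fun F => F v)) in E; unfold rank1 in E.
  exists (Cmul (Cinv (g v)) (g' v)). rewrite <- (Cinv_cancel (g v) y Hgv), E; vector.
Qed.

Lemma rank1_same_functional {X Y : CBanach} (y y' : Y) (g g' : X -> Cplx) v :
  in_dual g -> rank1 y g = rank1 y' g' -> rank1 y g v <> vzero ->
  exists a, forall u, g u = Cmul a (g' u).
Proof.
  intros Hg E Hv; destruct (rank1_nonzero y g v Hg Hv) as (Hy & _ & _).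
  destruct (dual_one y Hy) as (h & Hh & Ehy); exists (h y'); intros u.
  apply (f_equal (fun F => h (F u))) in E; unfold rank1 in E.
  rewrite !(dual_scal h Hh), Ehy in E.
  replace (g u) with (Cmul (g u) C1) by ring; rewrite E; ring.
Qed.

(** This and the next definition describe the two kinds of linear spaces of operators of rank at
    most one. *)
Definition common_functional {U Y : CBanach} (gam : U -> Y -> Y) : Prop :=
  exists g, in_dual g /\ forall u, exists y, gam u = rank1 y g.

Definition common_vector {U Y : CBanach} (gam : U -> Y -> Y) : Prop :=
  exists y, forall u, exists g, in_dual g /\ gam u = rank1 y g.

(** Compared with one nonzero member, every member shares its functional or its vector by
    [rank1_sum]. A space is not the union of two proper subspaces: if [u1] breaks the first
    alternative and [u2] the second, [u1 + u2] has nowhere to go. *)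
Lemma rank1_family {U Y : CBanach} (gam : U -> Y -> Y) :
  (forall u u' v, gam (vadd u u') v = vadd (gam u v) (gam u' v)) ->
  (forall u, rank_le1 (gam u)) -> common_functional gam \/ common_vector gam.
Proof.
  intros Hadd Hr.
  destruct (classic (exists u v, gam u v <> vzero)) as [(u0 & v & Hv)|H0].
  2: { left; exists (fun _ => C0); split; [apply dual_const0|]; intros u; exists vzero.
       rewrite rank1_zero; apply functional_extensionality; intros v; apply NNPP; eauto. }
  destruct (Hr u0) as (y0 & g0 & Hg0 & E0). rewrite E0 in Hv.
  destruct (rank1_nonzero y0 g0 v Hg0 Hv) as (Hy0 & _ & v0 & Ev0).
  assert (Hcase : forall u, (exists y, gam u = rank1 y g0) \/
                            (exists g, in_dual g /\ gam u = rank1 y0 g)).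
  { intros u; destruct (Hr u) as (y & g & Hg & E).
    destruct (rank1_sum y y0 g g0 v0 Hg Hg0 Hy0 Ev0) as [[a Ha]|[a Ha]].
    - replace (fun v => vadd (rank1 y g v) (rank1 y0 g0 v)) with (gam (vadd u u0)); [apply Hr|].
      apply functional_extensionality; intros w; now rewrite Hadd, E, E0.
    - right; exists (fun v => Cmul a (g v)); split; [now apply dual_fscal|].
      rewrite E, Ha; apply functional_extensionality; intros w; unfold rank1; vector.
    - left; exists (vscal a y); rewrite E; apply functional_extensionality; intros w.
      unfold rank1; rewrite Ha; vector. }
  destruct (classic (forall u, exists y, gam u = rank1 y g0)) as [HR|HnR];
    [left; exists g0; auto|].
  destruct (classic (forall u, exists g, in_dual g /\ gam u = rank1 y0 g)) as [HC|HnC];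
    [right; exists y0; auto|].
  exfalso. apply not_all_ex_not in HnR, HnC. destruct HnR as [u1 H1], HnC as [u2 H2].
  destruct (Hcase u1) as [|(g1 & Hg1 & E1)]; [contradiction|].
  destruct (Hcase u2) as [(y2 & E2)|]; [|contradiction].
  destruct (Hcase (vadd u1 u2)) as [(y & E)|(g & Hg & E)].
  - apply H1; exists (vadd y (vopp y2)); apply functional_extensionality; intros w.
    transitivity (vadd (gam (vadd u1 u2) w) (vopp (gam u2 w))); [rewrite Hadd; vector|].
    rewrite E, E2; unfold rank1; vector.
  - apply H2; exists (fun v => Cadd (Cmul C1 (g v)) (Cmul (Copp C1) (g1 v))).
    split; [now apply dual_lincomb|]; apply functional_extensionality; intros w.
    transitivity (vadd (gam (vadd u1 u2) w) (vopp (gam u1 w))); [rewrite Hadd; vector|].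
    rewrite E, E1; unfold rank1; vector.
Qed.

Definition bilinear_ops {U W Y : CBanach} (beta : U -> W -> Y -> Y) : Prop :=
  (forall u u' w v, beta (vadd u u') w v = vadd (beta u w v) (beta u' w v)) /\
  (forall a u w v, beta (vscal a u) w v = vscal a (beta u w v)) /\
  (forall u w w' v, beta u (vadd w w') v = vadd (beta u w v) (beta u w' v)) /\
  (forall a u w v, beta u (vscal a w) v = vscal a (beta u w v)).

(** Each [S w] is continuous, but [T] and [w => S w] are only algebraically linear at this stage. *)
Definition tensor_form {U W Y : CBanach} (beta : U -> W -> Y -> Y) : Prop :=
  exists (T : U -> Y) (S : W -> Y -> Cplx),
    (forall u u', T (vadd u u') = vadd (T u) (T u')) /\
    (forall a u, T (vscal a u) = vscal a (T u)) /\
    (forall w, in_dual (S w)) /\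
    (forall w w' v, S (vadd w w') v = Cadd (S w v) (S w' v)) /\
    (forall a w v, S (vscal a w) v = Cmul a (S w v)) /\
    (forall u w, beta u w = rank1 (T u) (S w)).

(** Comparing the ratios at [u], [u0] and [u + u0]: either they agree and equal 1, or [u] is a
    multiple of [u0]. *)
Lemma locally_proportional {U Y : CBanach} (T T' : U -> Y) (u0 : U) :
  (forall u u', T (vadd u u') = vadd (T u) (T u')) ->
  (forall a u, T (vscal a u) = vscal a (T u)) ->
  (forall u u', T' (vadd u u') = vadd (T' u) (T' u')) ->
  (forall a u, T' (vscal a u) = vscal a (T' u)) ->
  (forall u, T u = vzero -> u = vzero) -> (forall u, exists a, T' u = vscal a (T u)) ->
  u0 <> vzero -> T' u0 = T u0 -> forall u, T' u = T u.
Proof.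
  intros Ta Ts Ta' Ts' Tinj Hp Hu0 E0 u.
  destruct (Hp u) as [a Ea]. destruct (Hp (vadd u u0)) as [b Eb].
  rewrite Ta, Ta', E0, Ea in Eb.
  destruct (Cplx_dec a b) as [<-|Hab].
  - assert (E : vscal (Csub a C1) (T u0) = vzero).
    { apply (vadd_cancel_l (vadd (vscal a (T u)) (T u0))).
      transitivity (vscal a (vadd (T u) (T u0))); [vector | rewrite <- Eb; vector]. }
    apply vscal_eq0 in E; destruct E as [E|E]; [|now apply Tinj in E].
    apply Csub_eq0 in E; subst a; rewrite Ea; apply vscal_1.
  - assert (Hne : Csub a b <> C0) by (intros E; now apply Hab, Csub_eq0).
    assert (E : u = vscal (Cdiv (Csub b C1) (Csub a b)) u0).
    { apply vsub_eq0, Tinj; unfold vsub; rewrite vopp_scal, Ta, !Ts.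
      assert (E : vscal (Csub a b) (T u) = vscal (Csub b C1) (T u0)).
      { transitivity (vadd (vadd (vscal a (T u)) (T u0)) (vadd (vscal (Copp b) (T u)) (vopp (T u0)))); [vector|].
        rewrite Eb; vector. }
      rewrite <- (Cinv_cancel (Csub a b) (T u) Hne), E. vector_with ltac:(field; exact Hne). }
    rewrite E, Ts, Ts', E0; reflexivity.
Qed.

(** [T] is read off at [w0] and [S] at [u0], normalized by [h (T u0) = 1]. For another [w], the
    common functional gives a factor [Tw], the common vectors make [Tw u] a multiple of [T u] for
    each [u], and agreement at [u0] makes the two maps equal. *)
Lemma tensor_form_intro {U W Y : CBanach} (beta : U -> W -> Y -> Y) (u0 : U) (w0 : W) :
  bilinear_ops beta -> (forall u w, (forall v, beta u w v = vzero) -> u = vzero \/ w = vzero) ->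
  u0 <> vzero -> w0 <> vzero ->
  (forall w, w <> vzero -> common_functional (fun u => beta u w)) ->
  (forall u, u <> vzero -> common_vector (beta u)) -> tensor_form beta.
Proof.
  intros (Ha1 & Hs1 & Ha2 & Hs2) Hinj Hu0 Hw0 HF HV.
  assert (Hnz : forall u w, u <> vzero -> w <> vzero -> exists v, beta u w v <> vzero).
  { intros u w Hu Hw; apply NNPP; intros Hno.
    destruct (Hinj u w); [intros v; apply NNPP; eauto | contradiction | contradiction]. }
  destruct (HF w0 Hw0) as (g0 & Hg0 & Hy).
  destruct (Hnz u0 w0 Hu0 Hw0) as [v1 Hv1]; destruct (Hy u0) as [y1 Ey1].
  rewrite Ey1 in Hv1; destruct (rank1_nonzero y1 g0 v1 Hg0 Hv1) as (_ & _ & v0 & Ev0).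
  set (T := fun u => beta u w0 v0).
  assert (ET : forall u, beta u w0 = rank1 (T u) g0).
  { intros u; destruct (Hy u) as [y E]; unfold T; rewrite E; unfold rank1.
    rewrite Ev0, vscal_1; reflexivity. }
  assert (Tinj : forall u, T u = vzero -> u = vzero).
  { intros u E; destruct (Hinj u w0); [|assumption|contradiction].
    intros v; rewrite ET, E; apply vscal_vzero. }
  assert (HT0 : T u0 <> vzero) by auto.
  destruct (dual_one (T u0) HT0) as (h & Hh & EhT).
  set (S := fun w v => h (beta u0 w v)).
  destruct (HV u0 Hu0) as [yc Hc].
  assert (ES : forall w, in_dual (S w) /\ beta u0 w = rank1 (T u0) (S w)).
  { intros w; destruct (Hc w) as (g & Hg & E), (Hc w0) as (g' & Hg' & E').
    destruct (rank1_same_vector yc (T u0) g' g0 v1 Hg') as [a Ea].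
    - now rewrite <- ET, <- E'.
    - rewrite <- E', Ey1; exact Hv1.
    - assert (ESw : forall v, S w v = Cmul (g v) a).
      { intros v; unfold S; rewrite E; unfold rank1.
        rewrite Ea, !(dual_scal h Hh), EhT; ring. }
      split.
      + apply (dual_comp h (beta u0 w)); [exact Hh|]; rewrite E; now apply rank1_op.
      + apply functional_extensionality; intros v; unfold rank1; rewrite ESw, E.
        unfold rank1; rewrite Ea; vector. }
  exists T, S; split; [|split; [|split; [|split; [|split]]]].
  - intros u u'; apply Ha1.
  - intros a u; apply Hs1.
  - intros w; apply ES.
  - intros w w' v; unfold S; now rewrite Ha2, (dual_add h Hh).
  - intros a w v; unfold S; now rewrite Hs2, (dual_scal h Hh).
  - intros u w; destruct (classic (w = vzero)) as [->|Hw].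
    { apply functional_extensionality; intros v; unfold rank1, S.
      rewrite <- (vscal_0 vzero), !Hs2, !vscal_0, (dual_zero h Hh); now rewrite vscal_0. }
    destruct (HF w Hw) as (g & Hg & Hyw).
    destruct (Hnz u0 w Hu0 Hw) as [v2 Hv2]; destruct (Hyw u0) as [y2 Ey2].
    destruct (ES w) as [HSw ESw].
    destruct (rank1_same_functional y2 (T u0) g (S w) v2 Hg) as [k Ek];
      [now rewrite <- Ey2, <- ESw | now rewrite <- Ey2 |].
    assert (Hv2' := Hv2); rewrite ESw in Hv2'.
    destruct (rank1_nonzero _ _ v2 HSw Hv2') as (_ & _ & vw & Evw).
    set (Tw := fun u => beta u w vw).
    assert (ETw : forall u, beta u w = rank1 (Tw u) (S w)).
    { intros u'; destruct (Hyw u') as [y E]; apply functional_extensionality; intros v; unfold Tw.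
      rewrite E; unfold rank1; rewrite !Ek, Evw; vector. }
    rewrite ETw; f_equal; revert u.
    apply (locally_proportional T Tw u0); try assumption.
    + intros u u'; apply Ha1.
    + intros a u; apply Hs1.
    + intros u u'; apply Ha1.
    + intros a u; apply Hs1.
    + intros u; destruct (classic (u = vzero)) as [->|Hu].
      { exists C0; unfold Tw; rewrite <- (vscal_0 vzero) at 1; now rewrite Hs1, !vscal_0. }
      destruct (HV u Hu) as [y Hyu]; destruct (Hyu w) as (gw & _ & Egw), (Hyu w0) as (gw0 & _ & Egw0).
      assert (E1 : T u = vscal (gw0 v0) y) by (unfold T; now rewrite Egw0).
      assert (E2 : Tw u = vscal (gw vw) y) by (unfold Tw; now rewrite Egw).
      assert (Hn : gw0 v0 <> C0) by (intros E; apply Hu, Tinj; rewrite E1, E; apply vscal_0).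
      exists (Cmul (gw vw) (Cinv (gw0 v0))); rewrite E1, E2; vector_with ltac:(field; exact Hn).
    + unfold Tw; rewrite ESw; unfold rank1; rewrite Evw; apply vscal_1.
Qed.

(** In a one-dimensional [U] there are no independent vectors for the clash argument below, but
    [beta u0] alone determines [beta]: a common functional gives the swapped form, a common vector
    the direct one. *)
Lemma tensor_form_line {U W Y : CBanach} (beta : U -> W -> Y -> Y) (u0 : U) :
  bilinear_ops beta -> (forall u w, rank_le1 (beta u w)) -> u0 <> vzero -> (forall u, dep u0 u) ->
  tensor_form beta \/ tensor_form (fun w u => beta u w).
Proof.
  intros (Ha1 & Hs1 & Ha2 & Hs2) Hr Hu0 Hline.
  destruct (dual_one u0 Hu0) as (p & Hp & Ep).
  assert (Eu : forall u, u = vscal (p u) u0).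
  { intros u; destruct (Hline u) as [|[a ->]]; [contradiction|].
    rewrite (dual_scal p Hp), Ep; f_equal; ring. }
  destruct (rank1_family (beta u0) (fun w w' => Ha2 u0 w w') (Hr u0)) as [(g & Hg & Hy)|(y & Hy)].
  - right. destruct (classic (exists v, g v = C1)) as [(v & Ev)|Hno].
    + exists (fun w => beta u0 w v), (fun u x => Cmul (p u) (g x)).
      split; [|split; [|split; [|split; [|split]]]].
      * intros w w'; apply Ha2.
      * intros a w; apply Hs2.
      * intros u; now apply dual_fscal.
      * intros u u' x; rewrite (dual_add p Hp); ring.
      * intros a u x; rewrite (dual_scal p Hp); ring.
      * intros w u; apply functional_extensionality; intros x.
        rewrite (Eu u) at 1; rewrite Hs1; destruct (Hy w) as [y E]; rewrite E; unfold rank1.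
        rewrite Ev; vector.
    + assert (Hz : forall x, g x = C0).
      { intros x; apply NNPP; intros Hx; apply Hno; now apply (functional_at_one g x). }
      exists (fun _ => vzero), (fun _ _ => C0); split; [|split; [|split; [|split; [|split]]]];
        try (intros; ring).
      * intros; now rewrite vadd_0.
      * intros; now rewrite vscal_vzero.
      * intros; apply dual_const0.
      * intros w u; apply functional_extensionality; intros x.
        rewrite (Eu u); rewrite Hs1; destruct (Hy w) as [y E]; rewrite E; unfold rank1.
        rewrite Hz; vector.
  - left. destruct (classic (y = vzero)) as [->|Hyne].
    + exists (fun _ => vzero), (fun _ _ => C0); split; [|split; [|split; [|split; [|split]]]];
        try (intros; ring).
      * intros; now rewrite vadd_0.
      * intros; now rewrite vscal_vzero.
      * intros; apply dual_const0.
      * intros u w; apply functional_extensionality; intros x.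
        rewrite (Eu u); rewrite Hs1; destruct (Hy w) as (g & _ & E); rewrite E; unfold rank1.
        vector.
    + destruct (dual_one y Hyne) as (h & Hh & Eh).
      exists (fun u => vscal (p u) y), (fun w x => h (beta u0 w x)).
      split; [|split; [|split; [|split; [|split]]]].
      * intros u u'; rewrite (dual_add p Hp); vector.
      * intros a u; rewrite (dual_scal p Hp); vector.
      * intros w; apply (dual_comp h (beta u0 w)); [exact Hh | apply rank_le1_op, Hr].
      * intros w w' v; now rewrite Ha2, (dual_add h Hh).
      * intros a w v; now rewrite Hs2, (dual_scal h Hh).
      * intros u w; apply functional_extensionality; intros x.
        rewrite (Eu u) at 1; rewrite Hs1; destruct (Hy w) as (g & _ & E); rewrite E; unfold rank1.
        rewrite (dual_scal h Hh), Eh; vector.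
Qed.

Lemma bilinear_ops_swap {U W Y : CBanach} (beta : U -> W -> Y -> Y) :
  bilinear_ops beta -> bilinear_ops (fun w u => beta u w).
Proof. intros (H1 & H2 & H3 & H4); repeat split; auto. Qed.

(** Each partial family has a common functional or a common vector. If both families through
    [(u, w)] were of the same kind, [beta u' w + beta u w'] would have rank at most one for all [u']
    and [w'], against [Hpres] for [u'] independent of [u] and [w'] of [w]. So the kinds are
    opposite. *)
Lemma bilinear_rank_one {U W Y : CBanach} (beta : U -> W -> Y -> Y) (u0 : U) (w0 : W) :
  bilinear_ops beta -> (forall u w, rank_le1 (beta u w)) ->
  (forall u w, (forall v, beta u w v = vzero) -> u = vzero \/ w = vzero) ->
  (forall u u' w w', rank_le1 (fun v => vadd (beta u w v) (beta u' w' v)) -> dep u u' \/ dep w w') ->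
  u0 <> vzero -> w0 <> vzero ->
  tensor_form beta \/ tensor_form (fun w u => beta u w).
Proof.
  intros Hb Hr Hinj Hpres Hu0 Hw0.
  destruct (classic (exists u : U, u <> vzero /\ forall u', dep u u')) as [(u & Hu & Hl)|HU].
  { now apply (tensor_form_line beta u). }
  destruct (classic (exists w : W, w <> vzero /\ forall w', dep w w')) as [(w & Hw & Hl)|HW].
  { rewrite or_comm; apply (tensor_form_line (fun w u => beta u w) w); auto.
    now apply bilinear_ops_swap. }
  assert (HU' : forall u : U, u <> vzero -> exists u', ~ dep u u').
  { intros u Hu; apply NNPP; intros H; apply HU; exists u; split; [exact Hu|].
    intros u'; apply NNPP; eauto. }
  assert (HW' : forall w : W, w <> vzero -> exists w', ~ dep w w').
  { intros w Hw; apply NNPP; intros H; apply HW; exists w; split; [exact Hw|].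
    intros w'; apply NNPP; eauto. }
  assert (Hnz : forall u w, u <> vzero -> w <> vzero -> exists v, beta u w v <> vzero).
  { intros u w Hu Hw; apply NNPP; intros Hno.
    destruct (Hinj u w); [intros v; apply NNPP; eauto | contradiction | contradiction]. }
  assert (Hclash : forall u w, u <> vzero -> w <> vzero ->
     (forall u' w', rank_le1 (fun v => vadd (beta u' w v) (beta u w' v))) -> False).
  { intros u w Hu Hw H; destruct (HU' u Hu) as [u' Hu'], (HW' w Hw) as [w' Hw'].
    destruct (Hpres u' u w w' (H u' w')) as [D|D]; [apply dep_sym in D|]; contradiction. }
  assert (HFF : forall u w, u <> vzero -> w <> vzero ->
     common_functional (fun u => beta u w) -> common_functional (beta u) -> False).
  { intros u w Hu Hw (g & Hg & HF) (g' & Hg' & HF'); apply (Hclash u w Hu Hw); intros u' w'.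
    destruct (Hnz u w Hu Hw) as [v Hv].
    destruct (HF u) as [y E], (HF' w) as [y' E'].
    destruct (rank1_same_functional y' y g' g v Hg') as [a Ea]; [congruence | now rewrite <- E'|].
    destruct (HF u') as [y1 E1], (HF' w') as [y2 E2].
    exists (vadd y1 (vscal a y2)), g; split; [exact Hg|].
    apply functional_extensionality; intros x; rewrite E1, E2; unfold rank1; rewrite Ea; vector. }
  assert (HVV : forall u w, u <> vzero -> w <> vzero ->
     common_vector (fun u => beta u w) -> common_vector (beta u) -> False).
  { intros u w Hu Hw (y & HV) (y' & HV'); apply (Hclash u w Hu Hw); intros u' w'.
    destruct (Hnz u w Hu Hw) as [v Hv].
    destruct (HV u) as (g & Hg & E), (HV' w) as (g' & Hg' & E').
    destruct (rank1_same_vector y' y g' g v Hg') as [a Ea]; [congruence | now rewrite <- E'|].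
    destruct (HV u') as (g1 & Hg1 & E1), (HV' w') as (g2 & Hg2 & E2).
    exists y, (fun x => Cadd (Cmul C1 (g1 x)) (Cmul a (g2 x))); split; [now apply dual_lincomb|].
    apply functional_extensionality; intros x; rewrite E1, E2; unfold rank1; rewrite Ea; vector. }
  destruct Hb as (Ha1 & Hs1 & Ha2 & Hs2).
  assert (HU1 : forall w, common_functional (fun u => beta u w) \/ common_vector (fun u => beta u w)).
  { intros w; apply rank1_family; [intros; apply Ha1 | intros; apply Hr]. }
  assert (HW1 : forall u, common_functional (beta u) \/ common_vector (beta u)).
  { intros u; apply rank1_family; [intros; apply Ha2 | intros; apply Hr]. }
  destruct (HU1 w0) as [HF0|HV0].
  (* The kind at [w0] fixes the opposite kind at every nonzero [u], and the kind at [u0] in turn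
     fixes that at every nonzero [w]. *)
  - left; apply (tensor_form_intro beta u0 w0); try assumption; [split; auto| |].
    + assert (HVu : common_vector (beta u0)) by (destruct (HW1 u0); [exfalso; eauto | assumption]).
      intros w Hw; destruct (HU1 w); [assumption | exfalso; eauto].
    + intros u Hu; destruct (HW1 u); [exfalso; eauto | assumption].
  - right; apply (tensor_form_intro (fun w u => beta u w) w0 u0); try assumption.
    + now apply bilinear_ops_swap.
    + intros w u H; destruct (Hinj u w H); auto.
    + intros u Hu; destruct (HW1 u); [assumption | exfalso; eauto].
    + assert (HFu : common_functional (beta u0)) by (destruct (HW1 u0); [assumption | exfalso; eauto]).
      intros w Hw; destruct (HU1 w); [exfalso; eauto | assumption].
Qed.

(** * Pairings, adjoints and similarity *)

Lemma is_op_of_weakly_bounded {X Y : CBanach} (T : X -> Y) :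
  (forall x y, T (vadd x y) = vadd (T x) (T y)) ->
  (forall a x, T (vscal a x) = vscal a (T x)) ->
  (exists c, forall x, vnorm x <= 1 -> vnorm (T x) <= c) -> is_op T.
Proof.
  intros Ha Hs [c Hc]; apply is_op_intro with c; [exact Ha | exact Hs|]; intros x.
  destruct (Rle_lt_or_eq_dec 0 (vnorm x) (vnorm_pos x)) as [Hx|Hx].
  - assert (Hi : 0 < / vnorm x) by now apply Rinv_0_lt_compat.
    specialize (Hc (vscal (RtoC (/ vnorm x)) x)).
    rewrite Hs, !vnorm_rscal in Hc by lra.
    apply Rmult_le_reg_l with (/ vnorm x); [exact Hi|].
    replace (/ vnorm x * (c * vnorm x)) with c by (field; lra).
    apply Hc; rewrite Rinv_l; lra.
  - symmetry in Hx; pose proof (vnorm_eq0 _ _ Hx) as ->.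
    rewrite <- (vscal_0 vzero), Hs, !vscal_0, !vnorm_0; lra.
Qed.

(** The image of the unit ball is weakly bounded, hence bounded. *)
Lemma is_op_of_dual {X Y : CBanach} (T : X -> Y) :
  (forall x y, T (vadd x y) = vadd (T x) (T y)) ->
  (forall a x, T (vscal a x) = vscal a (T x)) ->
  (forall g, in_dual g -> in_dual (fun x => g (T x))) -> is_op T.
Proof.
  intros Ha Hs H; apply is_op_of_weakly_bounded; [exact Ha | exact Hs|].
  destruct (weakly_bounded (fun y => exists x, vnorm x <= 1 /\ y = T x)) as [c Hc].
  - intros g Hg; destruct (dual_bound _ (H g Hg)) as (c & Hc0 & Hc); exists c.
    intros y (x & Hx & ->); specialize (Hc x); pose proof (vnorm_pos x); nra.
  - exists c; eauto.
Qed.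

(** Serves both conclusions: [U] is X1 and [W] its dual in the direct case, the other way round in
    the dual case, with [pair] the evaluation. The number [k] is [m - 2]. *)
Section Pairing.
Context {U W Y : CBanach} (pair : U -> W -> Cplx) (T : U -> Y) (S : W -> Y -> Cplx) (k : nat).
Context (pair_addl : forall u u' w, pair (vadd u u') w = Cadd (pair u w) (pair u' w))
  (pair_scall : forall a u w, pair (vscal a u) w = Cmul a (pair u w))
  (pair_addr : forall u w w', pair u (vadd w w') = Cadd (pair u w) (pair u w'))
  (pair_scalr : forall a u w, pair u (vscal a w) = Cmul a (pair u w))
  (pair_nondegl : forall u, (forall w, pair u w = C0) -> u = vzero)
  (pair_nondegr : forall w, (forall u, pair u w = C0) -> w = vzero)
  (T_add : forall u u', T (vadd u u') = vadd (T u) (T u'))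
  (T_scal : forall a u, T (vscal a u) = vscal a (T u))
  (S_dual : forall w, in_dual (S w))
  (S_add : forall w w' v, S (vadd w w') v = Cadd (S w v) (S w' v))
  (S_scal : forall a w v, S (vscal a w) v = Cmul a (S w v))
  (ST_pow : forall u w, Cpow (S w (T u)) (k + 2) = Cpow (pair u w) (k + 2))
  (TS_onto : forall y g, in_dual g -> exists u w, rank1 y g = rank1 (T u) (S w))
  (U_nontrivial : exists u : U, u <> vzero) (Y_nontrivial : exists y : Y, y <> vzero).

Lemma pair_zeror u : pair u vzero = C0.
Proof. rewrite <- (vscal_0 vzero), pair_scalr; ring. Qed.

Lemma pair_nonzero2r u u' : u <> vzero -> u' <> vzero -> exists w, pair u w <> C0 /\ pair u' w <> C0.
Proof.
  assert (Hex : forall v, v <> vzero -> exists w, pair v w <> C0).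
  { intros v Hv; apply NNPP; intros H; apply Hv, pair_nondegl; intros w; apply NNPP; eauto. }
  intros Hu Hu'; destruct (Hex u Hu) as [w Hw], (Hex u' Hu') as [w' Hw'].
  destruct (Cplx_dec (pair u' w) C0) as [E|H]; [|eauto].
  destruct (Cplx_dec (pair u w') C0) as [E'|H]; [|eauto].
  exists (vadd w w'); rewrite !pair_addr, E, E'; split.
  - now replace (Cadd (pair u w) C0) with (pair u w) by ring.
  - now replace (Cadd C0 (pair u' w')) with (pair u' w') by ring.
Qed.

Lemma pair_nonzero2l w w' : w <> vzero -> w' <> vzero -> exists u, pair u w <> C0 /\ pair u w' <> C0.
Proof.
  assert (Hex : forall v, v <> vzero -> exists u, pair u v <> C0).
  { intros v Hv; apply NNPP; intros H; apply Hv, pair_nondegr; intros u; apply NNPP; eauto. }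
  intros Hw Hw'; destruct (Hex w Hw) as [u Hu], (Hex w' Hw') as [u' Hu'].
  destruct (Cplx_dec (pair u w') C0) as [E|H]; [|eauto].
  destruct (Cplx_dec (pair u' w) C0) as [E'|H]; [|eauto].
  exists (vadd u u'); rewrite !pair_addl, E, E'; split.
  - now replace (Cadd (pair u w) C0) with (pair u w) by ring.
  - now replace (Cadd C0 (pair u' w')) with (pair u' w') by ring.
Qed.

(* For fixed [w], the functionals [S w (T _)] and [pair _ w] have equal powers, hence the same
   kernel, hence are proportional; likewise for fixed [u], and the ratios all agree. *)
Lemma pairing_ratio : exists lam, Cpow lam (k + 2) = C1 /\ forall u w, S w (T u) = Cmul lam (pair u w).
Proof.
  assert (Hker : forall u w, pair u w = C0 -> S w (T u) = C0).
  { intros u w E; apply (Cpow_eq0 _ (k + 2)); rewrite ST_pow, E; apply Cpow_C0; lia. }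
  assert (Hw : forall w, exists a, forall u, S w (T u) = Cmul a (pair u w)).
  { intros w; apply (linear_proportional (fun u => pair u w) (fun u => S w (T u))); auto.
    - intros u u'; now rewrite T_add, (dual_add _ (S_dual w)).
    - intros a u; now rewrite T_scal, (dual_scal _ (S_dual w)). }
  assert (Hu : forall u, exists a, forall w, S w (T u) = Cmul a (pair u w)).
  { intros u; apply (linear_proportional (fun w => pair u w) (fun w => S w (T u))); auto. }
  assert (Hcancel : forall a b c, c <> C0 -> Cmul a c = Cmul b c -> a = b).
  { intros a b c Hc E; replace a with (Cmul (Cmul a c) (Cinv c)) by (field; exact Hc).
    rewrite E; field; exact Hc. }
  destruct U_nontrivial as [u0 Hu0].
  destruct (pair_nonzero2r u0 u0 Hu0 Hu0) as (w0 & Hp0 & _).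
  assert (Hw0 : w0 <> vzero) by (intros ->; apply Hp0, pair_zeror).
  destruct (Hw w0) as [lam Hlam]; exists lam; split.
  - apply (Hcancel _ _ (Cpow (pair u0 w0) (k + 2))); [now apply Cpow_neq0|].
    rewrite <- Cpow_mul_base, <- Hlam, ST_pow; ring.
  - intros u w; destruct (classic (w = vzero)) as [->|Hwne].
    { rewrite Hker; rewrite ?pair_zeror; ring. }
    destruct (Hw w) as [a Ha]; rewrite Ha; f_equal.
    (* The ratio at [u'] equals both the ratio at [w] and the ratio at [w0]. *)
    destruct (pair_nonzero2l w w0 Hwne Hw0) as (u' & H1 & H2).
    destruct (Hu u') as [b Hb].
    transitivity b; [apply (Hcancel _ _ (pair u' w) H1) | apply (Hcancel _ _ (pair u' w0) H2)];
      congruence.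
Qed.

Lemma pairing_T_onto y : exists u, T u = y.
Proof.
  destruct (classic (y = vzero)) as [->|Hy].
  - exists vzero; rewrite <- (vscal_0 vzero), T_scal; now rewrite !vscal_0.
  - destruct (dual_one y Hy) as (g & Hg & E); destruct (TS_onto y g Hg) as (u & w & H).
    apply (f_equal (fun F => F y)) in H; unfold rank1 in H; rewrite E, vscal_1 in H.
    exists (vscal (S w y) u); now rewrite T_scal.
Qed.

Lemma pairing_S_onto g : in_dual g -> exists w, S w = g.
Proof.
  intros Hg; destruct Y_nontrivial as [y Hy]; destruct (dual_one y Hy) as (h & Hh & E).
  destruct (TS_onto y g Hg) as (u & w & H); exists (vscal (h (T u)) w).
  apply functional_extensionality; intros v.
  apply (f_equal (fun F => h (F v))) in H; unfold rank1 in H; rewrite !(dual_scal h Hh), E in H.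
  rewrite S_scal; replace (g v) with (Cmul (g v) C1) by ring; rewrite H; ring.
Qed.

Lemma pairing_T_injective lam u : (forall u w, S w (T u) = Cmul lam (pair u w)) -> lam <> C0 ->
  T u = vzero -> u = vzero.
Proof.
  intros H Hlam E; apply pair_nondegl; intros w.
  pose proof (H u w) as G; rewrite E, (dual_zero _ (S_dual w)) in G; symmetry in G.
  destruct (Cmul_integral _ _ G); [contradiction | assumption].
Qed.

Lemma pairing_inverse lam : (forall u w, S w (T u) = Cmul lam (pair u w)) -> lam <> C0 ->
  exists Ti : Y -> U, (forall u, Ti (T u) = u) /\ (forall y, T (Ti y) = y) /\
    (forall y y', Ti (vadd y y') = vadd (Ti y) (Ti y')) /\
    (forall a y, Ti (vscal a y) = vscal a (Ti y)).
Proof.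
  intros H Hlam.
  set (Ti := fun y => proj1_sig (constructive_indefinite_description _ (pairing_T_onto y))).
  assert (HTi : forall y, T (Ti y) = y)
    by (intros y; exact (proj2_sig (constructive_indefinite_description _ (pairing_T_onto y)))).
  assert (Hinj : forall u u', T u = T u' -> u = u').
  { intros u u' E; apply vsub_eq0, (pairing_T_injective lam); [exact H | exact Hlam|].
    unfold vsub; rewrite T_add, vopp_scal, T_scal, <- vopp_scal, E; apply vadd_opp. }
  exists Ti; split; [|split; [exact HTi|split]].
  - intros u; apply Hinj, HTi.
  - intros y y'; apply Hinj; now rewrite T_add, !HTi.
  - intros a y; apply Hinj; now rewrite T_scal, !HTi.
Qed.

(** Let [v] be the difference of the two sides, written [T u']. The relation says that
    [(pair u w)^k * pair u' w] vanishes for all [w], which is impossible when [u] and [u'] are both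
    nonzero. *)
Lemma pairing_intertwine lam (P : Y -> Y) (Q : U -> U) :
  Cpow lam (k + 2) = C1 -> (forall u w, S w (T u) = Cmul lam (pair u w)) -> is_op P ->
  Q vzero = vzero ->
  (forall u w, Cmul (Cpow (pair u w) k) (pair (Q u) w)
               = Cmul (Cpow (S w (T u)) k) (S w (P (T u)))) ->
  forall u, P (T u) = vscal lam (T (Q u)).
Proof.
  intros Hpow H HP HQ Hrel u.
  assert (Hlam : lam <> C0).
  { intros E; apply C1_neq0; rewrite <- Hpow, E; apply Cpow_C0; lia. }
  destruct (classic (u = vzero)) as [->|Hu].
  { rewrite HQ. assert (E : T vzero = vzero)
      by (rewrite <- (vscal_0 vzero), T_scal; now rewrite !vscal_0).
    rewrite E, (op_zero P HP), vscal_vzero; reflexivity. }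
  apply vsub_eq0; set (v := vsub (P (T u)) (vscal lam (T (Q u)))).
  destruct (pairing_T_onto v) as [u' Eu'].
  destruct (classic (u' = vzero)) as [E|Hu'].
  { rewrite <- Eu', E, <- (vscal_0 vzero), T_scal; now rewrite !vscal_0. }
  exfalso; destruct (pair_nonzero2r u u' Hu Hu') as (w & H1 & H2).
  apply (Cmul_neq0 (Cpow (pair u w) k) (Cmul (Cpow lam (k + 1)) (pair u' w))).
  - now apply Cpow_neq0.
  - apply Cmul_neq0; [now apply Cpow_neq0 | exact H2].
  - transitivity (Cmul (Cpow (S w (T u)) k) (S w v)).
    + rewrite <- Eu', !H, Cpow_mul_base, Cpow_add; simpl; ring.
    + unfold v, vsub.
      rewrite (dual_add _ (S_dual w)), (dual_opp _ (S_dual w)), (dual_scal _ (S_dual w)).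
      transitivity (Csub (Cmul (Cpow (S w (T u)) k) (S w (P (T u))))
        (Cmul (Cmul (Cpow (S w (T u)) k) lam) (S w (T (Q u))))); [ring|].
      rewrite <- Hrel, !H, Cpow_mul_base.
      (* The two terms differ by the factor [1 - lam^(k+2)]; here [lam^m = 1] enters. *)
      transitivity (Cmul (Csub C1 (Cpow lam (k + 2))) (Cmul (Cpow (pair u w) k) (pair (Q u) w))).
      * rewrite Cpow_add; simpl; ring.
      * rewrite Hpow; ring.
Qed.

End Pairing.

(** * Adjoints on the bundled dual *)

Section Adjoint.
Context {X : CBanach}.

Definition adjoint (A : X -> X) (HA : is_op A) (f : dual X) : dual X :=
  exist _ _ (dual_comp (dfun f) A (dfun_dual f) HA).

Lemma adjoint_apply A HA f x : dfun (adjoint A HA f) x = dfun f (A x).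
Proof. reflexivity. Qed.

Lemma adjoint_op A HA : is_op (adjoint A HA).
Proof.
  destruct (op_bound A HA) as (c & Hc0 & Hc); apply is_op_intro with c.
  - intros f g; apply dcar_ext; reflexivity.
  - intros a f; apply dcar_ext; reflexivity.
  - intros f; pose proof (dnorm_pos f) as Hf. apply dnorm_min; [change (0 <= c * dnorm f); nra|].
    intros x; rewrite adjoint_apply; pose proof (dnorm_spec f (A x)); specialize (Hc x).
    change (Cabs (dfun f (A x)) <= c * dnorm f * vnorm x); nra.
Qed.

Lemma adjoint_pow A HA n f x : dfun (opow (adjoint A HA) n f) x = dfun f (opow A n x).
Proof.
  revert x; induction n as [|n IH]; intros x; [reflexivity|].
  rewrite opow_S, adjoint_apply, IH; f_equal.
  change (opow A n (opow A 1 x) = opow A 1 (opow A n x)); rewrite <- !opow_add; f_equal; lia.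
Qed.

Lemma adjoint_prod A HA B HB r s HC f :
  prod_op (adjoint B HB) r (adjoint A HA) s f = adjoint (prod_op B s A r) HC f.
Proof.
  apply dcar_ext; intros x; unfold prod_op; rewrite adjoint_pow, adjoint_apply, adjoint_pow; reflexivity.
Qed.

(** If [R] inverts the adjoint, [f => R f x] belongs to the bidual; reflexivity represents it by a
    point [Q x], and [Q] inverts [A]. *)
Lemma adjoint_invertible A HA : reflexive X -> invertible_op (adjoint A HA) -> invertible_op A.
Proof.
  intros Hrefl [R (_ & HR & HRl & HRr)].
  destruct (op_bound R HR) as (c & Hc0 & Hc).
  assert (Hex : forall x, exists x', forall f : dual X, dfun f x' = dfun (R f) x).
  { intros x.
    (* [reflexive] quantifies over maps on all functions, so [phi] gets the default value 0 off the
       dual. *)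
    set (phi := fun f : X -> Cplx => match excluded_middle_informative (in_dual f) with
                | left H => dfun (R (exist _ f H)) x | right _ => C0 end).
    assert (Ephi : forall f : dual X, phi (dfun f) = dfun (R f) x).
    { intros [f Hf]; unfold phi; simpl.
      destruct (excluded_middle_informative (in_dual f)) as [H|H]; [|contradiction].
      now rewrite (proof_irrelevance _ H Hf). }
    destruct (Hrefl phi) as [x' Hx'].
    - split.
      + intros a f g Hf Hg; split.
        * set (f' := exist _ f Hf : dual X). set (g' := exist _ g Hg : dual X).
          transitivity (dfun (R (vadd f' g')) x); [apply (Ephi (vadd f' g'))|].
          rewrite (op_add R HR).
          transitivity (Cadd (dfun (R f') x) (dfun (R g') x)); [reflexivity|].
          now rewrite <- !Ephi.
        * set (f' := exist _ f Hf : dual X).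
          transitivity (dfun (R (vscal a f')) x); [apply (Ephi (vscal a f'))|].
          rewrite (op_scal R HR).
          transitivity (Cmul a (dfun (R f') x)); [reflexivity|].
          now rewrite <- Ephi.
      + exists (c * vnorm x); intros f a Hf Ha.
        set (f' := exist _ f Hf : dual X).
        pose proof (Ephi f') as E; simpl in E; rewrite E.
        pose proof (dnorm_spec (R f') x) as H1; pose proof (Hc f') as H2.
        change (dnorm (R f') <= c * dnorm f') in H2.
        pose proof (vnorm_pos x) as Hx.
        (* A bound [dnorm_le f a] forces [0 <= a] only in the presence of a vector of positive norm;
           for [x = 0] both sides vanish. *)
        destruct (Rle_lt_or_eq_dec 0 (vnorm x) Hx) as [Hx0|Hx0].
        * assert (Ha0 : 0 <= a).
          { pose proof (Ha x) as H3; pose proof (Cabs_pos (f x)); apply Rnot_lt_le; intros Hneg; nra. }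
          pose proof (dnorm_min f' a Ha0 Ha) as H3.
          assert (c * dnorm f' <= c * a) by (apply Rmult_le_compat_l; lra).
          nra.
        * rewrite <- Hx0 in *; rewrite Rmult_0_r in H1; lra.
    - exists x'; intros f; rewrite <- Ephi; symmetry; apply Hx', dfun_dual. }
  set (Q := fun x => proj1_sig (constructive_indefinite_description _ (Hex x))).
  assert (HQ : forall x (f : dual X), dfun f (Q x) = dfun (R f) x)
    by (intros x; exact (proj2_sig (constructive_indefinite_description _ (Hex x)))).
  assert (Hsep : forall x y : X, (forall f : dual X, dfun f x = dfun f y) -> x = y).
  { intros x y H; apply dual_eq; intros f Hf; apply (H (exist _ f Hf)). }
  exists Q; split; [exact HA|]; split; [|split].
  - apply is_op_intro with c.
    + intros x y; apply Hsep; intros f.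
      now rewrite (dual_add _ (dfun_dual f)), !HQ, (dual_add _ (dfun_dual (R f))).
    + intros a x; apply Hsep; intros f.
      now rewrite (dual_scal _ (dfun_dual f)), !HQ, (dual_scal _ (dfun_dual (R f))).
    + intros x; destruct (norming_functional (Q x)) as (f & Hf & Hf1 & E).
      set (f' := exist _ f Hf : dual X). pose proof (HQ x f') as E'; simpl in E'.
      rewrite E in E'; apply (f_equal Cabs) in E'.
      rewrite Cabs_RtoC, Rabs_pos_eq in E' by apply vnorm_pos; rewrite E'.
      pose proof (dnorm_spec (R f') x) as H1; pose proof (Hc f') as H2.
      pose proof (dnorm_min f' 1 ltac:(lra) Hf1) as H3.
      change (dnorm (R f') <= c * dnorm f') in H2. pose proof (vnorm_pos x) as Hx.
      assert (c * dnorm f' <= c * 1) by (apply Rmult_le_compat_l; lra).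
      nra.
  - intros x; apply Hsep; intros f; rewrite HQ, <- (adjoint_apply A HA), HRr; reflexivity.
  - intros x; apply Hsep; intros f; rewrite <- (adjoint_apply A HA), HQ, HRl; reflexivity.
Qed.

Lemma adjoint_shift A HA z Hz : shift (adjoint A HA) z = adjoint (shift A z) Hz.
Proof.
  apply functional_extensionality; intros f; apply dcar_ext; intros x.
  rewrite adjoint_apply; unfold shift.
  rewrite (dual_add _ (dfun_dual f)), (dual_opp _ (dfun_dual f)), (dual_scal _ (dfun_dual f)).
  simpl; ring.
Qed.

Lemma spectrum_adjoint A HA z : reflexive X -> spectrum A z <-> spectrum (adjoint A HA) z.
Proof.
  intros Hrefl; rewrite !spectrum_alt, (adjoint_shift A HA z (is_op_shift A z HA)); split; intros H Hinv; apply H.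
  - revert Hinv; now apply adjoint_invertible.
  - destruct Hinv as [Q (HT & HQ & Hl & Hr)].
    exists (adjoint Q HQ); split; [apply adjoint_op|]; split; [apply adjoint_op|].
    split; intros f; apply dcar_ext; intros x; rewrite !adjoint_apply; f_equal; auto.
Qed.

End Adjoint.

Lemma spectrum_similar_sub {U Y : CBanach} (T : U -> Y) (Ti : Y -> U) (C : U -> U) (D : Y -> Y) z :
  inverse_ops T Ti -> is_op C -> (forall y, D y = T (C (Ti y))) -> spectrum D z -> spectrum C z.
Proof.
  intros (HT & HTi & Hl & Hr) HC HD Hsp [Q (_ & HQ & HQl & HQr)]; apply Hsp.
  assert (E : forall y, shift D z y = T (shift C z (Ti y))).
  { intros y; unfold shift; rewrite (op_add T HT), (op_opp T HT), (op_scal T HT), Hr, HD; reflexivity. }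
  exists (fun y => T (Q (Ti y))).
  assert (HDop : is_op D).
  { replace D with (fun y => T (C (Ti y))) by (symmetry; now apply functional_extensionality).
    apply (is_op_comp T); [exact HT|]; now apply (is_op_comp C). }
  split; [now apply is_op_shift|]; split; [|split].
  - apply (is_op_comp T); [exact HT|]; now apply (is_op_comp Q).
  - intros y; change (T (Q (Ti (shift D z y))) = y); rewrite E, Hl.
    unfold shift; now rewrite HQl, Hr.
  - intros y; change (shift D z (T (Q (Ti y))) = y); rewrite E, Hl.
    unfold shift; now rewrite HQr, Hr.
Qed.

Lemma spectrum_similar {U Y : CBanach} (T : U -> Y) (Ti : Y -> U) (C : U -> U) (D : Y -> Y) z :
  inverse_ops T Ti -> is_op C -> (forall y, D y = T (C (Ti y))) -> spectrum C z <-> spectrum D z.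
Proof.
  intros HTT HC HD. assert (HTT' := HTT). destruct HTT' as (HT & HTi & Hl & Hr).
  assert (HDop : is_op D).
  { replace D with (fun y => T (C (Ti y))) by (symmetry; now apply functional_extensionality).
    apply (is_op_comp T); [exact HT|]; now apply (is_op_comp C). }
  split; [|now apply (spectrum_similar_sub T Ti)].
  apply (spectrum_similar_sub Ti T); [split; auto | exact HDop|].
  intros u; now rewrite HD, !Hl.
Qed.

(** Each of the [r + s + 1] factors contributes one [lam], and together they cancel. *)
Lemma prod_scaled_similar {U Y : CBanach} (T : U -> Y) (Ti : Y -> U) (A B : U -> U) (A' B' : Y -> Y)
  lam r s : inverse_ops T Ti -> is_op A -> is_op B -> Cpow lam (r + s + 1) = C1 ->
  (forall y, A' y = vscal lam (T (A (Ti y)))) -> (forall y, B' y = vscal lam (T (B (Ti y)))) ->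
  forall y, prod_op B' r A' s y = T (prod_op B r A s (Ti y)).
Proof.
  intros (HT & HTi & Hl & Hr) HA HB Hlam EA EB.
  assert (Hpow : forall n y, opow B' n y = vscal (Cpow lam n) (T (opow B n (Ti y)))).
  { intros n; induction n as [|n IH]; intros y.
    - simpl; now rewrite vscal_1, Hr.
    - rewrite !opow_S, EB, IH, (op_scal Ti HTi), Hl, (op_scal B HB), (op_scal T HT); simpl; vector. }
  intros y; unfold prod_op; rewrite Hpow, EA, Hpow.
  rewrite !(op_scal Ti HTi), !Hl, (op_scal A HA).
  rewrite !(op_scal _ (is_op_pow B r HB)), !(op_scal T HT), !vscal_assoc.
  replace (Cmul (Cmul (Cpow lam r) lam) (Cpow lam s)) with (Cpow lam (r + s + 1)).
  - now rewrite Hlam, vscal_1.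
  - rewrite !Cpow_add; simpl; ring.
Qed.

(** * Peripheral spectrum preservers *)

(** Passes from the bare-function form in the statement to bounded operators on the bundled dual. *)
Lemma dual_inverse_ops_operators {X Y : CBanach} (T : (X -> Cplx) -> Y) (S : Y -> (X -> Cplx)) :
  dual_inverse_ops T S -> exists (T0 : dual X -> Y) (S0 : Y -> dual X),
    inverse_ops T0 S0 /\ (forall f, T0 f = T (dfun f)) /\ (forall y, dfun (S0 y) = S y).
Proof.
  intros (HTlin & (c & HTb) & HSd & HSlin & (d & HSb) & HST & HTS).
  exists (fun f => T (dfun f)), (fun y => exist _ (S y) (HSd y)); split; [|split; reflexivity].
  split; [|split; [|split]].
  - apply is_op_intro with c.
    + intros f g; apply (HTlin C0 _ _ (dfun_dual f) (dfun_dual g)).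
    + intros a f; apply (HTlin a _ _ (dfun_dual f) (dfun_dual f)).
    + intros f; apply HTb; [apply dfun_dual | apply dnorm_spec].
  (* The given constant [d] may be negative, while [dnorm_min] asks for a nonnegative bound. *)
  - apply is_op_intro with (Rabs d).
    + intros y y'; apply dcar_ext; intros x; simpl; now rewrite (proj1 (HSlin C0 y y')).
    + intros a y; apply dcar_ext; intros x; simpl; now rewrite (proj2 (HSlin a y y)).
    + intros y; pose proof (vnorm_pos y); pose proof (Rabs_pos d).
      apply dnorm_min; [nra|]; intros x; simpl; eapply Rle_trans; [apply HSb|].
      pose proof (vnorm_pos x); pose proof (Rle_abs d).
      apply Rmult_le_compat_r; [assumption|]; nra.
  - intros f; apply dcar_ext; intros x; simpl; now rewrite (HST _ (dfun_dual f)).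
  - intros y; apply HTS.
Qed.

Section Preserver.
Context (X1 X2 : CBanach) (A1 : (X1 -> X1) -> Prop) (A2 : (X2 -> X2) -> Prop)
  (hA1 : standard_alg A1) (hA2 : standard_alg A2) (r s : nat) (hrs : (1 <= r + s)%nat)
  (Phi : (X1 -> X1) -> (X2 -> X2)) (hPhi : forall A, A1 A -> A2 (Phi A)).

Lemma A1_op A : A1 A -> is_op A.
Proof. apply hA1. Qed.

Lemma Phi_op A : A1 A -> is_op (Phi A).
Proof. intros HA; apply hA2; auto. Qed.

(** * Sufficiency: both forms preserve peripheral spectra *)

Lemma similarity_preserves lam (T : X1 -> X2) (S : X2 -> X1) :
  Cpow lam (r + s + 1) = C1 -> inverse_ops T S ->
  (forall A, A1 A -> forall y, Phi A y = vscal lam (T (A (S y)))) ->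
  forall A B, A1 A -> A1 B -> forall z,
    peripheral_spectrum (prod_op B r A s) z <-> peripheral_spectrum (prod_op (Phi B) r (Phi A) s) z.
Proof.
  intros Hlam HT E A B HA HB z. apply peripheral_similar; intros w.
  apply (spectrum_similar T S); [exact HT | apply is_op_prod; now apply A1_op|].
  apply (prod_scaled_similar T S A B _ _ lam); auto; now apply A1_op.
Qed.

Lemma dual_similarity_preserves lam (T : (X1 -> Cplx) -> X2) (S : X2 -> (X1 -> Cplx)) :
  reflexive X1 -> Cpow lam (r + s + 1) = C1 -> dual_inverse_ops T S ->
  (forall A, A1 A -> forall y, Phi A y = vscal lam (T (fun x => S y (A x)))) ->
  forall A B, A1 A -> A1 B -> forall z,
    peripheral_spectrum (prod_op B r A s) z <-> peripheral_spectrum (prod_op (Phi B) r (Phi A) s) z.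
Proof.
  intros Hrefl Hlam HTS E A B HA HB z.
  destruct (dual_inverse_ops_operators T S HTS) as (T0 & S0 & HT0 & ET & ES).
  assert (EP : forall A (HA : A1 A) y, Phi A y = vscal lam (T0 (adjoint A (A1_op A HA) (S0 y)))).
  { intros A' HA' y; rewrite E, ET by exact HA'; do 2 f_equal.
    apply functional_extensionality; intros x; now rewrite adjoint_apply, ES. }
  assert (HC : is_op (prod_op B s A r)) by (apply is_op_prod; now apply A1_op).
  transitivity (peripheral_spectrum (prod_op B s A r) z).
  { split; apply peripheral_prod_swap; now apply A1_op. }
  apply peripheral_similar; intros w; rewrite (spectrum_adjoint _ HC w Hrefl).
  apply (spectrum_similar T0 S0); [exact HT0 | apply adjoint_op|].
  intros y; rewrite <- (adjoint_prod A (A1_op A HA) B (A1_op B HB)).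
  apply (prod_scaled_similar T0 S0 (adjoint A (A1_op A HA)) (adjoint B (A1_op B HB)) _ _ lam);
    auto; apply adjoint_op.
Qed.

(** * Necessity: the structure of a preserver between nonzero spaces *)

Context (hrange : forall F : X2 -> X2, is_op F -> rank_le2 F -> exists A, A1 A /\ Phi A = F)
  (Hper : forall A B, A1 A -> A1 B -> forall z,
    peripheral_spectrum (prod_op B r A s) z <-> peripheral_spectrum (prod_op (Phi B) r (Phi A) s) z)
  (Hne1 : exists x : X1, x <> vzero) (Hne2 : exists y : X2, y <> vzero).

Lemma A1_rank_le2 F : is_op F -> rank_le2 F -> A1 F.
Proof. intros HF H2; apply hA1; [exact HF | now apply rank_le2_finite]. Qed.

Lemma A1_rank1 x f : in_dual f -> A1 (rank1 x f).
Proof.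
  intros Hf; apply A1_rank_le2; [now apply rank1_op|].
  apply rank_le1_rank_le2; exists x, f; auto.
Qed.

Lemma A1_lincomb a b A A' : A1 A -> A1 A' -> A1 (fun x => vadd (vscal a (A x)) (vscal b (A' x))).
Proof.
  destruct hA1 as (_ & Hadd & Hscal & _); intros HA HA'.
  apply (Hadd (fun x => vscal a (A x)) (fun x => vscal b (A' x))); auto.
Qed.

(** A test operator on X2 is a value of [Phi] by [hrange]; one on X1 belongs to the algebra because
    it has finite rank. *)
Lemma Phi_rank_le1 A : A1 A -> rank_le1 A <-> rank_le1 (Phi A).
Proof.
  intros HA; split.
  - intros (x & f & Hf & E); apply (rank_le1_of_peripheral _ r s); [now apply Phi_op | exact hrs|].
    intros B' HB' H2 z w Hz Hw; destruct (hrange B' HB' H2) as (B & HB & <-).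
    apply Hper in Hz, Hw; try assumption. rewrite E in Hz, Hw.
    apply prod_rank1_middle in Hz, Hw; try assumption; try now apply A1_op. congruence.
  - intros (y & g & Hg & E); apply (rank_le1_of_peripheral _ r s); [now apply A1_op | exact hrs|].
    intros B HB H2 z w Hz Hw. assert (HBA := A1_rank_le2 B HB H2).
    apply Hper in Hz, Hw; try assumption. rewrite E in Hz, Hw.
    apply prod_rank1_middle in Hz, Hw; try assumption; try now apply Phi_op. congruence.
Qed.

Lemma Phi_rank1_relation A x f y g : A1 A -> in_dual f -> in_dual g ->
  Phi (rank1 x f) = rank1 y g ->
  Cmul (Cpow (f x) (r + s - 1)) (f (A x)) = Cmul (Cpow (g y) (r + s - 1)) (g (Phi A y)).
Proof.
  intros HA Hf Hg E.
  apply (prod_rank1_outer (Phi A) y g r s _ Hne2 (Phi_op A HA) Hg hrs); rewrite <- E.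
  apply Hper; [exact HA | now apply A1_rank1|].
  now apply (prod_rank1_outer A x f r s _ Hne1 (A1_op A HA) Hf hrs).
Qed.

Lemma Phi_onto_rank1 y g : in_dual g -> exists x f, in_dual f /\ Phi (rank1 x f) = rank1 y g.
Proof.
  intros Hg; assert (H1 : rank_le1 (rank1 y g)) by (exists y, g; auto).
  destruct (hrange (rank1 y g)) as (A & HA & E);
    [now apply rank1_op | now apply rank_le1_rank_le2|].
  assert (HA1 : rank_le1 A) by (apply Phi_rank_le1; [exact HA | now rewrite E]).
  destruct HA1 as (x & f & Hf & ->); eauto.
Qed.

(** If [D x] were nonzero, some functional would be nonzero at both [x] and [D x]. *)
Lemma operator_zero_of_rank1 {X : CBanach} (D : X -> X) k : is_op D ->
  (forall x f, in_dual f -> Cmul (Cpow (f x) k) (f (D x)) = C0) -> forall x, D x = vzero.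
Proof.
  intros HD H x; apply NNPP; intros Hx.
  assert (Hx0 : x <> vzero) by (intros ->; apply Hx; now apply op_zero).
  destruct (dual_nonzero2 x (D x) Hx0 Hx) as (f & Hf & H1 & H2).
  apply (Cmul_neq0 _ _ (Cpow_neq0 _ k H1) H2); auto.
Qed.

(** Every rank-one operator on X2 comes from one on X1, so the rank-one relation holds at every [y]
    and [g]; its left side is linear in the operator, hence so is its right side, and
    [operator_zero_of_rank1] concludes. *)
Lemma Phi_linear a b A A' C : A1 A -> A1 A' ->
  (forall x, C x = vadd (vscal a (A x)) (vscal b (A' x))) ->
  forall y, Phi C y = vadd (vscal a (Phi A y)) (vscal b (Phi A' y)).
Proof.
  intros HA HA' HC.
  assert (HCA : A1 C).
  { replace C with (fun x => vadd (vscal a (A x)) (vscal b (A' x))); [now apply A1_lincomb|].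
    symmetry; now apply functional_extensionality. }
  pose proof (Phi_op A HA) as OA; pose proof (Phi_op A' HA') as OA'; pose proof (Phi_op C HCA) as OC.
  set (D := fun y => vadd (vscal C1 (Phi C y))
              (vscal (Copp C1) (vadd (vscal a (Phi A y)) (vscal b (Phi A' y))))).
  assert (HD : forall y, D y = vzero).
  { apply (operator_zero_of_rank1 D (r + s - 1)).
    - apply is_op_lincomb; [exact OC | now apply is_op_lincomb].
    - intros y g Hg; destruct (Phi_onto_rank1 y g Hg) as (x & f & Hf & E).
      pose proof (Phi_rank1_relation A x f y g HA Hf Hg E) as RA.
      pose proof (Phi_rank1_relation A' x f y g HA' Hf Hg E) as RA'.
      pose proof (Phi_rank1_relation C x f y g HCA Hf Hg E) as RC.
      unfold D; rewrite !(dual_add g Hg), !(dual_scal g Hg), (dual_add g Hg), !(dual_scal g Hg).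
      rewrite HC, (dual_add f Hf), !(dual_scal f Hf) in RC.
      transitivity (Csub (Cmul (Cpow (g y) (r + s - 1)) (g (Phi C y)))
        (Cadd (Cmul a (Cmul (Cpow (g y) (r + s - 1)) (g (Phi A y))))
              (Cmul b (Cmul (Cpow (g y) (r + s - 1)) (g (Phi A' y)))))); [ring|].
      rewrite <- RA, <- RA', <- RC; ring. }
  intros y; apply vsub_eq0; rewrite <- (HD y); unfold D; vector.
Qed.

Lemma Phi_injective A A' : A1 A -> A1 A' -> Phi A = Phi A' -> A = A'.
Proof.
  intros HA HA' E; apply functional_extensionality; intros x; apply vsub_eq0.
  transitivity (vadd (vscal C1 (A x)) (vscal (Copp C1) (A' x))); [vector|]. revert x.
  apply (operator_zero_of_rank1 (fun x => vadd (vscal C1 (A x)) (vscal (Copp C1) (A' x))) (r + s - 1)).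
  - apply is_op_lincomb; now apply A1_op.
  - intros x f Hf.
    assert (H1 : rank_le1 (Phi (rank1 x f))).
    { apply Phi_rank_le1; [now apply A1_rank1 | exists x, f; auto]. }
    destruct H1 as (y & g & Hg & Ey).
    pose proof (Phi_rank1_relation A x f y g HA Hf Hg Ey) as RA.
    pose proof (Phi_rank1_relation A' x f y g HA' Hf Hg Ey) as RA'. rewrite E in RA.
    rewrite (dual_add f Hf), !(dual_scal f Hf).
    transitivity (Csub (Cmul (Cpow (f x) (r + s - 1)) (f (A x)))
      (Cmul (Cpow (f x) (r + s - 1)) (f (A' x)))); [ring|].
    rewrite RA, RA'; ring.
Qed.

Definition Phi_beta (x : X1) (f : dual X1) : X2 -> X2 := Phi (rank1 x (dfun f)).

Lemma Phi_beta_bilinear : bilinear_ops Phi_beta.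
Proof.
  assert (HA : forall x (f : dual X1), A1 (rank1 x (dfun f))) by (intros; apply A1_rank1, dfun_dual).
  unfold Phi_beta; split; [|split; [|split]].
  - intros x x' f v; rewrite (Phi_linear C1 C1 (rank1 x (dfun f)) (rank1 x' (dfun f))), !vscal_1; auto.
    intros u; unfold rank1; vector.
  - intros a x f v; rewrite (Phi_linear a C0 (rank1 x (dfun f)) (rank1 x (dfun f))), vscal_0, vadd_0r; auto.
    intros u; unfold rank1; vector.
  - intros x f f' v; rewrite (Phi_linear C1 C1 (rank1 x (dfun f)) (rank1 x (dfun f'))), !vscal_1; auto.
    intros u; unfold rank1. change (dfun (vadd f f') u) with (Cadd (dfun f u) (dfun f' u)); vector.
  - intros a x f v; rewrite (Phi_linear a C0 (rank1 x (dfun f)) (rank1 x (dfun f))), vscal_0, vadd_0r; auto.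
    intros u; unfold rank1. change (dfun (vscal a f) u) with (Cmul a (dfun f u)); vector.
Qed.

(** Nondegeneracy comes from injectivity of [Phi]. The dependence condition is pulled back to X1,
    where [rank1_sum] decides when a sum of two rank-one operators has rank at most one. *)
Lemma Phi_beta_tensor : tensor_form Phi_beta \/ tensor_form (fun f x => Phi_beta x f).
Proof.
  assert (HA : forall x (f : dual X1), A1 (rank1 x (dfun f))) by (intros; apply A1_rank1, dfun_dual).
  destruct Hne1 as [x0 Hx0]; destruct (dual_one x0 Hx0) as (f0 & Hf0 & E0).
  apply (bilinear_rank_one Phi_beta x0 (exist _ f0 Hf0 : dual X1)).
  - apply Phi_beta_bilinear.
  - intros x f; apply Phi_rank_le1; [apply HA|]; exists x, (dfun f); split; [apply dfun_dual | reflexivity].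
  - intros x f Hz.
    assert (HA0 : A1 (rank1 vzero (dfun f))) by apply HA.
    assert (E : rank1 x (dfun f) = rank1 vzero (dfun f)).
    { apply Phi_injective; auto. apply functional_extensionality; intros v.
      transitivity (vzero : X2); [apply Hz|].
      rewrite (Phi_linear C0 C0 (rank1 x (dfun f)) (rank1 x (dfun f))), vscal_0; auto.
      - symmetry; apply vadd_0.
      - intros u; unfold rank1; vector. }
    destruct (classic (x = vzero)) as [|Hx]; [now left | right].
    apply dcar_ext; intros v; apply (f_equal (fun F => F v)) in E; unfold rank1 in E.
    rewrite vscal_vzero in E; destruct (vscal_eq0 _ _ E); [assumption | contradiction].
  - intros x x' f f' H.
    set (F := fun v => vadd (rank1 x (dfun f) v) (rank1 x' (dfun f') v)).
    assert (EF : forall v, F v = vadd (vscal C1 (rank1 x (dfun f) v)) (vscal C1 (rank1 x' (dfun f') v)))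
      by (intros v; unfold F; vector).
    assert (HF : A1 F).
    { replace F with (fun v => vadd (vscal C1 (rank1 x (dfun f) v)) (vscal C1 (rank1 x' (dfun f') v)))
        by (symmetry; now apply functional_extensionality). now apply A1_lincomb. }
    assert (HrF : rank_le1 F).
    { apply Phi_rank_le1; [exact HF|].
      replace (Phi F) with (fun v => vadd (Phi_beta x f v) (Phi_beta x' f' v)); [exact H|].
      apply functional_extensionality; intros v; unfold Phi_beta.
      rewrite (Phi_linear C1 C1 _ _ F (HA x f) (HA x' f') EF), !vscal_1; reflexivity. }
    destruct (classic (x' = vzero)) as [->|Hx']; [left; apply dep_sym; now left|].
    destruct (classic (exists v, dfun f' v <> C0)) as [[v Hv]|Hno].
    + destruct (functional_at_one _ v (dfun_dual f') Hv) as [v0 Ev0].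
      destruct (rank1_sum x x' _ _ v0 (dfun_dual f) (dfun_dual f') Hx' Ev0 HrF) as [[a Ha]|[a Ha]].
      * left; apply dep_sym; right; eauto.
      * right; apply dep_sym; right; exists a; apply dcar_ext; exact Ha.
    + right; apply dep_sym; left; apply dcar_ext; intros v; simpl; apply NNPP; eauto.
  - exact Hx0.
  - intros E; apply C1_neq0; rewrite <- E0; exact (f_equal (fun f : dual X1 => dfun f x0) E).
Qed.

Lemma exponent_eq : (r + s - 1 + 2 = r + s + 1)%nat.
Proof. lia. Qed.

(** The rank-one relation with [A] equal to the rank-one operator itself: [f (A x)] is then the
    square of [f x], raising the exponent from [m - 2] to [m]. *)
Lemma Phi_beta_trace_power x f y g : in_dual g -> Phi_beta x f = rank1 y g ->
  Cpow (g y) (r + s - 1 + 2) = Cpow (dfun f x) (r + s - 1 + 2).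
Proof.
  intros Hg E.
  pose proof (Phi_rank1_relation _ x _ y g (A1_rank1 x _ (dfun_dual f)) (dfun_dual f) Hg E) as H.
  unfold Phi_beta in E; rewrite E in H; unfold rank1 in H.
  rewrite (dual_scal g Hg), (dual_scal _ (dfun_dual f)) in H.
  rewrite !Cpow_add; simpl. transitivity (Cmul (Cpow (g y) (r + s - 1)) (Cmul (g y) (g y))); [ring|].
  rewrite <- H; ring.
Qed.

Lemma Phi_beta_onto y g : in_dual g -> exists x f, rank1 y g = Phi_beta x f.
Proof.
  intros Hg; destruct (Phi_onto_rank1 y g Hg) as (x & f & Hf & E).
  exists x, (exist _ f Hf : dual X1); symmetry; exact E.
Qed.

Lemma dual_pair_nondegl (x : X1) : (forall f : dual X1, dfun f x = C0) -> x = vzero.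
Proof. intros H; apply dual_separates; intros f Hf; apply (H (exist _ f Hf)). Qed.

Lemma dual_pair_nondegr (f : dual X1) : (forall x, dfun f x = C0) -> f = vzero.
Proof. intros H; apply dcar_ext; exact H. Qed.

Lemma tensor_case_direct : tensor_form Phi_beta ->
  exists lam (T : X1 -> X2) (S : X2 -> X1), Cpow lam (r + s + 1) = C1 /\ inverse_ops T S /\
    forall A, A1 A -> forall y, Phi A y = vscal lam (T (A (S y))).
Proof.
  intros (T & S & Tadd & Tscal & Sd & Sadd & Sscal & E).
  assert (Hpow : forall x f, Cpow (S f (T x)) (r + s - 1 + 2) = Cpow (dfun f x) (r + s - 1 + 2))
    by (intros x f; apply Phi_beta_trace_power; auto).
  assert (Honto : forall y g, in_dual g -> exists x f, rank1 y g = rank1 (T x) (S f)).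
  { intros y g Hg; destruct (Phi_beta_onto y g Hg) as (x & f & H); exists x, f; now rewrite H, E. }
  set (pair := fun (x : X1) (f : dual X1) => dfun f x).
  assert (Pal : forall u u' w, pair (vadd u u') w = Cadd (pair u w) (pair u' w))
    by (intros u u' w; apply (dual_add _ (dfun_dual w))).
  assert (Psl : forall a u w, pair (vscal a u) w = Cmul a (pair u w))
    by (intros a u w; apply (dual_scal _ (dfun_dual w))).
  assert (Par : forall u w w', pair u (vadd w w') = Cadd (pair u w) (pair u w')) by reflexivity.
  assert (Psr : forall a u w, pair u (vscal a w) = Cmul a (pair u w)) by reflexivity.
  destruct (pairing_ratio pair T S (r + s - 1)) as (lam & Hlam & H); auto;
    [exact dual_pair_nondegl | exact dual_pair_nondegr|].
  assert (Hlam0 : lam <> C0) by (intros E0; apply C1_neq0; rewrite <- Hlam, E0; apply Cpow_C0; lia).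
  destruct (pairing_inverse pair T S) with (lam := lam) as (Ti & H1 & H2 & H3 & H4); auto;
    [exact dual_pair_nondegl|].
  exists lam, T, Ti; split; [now rewrite <- exponent_eq|].
  assert (HSon : forall g, in_dual g -> exists f, S f = g) by (apply (pairing_S_onto T S); auto).
  split; [split; [|split; [|split]]|]; auto.
  (* Every functional [g] on X2 is some [S f], and [g] composed with [T] is [lam f]; dually, [f]
     composed with the inverse is [lam^-1 S f]. *)
  - apply is_op_of_dual; auto. intros g Hg; destruct (HSon g Hg) as [f <-].
    replace (fun x => S f (T x)) with (fun x => Cmul lam (dfun f x))
      by (apply functional_extensionality; intros x; symmetry; apply H).
    apply dual_fscal, dfun_dual.
  - apply is_op_of_dual; auto. intros f Hf. set (f' := exist _ f Hf : dual X1).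
    replace (fun y => f (Ti y)) with (fun y => Cmul (Cinv lam) (S f' y)).
    + now apply dual_fscal.
    + apply functional_extensionality; intros y; rewrite <- (H2 y) at 1; rewrite H; unfold pair; simpl.
      field; exact Hlam0.
  - intros A HA y. rewrite <- (H2 y) at 1.
    apply (pairing_intertwine pair T S (r + s - 1)) with (Q := A); auto.
    + exact dual_pair_nondegl.
    + now apply Phi_op.
    + apply op_zero; now apply A1_op.
    + intros x f; apply (Phi_rank1_relation A x (dfun f)); auto; apply dfun_dual || apply E.
Qed.

Lemma tensor_case_dual : tensor_form (fun f x => Phi_beta x f) ->
  reflexive X1 /\ reflexive X2 /\
  exists lam (T : (X1 -> Cplx) -> X2) (S : X2 -> (X1 -> Cplx)),
    Cpow lam (r + s + 1) = C1 /\ dual_inverse_ops T S /\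
    forall A, A1 A -> forall y, Phi A y = vscal lam (T (fun x => S y (A x))).
Proof.
  intros (T & S & Tadd & Tscal & Sd & Sadd & Sscal & E).
  assert (Hpow : forall f x, Cpow (S x (T f)) (r + s - 1 + 2) = Cpow (dfun f x) (r + s - 1 + 2))
    by (intros f x; apply Phi_beta_trace_power; auto).
  assert (Honto : forall y g, in_dual g -> exists f x, rank1 y g = rank1 (T f) (S x)).
  { intros y g Hg; destruct (Phi_beta_onto y g Hg) as (x & f & H); exists f, x; now rewrite H, E. }
  set (pair := fun (f : dual X1) (x : X1) => dfun f x).
  assert (Pal : forall u u' w, pair (vadd u u') w = Cadd (pair u w) (pair u' w)) by reflexivity.
  assert (Psl : forall a u w, pair (vscal a u) w = Cmul a (pair u w)) by reflexivity.
  assert (Par : forall u w w', pair u (vadd w w') = Cadd (pair u w) (pair u w'))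
    by (intros u w w'; apply (dual_add _ (dfun_dual u))).
  assert (Psr : forall a u w, pair u (vscal a w) = Cmul a (pair u w))
    by (intros a u w; apply (dual_scal _ (dfun_dual u))).
  assert (Hned : exists f : dual X1, f <> vzero).
  { destruct Hne1 as [x Hx]; destruct (dual_one x Hx) as (f & Hf & Ef).
    exists (exist _ f Hf); intros E0; apply C1_neq0; rewrite <- Ef.
    exact (f_equal (fun f : dual X1 => dfun f x) E0). }
  destruct (pairing_ratio pair T S (r + s - 1)) as (lam & Hlam & H); auto;
    [exact dual_pair_nondegr | exact dual_pair_nondegl|].
  assert (Hlam0 : lam <> C0) by (intros E0; apply C1_neq0; rewrite <- Hlam, E0; apply Cpow_C0; lia).
  destruct (pairing_inverse pair T S) with (lam := lam) as (Ti & H1 & H2 & H3 & H4); auto;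
    [exact dual_pair_nondegr|].
  assert (HSon : forall g, in_dual g -> exists x, S x = g) by (apply (pairing_S_onto T S); auto).
  assert (HTi_at : forall y x, dfun (Ti y) x = Cmul (Cinv lam) (S x y)).
  { intros y x; rewrite <- (H2 y) at 2; rewrite H; unfold pair; field; exact Hlam0. }
  assert (HT : is_op T).
  { apply is_op_of_dual; auto. intros g Hg; destruct (HSon g Hg) as [x <-].
    replace (fun f => S x (T f)) with (fun f : dual X1 => Cmul lam (dfun f x))
      by (apply functional_extensionality; intros f; symmetry; apply H).
    apply (dual_fscal lam (fun f : dual X1 => dfun f x)), dual_point. }
  assert (HTi : is_op Ti).
  (* The values lie in a dual space and are controlled at points of X1, so uniform boundedness is
     applied there directly, without functionals of the bidual. *)
  { apply is_op_of_weakly_bounded; auto.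
    destruct (banach_steinhaus (fun f : dual X1 => exists y, vnorm y <= 1 /\ f = Ti y)) as [c Hc].
    - intros x; destruct (dual_bound _ (dual_fscal (Cinv lam) _ (Sd x))) as (c & Hc0 & Hc); exists c.
      intros f (y & Hy & ->); rewrite HTi_at; specialize (Hc y); pose proof (vnorm_pos y); nra.
    - exists c; intros y Hy; apply Hc; eauto. }
  destruct (op_bound T HT) as (c & Hc0 & Hc), (op_bound Ti HTi) as (d & Hd0 & Hd).
  split; [|split].
  (* Reflexivity of X1: [phi] composed with [Ti] is a functional on X2, hence some [S x], and
     [lam x] represents [phi]. *)
  - intros phi [Hphi (b & Hb)].
    destruct (HSon (fun y => phi (dfun (Ti y)))) as [x Hx].
    { apply in_dual_intro with (b * d).
      - intros y y'; rewrite H3.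
        exact (proj1 (Hphi C0 _ _ (dfun_dual (Ti y)) (dfun_dual (Ti y')))).
      - intros a y; rewrite H4.
        exact (proj2 (Hphi a _ _ (dfun_dual (Ti y)) (dfun_dual (Ti y)))).
      - intros y; rewrite Rmult_assoc; apply Hb; [apply dfun_dual|].
        intros x; eapply Rle_trans; [apply dnorm_spec|].
        apply Rmult_le_compat_r; [apply vnorm_pos | apply Hd]. }
    exists (vscal lam x); intros f Hf; set (f' := exist _ f Hf : dual X1).
    rewrite (dual_scal f Hf). change (f x) with (pair f' x); rewrite <- H, Hx, H1; reflexivity.
  (* Reflexivity of X2: [phi] composed with [S] is a functional [f] on X1, and [lam^-1 T f]
     represents [phi], every functional on X2 being some [S x]. *)
  - intros phi [Hphi (b & Hb)].
    assert (Hpsi : in_dual (fun x => phi (S x))).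
    { apply in_dual_intro with (b * (Cabs lam * d)).
      - intros x x'. rewrite <- (proj1 (Hphi C0 _ _ (Sd x) (Sd x'))); f_equal.
        apply functional_extensionality; intros y; apply Sadd.
      - intros a x. rewrite <- (proj2 (Hphi a _ _ (Sd x) (Sd x))); f_equal.
        apply functional_extensionality; intros y; apply Sscal.
      - intros x; rewrite Rmult_assoc; apply Hb; [apply Sd|].
        intros y. replace (S x y) with (Cmul lam (dfun (Ti y) x))
          by (rewrite HTi_at; field; exact Hlam0).
        rewrite Cabs_mul. pose proof (dnorm_spec (Ti y) x) as G1; pose proof (Hd y) as G2.
        change (dnorm (Ti y) <= d * vnorm y) in G2.
        pose proof (Cabs_pos lam); pose proof (vnorm_pos x).
        assert (dnorm (Ti y) * vnorm x <= d * vnorm y * vnorm x) by (apply Rmult_le_compat_r; assumption).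
        replace (Cabs lam * d * vnorm x * vnorm y) with (Cabs lam * (d * vnorm y * vnorm x)) by ring.
        apply Rmult_le_compat_l; lra. }
    set (f := exist _ _ Hpsi : dual X1).
    exists (vscal (Cinv lam) (T f)); intros g Hg; destruct (HSon g Hg) as [x <-].
    rewrite (dual_scal _ (Sd x)), H; unfold pair; simpl; field; exact Hlam0.
  (* The statement wants a map on bare functions; [T] is extended by 0 off the dual. *)
  - set (T' := fun f : X1 -> Cplx => match excluded_middle_informative (in_dual f) with
                | left Hf => T (exist _ f Hf) | right _ => vzero end).
    assert (ET : forall f : dual X1, T' (dfun f) = T f).
    { intros [f Hf]; unfold T'; simpl.
      destruct (excluded_middle_informative (in_dual f)) as [Hf'|Hf']; [|contradiction].
      now rewrite (proof_irrelevance _ Hf' Hf). }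
    exists lam, T', (fun y => dfun (Ti y)); split; [now rewrite <- exponent_eq|split].
    + split; [|split; [|split; [|split; [|split; [|split]]]]].
      * intros a f g Hf Hg; set (f' := exist _ f Hf : dual X1); set (g' := exist _ g Hg : dual X1).
        change f with (dfun f'); change g with (dfun g'); rewrite !ET; split.
        -- rewrite <- Tadd; apply (ET (vadd f' g')).
        -- rewrite <- Tscal; apply (ET (vscal a f')).
      * exists c; intros f a Hf Ha; set (f' := exist _ f Hf : dual X1).
        change f with (dfun f'); rewrite ET. eapply Rle_trans; [apply Hc|].
        apply Rmult_le_compat_l; [exact Hc0|].
        assert (Ha0 : 0 <= a).
        { destruct Hne1 as [x Hx]; pose proof (Ha x) as G; pose proof (Cabs_pos (f x)).
          assert (0 < vnorm x) by (destruct (vnorm_pos x) as [|E0]; [assumption|];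
            exfalso; apply Hx, vnorm_eq0; now symmetry).
          apply Rnot_lt_le; intros Hneg; nra. }
        apply (dnorm_min f' a Ha0 Ha).
      * intros y; apply dfun_dual.
      * intros a y y'; rewrite H3, H4; split; reflexivity.
      * exists d; intros y x; eapply Rle_trans; [apply dnorm_spec|].
        apply Rmult_le_compat_r; [apply vnorm_pos | apply Hd].
      * intros f Hf; set (f' := exist _ f Hf : dual X1).
        change f with (dfun f'); rewrite ET, H1; reflexivity.
      * intros y; rewrite ET; apply H2.
    + intros A HA y. rewrite <- (H2 y) at 1.
      change (fun x => dfun (Ti y) (A x)) with (dfun (adjoint A (A1_op A HA) (Ti y))); rewrite ET.
      apply (pairing_intertwine pair T S (r + s - 1)) with (Q := adjoint A (A1_op A HA)); auto.
      * exact dual_pair_nondegr.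
      * now apply Phi_op.
      * apply op_zero, adjoint_op.
      * intros f x; apply (Phi_rank1_relation A x (dfun f)); auto; apply dfun_dual || apply (E f x).
Qed.

End Preserver.

(** * The characterization, with the zero space included *)

Theorem theorem2p2 (X1 X2 : CBanach)
  (A1 : (X1 -> X1) -> Prop) (A2 : (X2 -> X2) -> Prop)
  (hA1 : standard_alg A1) (hA2 : standard_alg A2)
  (r s : nat) (hrs : (1 <= r + s)%nat)
  (Phi : (X1 -> X1) -> (X2 -> X2))
  (hPhi : forall A, A1 A -> A2 (Phi A))
  (hrange : forall F : X2 -> X2, is_op F -> rank_le2 F ->
              exists A, A1 A /\ Phi A = F) :
  (forall A B, A1 A -> A1 B -> forall z : Cplx,
      peripheral_spectrum (prod_op B r A s) z <->
      peripheral_spectrum (prod_op (Phi B) r (Phi A) s) z)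
  <->
  ((exists (lam : Cplx) (T : X1 -> X2) (S : X2 -> X1),
       Cpow lam (r + s + 1)%nat = C1 /\ inverse_ops T S /\
       forall A, A1 A -> forall y, Phi A y = vscal lam (T (A (S y))))
   \/
   (reflexive X1 /\ reflexive X2 /\
    exists (lam : Cplx) (T : (X1 -> Cplx) -> X2) (S : X2 -> (X1 -> Cplx)),
       Cpow lam (r + s + 1)%nat = C1 /\ dual_inverse_ops T S /\
       forall A, A1 A -> forall y,
         Phi A y = vscal lam (T (fun x => S y (A x))))).
Proof.
  split.
  - intros Hper.
    destruct (classic (exists x : X1, x <> vzero)) as [Hne1|Htriv1].
    + assert (Hne2 : exists y : X2, y <> vzero).
      (* A product with a rank-one factor on X1 has a peripheral value, so its counterpart on X2 has
         nonempty spectrum and X2 cannot be zero. *)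
      { destruct Hne1 as [x Hx]; destruct (dual_one x Hx) as (f & Hf & _).
        pose proof (A1_rank1 X1 A1 hA1 x f Hf) as HA.
        apply (nontrivial_of_spectrum (prod_op (Phi (rank1 x f)) r (Phi (rank1 x f)) s)
                 (f (opow (rank1 x f) (r + s) x))).
        - apply is_op_prod; apply hA2; auto.
        - apply Hper; auto. apply prod_rank1_middle; eauto using rank1_op. }
      destruct (Phi_beta_tensor X1 X2 A1 A2 hA1 hA2 r s hrs Phi hPhi hrange Hper Hne1 Hne2) as [H|H].
      * left; eapply tensor_case_direct; eauto.
      * right; eapply tensor_case_dual; eauto.
    + assert (H1 : forall x : X1, x = vzero) by (intros x; apply NNPP; eauto).
      assert (Heq : forall F G : X1 -> X1, F = G).
      { intros F G; apply functional_extensionality; intros x; now rewrite (H1 (F x)), (H1 (G x)). }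
      (* On the zero space there is only one operator, so [Phi] takes a single value there; a
         nonzero [y] would give two different operators in its range. *)
      assert (H2 : forall y : X2, y = vzero).
      { intros y; apply NNPP; intros Hy; destruct (dual_one y Hy) as (g & Hg & Eg).
        assert (Hr : forall u : X2, exists A, A1 A /\ Phi A = rank1 u g).
        { intros u; apply hrange; [now apply rank1_op|].
          apply rank_le1_rank_le2; exists u, g; auto. }
        destruct (Hr y) as (A & _ & EA), (Hr vzero) as (B & _ & EB).
        rewrite (Heq A B), EB in EA; apply (f_equal (fun F => F y)) in EA; unfold rank1 in EA.
        rewrite Eg, !vscal_1 in EA; now apply Hy. }
      (* Between zero spaces the zero map is its own inverse, and [lam = 1] will do. *)
      left; exists C1, (fun _ => vzero), (fun _ => vzero); split; [|split].
      * assert (E : forall n, Cpow C1 n = C1) by (intros n; induction n as [|n IH]; simpl; [|rewrite IH]; ring).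
        apply E.
      * split; [|split; [|split]].
        -- rewrite <- (rank1_zero (fun _ => C0)); apply rank1_op, dual_const0.
        -- rewrite <- (rank1_zero (fun _ => C0)); apply rank1_op, dual_const0.
        -- intros x; symmetry; apply H1.
        -- intros y; symmetry; apply H2.
      * intros A _ y; rewrite (H2 (Phi A y)); symmetry; apply vscal_vzero.
  - intros [(lam & T & S & Hlam & HT & E)|(Hrefl & _ & lam & T & S & Hlam & HT & E)].
    + now apply (similarity_preserves X1 X2 A1 hA1 r s Phi lam T S).
    + now apply (dual_similarity_preserves X1 X2 A1 hA1 r s Phi lam T S).
Qed.
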